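(* Let $n\ge 2$, $p_1,\dots,p_n>0$, $1\le k\le n$, let $\mathbb{E}=\mathbb{E}_{p_1,\dots,p_n}$ be the complex ellipsoid and $A=A_{\mathbb{E},k}=\{z\in\mathbb{E}: z_1\cdots z_k=0\}$. Let $m_{\mathbb{E}}(A,\cdot)$, $g_{\mathbb{E}}(A,\cdot)$ be the generalized Möbius and Green functions and let $R_{\mathbb{E}}(A,\cdot)$ be the function on $\mathbb{E}$ defined in the context. Then (with $\equiv$ meaning equality at every point of $\mathbb{E}$): (a) $g_{\mathbb{E}}(A,\cdot)\equiv R_{\mathbb{E}}(A,\cdot)$; (b) if $p_j\ge 1/2$ for $j=1,\dots,n$, then $m_{\mathbb{E}}(A,\cdot)\equiv g_{\mathbb{E}}(A,\cdot)\equiv R_{\mathbb{E}}(A,\cdot)$; (c) if $k=1$, $n=2$ and $p_2\ge 1/2$, then $m_{\mathbb{E}}(A,\cdot)\equiv g_{\mathbb{E}}(A,\cdot)\equiv R_{\mathbb{E}}(A,\cdot)$; (d) if there exists $j\in\{k+1,\dots,n\}$ with $p_j<1/2$, then $m_{\mathbb{E}}(A,\cdot)\not\equiv g_{\mathbb{E}}(A,\cdot)$; (e) if $k=n=2$, $p_1\le p_2$, and either $p_2\ge 1/2$ or $8p_1+4p_2(1-p_2)>1$, then $m_{\mathbb{E}}(A,\cdot)\equiv g_{\mathbb{E}}(A,\cdot)\equiv R_{\mathbb{E}}(A,\cdot)$.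
   Context: $\mathbb{D}\subset\mathbb{C}$ is the open unit disc. The complex ellipsoid is $\mathbb{E}_{p_1,\dots,p_n}:=\{z\in\mathbb{C}^n:\sum_{j=1}^n|z_j|^{2p_j}<1\}$. For a domain $G\subset\mathbb{C}^n$ and $A\subset G$, the generalized Green function is $g_G(A,z):=\sup u(z)$, the supremum over all $u:G\to[0,1)$ such that $\log u$ is plurisubharmonic on $G$ (with $\log 0=-\infty$) and for every $a\in A$ there is a constant $C=C(u,a)>0$ with $u(w)\le C\|w-a\|$ for all $w\in G$. The generalized Möbius function is $m_G(A,z):=\sup\{|f(z)|: f:G\to\mathbb{D}\text{ holomorphic},\ f|_A\equiv 0\}$. Definition of $R_{\mathbb{E}}(A,z)$: let first $z\in\mathbb{E}$ be such that the sequence $(p_j|z_j|^{2p_j})_{j=1}^k$ is monotonically increasing (non-decreasing). For $s\in\{1,\dots,k\}$ put $q_s:=\sum_{j=1}^s\frac{1}{2p_j}$, $r_s(z):=1-\sum_{j=s+1}^n|z_j|^{2p_j}$, $c_s(z):=r_s(z)/q_s$, let $d:=\max\{s\in\{1,\dots,k\}:2p_s|z_s|^{2p_s}\le c_s(z)\}$, and set $$R_{\mathbb{E}}(A,z):=\prod_{j=1}^d|z_j|\Big(\frac{2p_j}{c_d(z)}\Big)^{\frac1{2p_j}}.$$ For arbitrary $z\in\mathbb{E}$, $R_{\mathbb{E}}(A,z)$ is defined by first permuting the first $k$ coordinates of $z$, together with the corresponding exponents $p_1,\dots,p_k$, so that the sequence $(p_j|z_j|^{2p_j})_{j=1}^k$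 becomes monotonically increasing (non-decreasing), and then setting $R_{\mathbb{E}}(A,z):=\prod_{j=1}^d|z_j|\big(\frac{2p_j}{c_d(z)}\big)^{\frac1{2p_j}}$, where $z_j$, $p_j$ now denote the permuted coordinates and exponents and $q_s$, $r_s(z)$, $c_s(z)$, $d$ are computed from them. *)

(* Defs.v *)
From mathcomp Require Import all_boot all_order all_algebra all_fingroup.
From mathcomp Require Import all_classical all_reals all_analysis.
From mathcomp.real_closed Require Import complex.
Import numFieldNormedType.Exports.
Import Order.TTheory GRing.Theory Num.Theory.

Set Implicit Arguments.
Unset Strict Implicit.
Unset Printing Implicit Defensive.

Local Open Scope classical_set_scope.
Local Open Scope ring_scope.

(* C is R[i]^o rather than R[i]: the regular module R[i]^o is the copy of R[i]
   that carries the canonical topology, so that 'rV[R[i]^o]_n is C^n as a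
   normed module over C and [differentiable] is complex differentiability. *)

(* The modulus with values in R; the norm `|z| of z : R[i] is the same number
   seen in R[i]. *)
Definition cabs (R : realType) (z : R[i]^o) : R := ComplexField.Normc.normc z.

(* The norm `|z| of 'rV[R[i]^o]_n is the sup norm. *)
Definition enorm (R : realType) n (z : 'rV[R[i]^o]_n) : R :=
  Num.sqrt (\sum_(j < n) cabs (z 0 j) ^+ 2).

Definition expi (R : realType) (t : R) : R[i]^o := (cos t +i* sin t)%C.

Definition holomorphic (R : realType) n (G : set 'rV[R[i]^o]_n)
    (f : 'rV[R[i]^o]_n -> R[i]^o) : Prop :=
  forall z, G z -> differentiable f z.

(* Upper semicontinuity on D of a function with values in [-oo, +oo[; values
   outside D are irrelevant. *)
Definition usc_on (R : realType) (T : topologicalType) (D : set T)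
    (v : T -> \bar R) : Prop :=
  forall x, D x -> (v x < +oo)%E /\
    forall a : R, (v x < a%:E)%E ->
      \forall y \near within D (nbhs x), (v y < a%:E)%E.

(* The function -oo counts as subharmonic. The integral makes sense in
   [-oo, +oo[ since an upper semicontinuous function is measurable and bounded
   above on a circle. *)
Definition subharmonic (R : realType) (D : set R[i]^o)
    (v : R[i]^o -> \bar R) : Prop :=
  usc_on D v /\
  forall (c : R[i]^o) (r : R), 0 < r ->
    [set x | cabs (x - c) <= r] `<=` D ->
    (v c <= ((2 * pi)^-1)%:E *
       \int[lebesgue_measure]_(t in `[(0 : R)%R, (2 * pi : R)%R]%classic)
          v (c + r%:C%C * expi t)%R)%E.

Definition plurisubharmonic (R : realType) n (G : set 'rV[R[i]^o]_n)
    (v : 'rV[R[i]^o]_n -> \bar R) : Prop :=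
  usc_on G v /\
  forall a b : 'rV[R[i]^o]_n,
    subharmonic [set x : R[i]^o | G (a + x *: b)] (fun x => v (a + x *: b)).

(* [lne] maps 0 to -oo. *)
Definition green_family (R : realType) n (G A : set 'rV[R[i]^o]_n) :
    set ('rV[R[i]^o]_n -> R) :=
  [set u | [/\ forall z, G z -> 0 <= u z < 1,
    plurisubharmonic G (fun z => lne (u z)%:E) &
    forall a, A a ->
      exists2 C : R, 0 < C & forall w, G w -> u w <= C * enorm (w - a)]].

Definition green (R : realType) n (G A : set 'rV[R[i]^o]_n)
    (z : 'rV[R[i]^o]_n) : R :=
  sup [set u z | u in green_family G A].

Definition mobius_family (R : realType) n (G A : set 'rV[R[i]^o]_n) :
    set ('rV[R[i]^o]_n -> R[i]^o) :=
  [set f | [/\ holomorphic G f, forall z, G z -> cabs (f z) < 1 &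
    forall a, A a -> f a = 0]].

Definition mobius (R : realType) n (G A : set 'rV[R[i]^o]_n)
    (z : 'rV[R[i]^o]_n) : R :=
  sup [set cabs (f z) | f in mobius_family G A].

Definition ellipsoid (R : realType) n (p : 'I_n -> R) : set 'rV[R[i]^o]_n :=
  [set z | \sum_(j < n) cabs (z 0 j) `^ (2 * p j) < 1].

Definition ellA (R : realType) n (p : 'I_n -> R) (k : nat) :
    set 'rV[R[i]^o]_n :=
  [set z | ellipsoid p z /\ \prod_(j < n | (j < k)%N) z 0 j = 0].

(* The coordinates z_1, ..., z_n are z 0 0, ..., z 0 (n - 1); the argument s
   below is the number of coordinates taken, so that "j <= s" in 1-based
   indexing reads "j < s" here. *)
Definition ellq (R : realType) n (p : 'I_n -> R) (s : nat) : R :=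
  \sum_(j < n | (j < s)%N) (2 * p j)^-1.

Definition ellr (R : realType) n (p : 'I_n -> R) (z : 'rV[R[i]^o]_n)
    (s : nat) : R :=
  1 - \sum_(j < n | (s <= j)%N) cabs (z 0 j) `^ (2 * p j).

Definition ellc (R : realType) n (p : 'I_n -> R) (z : 'rV[R[i]^o]_n)
    (s : nat) : R :=
  ellr p z s / ellq p s.

Definition elld (R : realType) n (p : 'I_n -> R) (k : nat)
    (z : 'rV[R[i]^o]_n) : nat :=
  (\max_(j < n | (j < k)%N &&
     (2 * p j * cabs (z 0 j) `^ (2 * p j) <= ellc p z j.+1)%R) j.+1)%N.

Definition ellR_sorted (R : realType) n (p : 'I_n -> R) (k : nat)
    (z : 'rV[R[i]^o]_n) : R :=
  let d := elld p k z in
  \prod_(j < n | (j < d)%N)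
    (cabs (z 0 j) * (2 * p j / ellc p z d) `^ (2 * p j)^-1).

Definition ell_sorting (R : realType) n (p : 'I_n -> R) (k : nat)
    (z : 'rV[R[i]^o]_n) (s : 'S_n) : bool :=
  [forall j : 'I_n, (k <= j)%N ==> (s j == j)] &&
  [forall i : 'I_n, forall j : 'I_n, (i <= j < k)%N ==>
     (p (s i) * cabs (z 0 (s i)) `^ (2 * p (s i)) <=
      p (s j) * cabs (z 0 (s j)) `^ (2 * p (s j)))].

(* The default 0 is never used, by [ell_sorting_ex]. The permutation is only
   determined up to ties in the sequence (p_j |z_j|^(2 p_j)); the value does not
   depend on the choice, because d never separates two tied indices. *)
Definition ellR (R : realType) n (p : 'I_n -> R) (k : nat)
    (z : 'rV[R[i]^o]_n) : R :=
  if [pick s : 'S_n | ell_sorting p k z s] is Some s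
  then ellR_sorted (fun j => p (s j)) k (\row_j z 0 (s j))
  else 0.

Lemma ell_sorting_ex (R : realType) n (p : 'I_n -> R) (k : nat)
  (z : 'rV[R[i]^o]_n) : exists s : 'S_n, ell_sorting p k z s.
Proof.
pose w j := p j * cabs (z 0 j) `^ (2 * p j).
pose le_w := relpre w (<=%R : rel R).
have tot_w : total le_w by move=> i j; exact: le_total.
have tr_w : transitive le_w by move=> i j l; exact: le_trans.
pose e := enum 'I_n.
pose l := sort le_w (take k e) ++ drop k e.
have pe : perm_eq l e by rewrite -[X in perm_eq _ X](cat_take_drop k) perm_cat2r perm_sort.
have sl : size l = n by rewrite (perm_size pe) /e size_enum_ord.
have ul : uniq l by rewrite (perm_uniq pe) enum_uniq.
have f_inj : injective (fun j : 'I_n => nth j l j).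
  move=> i j /=; rewrite (set_nth_default i j) ?sl ?ltn_ord// => /eqP.
  by rewrite nth_uniq ?sl ?ltn_ord// => /eqP/val_inj.
exists (perm f_inj); apply/andP; split.
  apply/forallP => j; apply/implyP => kj; rewrite permE /l nth_cat.
  rewrite size_sort size_take size_enum_ord.
  rewrite (leq_ltn_trans kj (ltn_ord j)) ltnNge kj/= nth_drop subnKC//.
  by rewrite nth_ord_enum.
apply/forallP => i; apply/forallP => j; apply/implyP => /andP[ij jk].
rewrite !permE /= -/(w _) -/(w _) -/(le_w _ _).
have st : size (sort le_w (take k e)) = minn k n.
  by rewrite size_sort size_take_min size_enum_ord.
have jm : (j < minn k n)%N by rewrite leq_min jk ltn_ord.
have im := leq_ltn_trans ij jm.
rewrite /l !nth_cat !st im jm (set_nth_default i j) ?st//.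
have re_w : reflexive le_w by move=> a; exact: lexx.
apply: (sorted_leq_nth tr_w re_w _ (sort_sorted tot_w _)) => //.
- by rewrite inE st.
- by rewrite inE st.
Qed.

(* Main.v *)
Require Import Defs.
From mathcomp Require Import all_boot all_order all_algebra all_fingroup.
From mathcomp Require Import all_classical all_reals all_analysis.
From mathcomp Require Import measurable_realfun.
From mathcomp.real_closed Require Import complex.
From mathcomp Require Import ring lra.
Import numFieldNormedType.Exports.
Import Order.TTheory GRing.Theory Num.Theory.
Set Implicit Arguments.
Unset Strict Implicit.
Unset Printing Implicit Defensive.
Local Open Scope classical_set_scope.
Local Open Scope ring_scope.

(** Fix a point [z] of the ellipsoid, let [T] be the set of coordinates whose
    product enters [R(z)] and [c] the corresponding constant (the pair is
    called [critical] below). The point [z*] with coordinates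
    [(c / 2 p_j)^(1 / 2 p_j)] for [j] in [T] and [|z_j|] elsewhere lies on the
    boundary of the ellipsoid, and [R(z)] is the product over [T] of the
    quotients [|z_j| / z*_j] ([exists_critical], [critical_valueE]).

    Upper bounds. If the coordinates outside [T] are frozen, the polydisc
    [|w_j| < z*_j] lies in the ellipsoid and its coordinate hyperplanes lie in
    [A]. Schwarz's lemma in one coordinate after the other bounds the members
    of both families by [R(z)] ([polydisc_bound]).

    Lower bounds. By Lagrange multipliers, [z*] is where the monomial with the
    exponents [al_j = 2 p_j (z*_j)^(2 p_j) / c] is maximal. These exponents are
    1 on [T], and the choice of [T] makes them at least 1 at the other
    coordinates on which functions have to vanish. So the normalized monomial
    belongs to the family of the Green function, and its value at [z] is
    [R(z)] ([green_critical]); it is logarithmically plurisubharmonic because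
    the mean of [ln |c + s e^(it)|] is at least [ln |c|] ([monomial_psh]).
    For the Moebius function the factors [|w_j|^(al_j)] with [j] outside [T] are
    replaced by exponentials of linear functions, times [w_j] where a zero is
    required, with first order contact at [z] ([mobius_extremal]). The product
    is still bounded by 1 if [x^(2 p_j)] is convex for these [j]
    ([mobius_critical_convex]). For two coordinates with exponents [Q] on [T]
    and [P] off [T], what is needed is that [- (1 / 2 Q) ln (1 - x^(2 P)) - ln x]
    lies above its tangents, and this follows from [(1 - 2 P)^2 < 8 Q], the sign
    of the discriminant of a quadratic polynomial ([tangent_inequality]).

    Inequality. If [j] is not among the first [k] coordinates and [p_j < 1/2],
    the Green function has a cusp of order [2 p_j < 1] at [z_j = 0], while
    Schwarz's lemma makes the Moebius function at most linear there
    ([mobius_neq_green]).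

    One complex variable. Both Schwarz lemmas come from one maximum principle,
    [annulus_max], fed with circle means: the mean value property of
    holomorphic functions, which is Goursat's theorem in logarithmic
    coordinates ([goursat], [holo_mean]), and that of [ln |z|], which follows
    from angle doubling ([log_mean_unit], [log_mean_off]). *)

(** * Modulus and complex derivatives *)

Section Modulus.
Variable R : realType.
Notation C := R[i]^o.
Implicit Types (z w : C) (x r : R).

Lemma normr_cabs z : `|z| = (cabs z)%:C%C.
Proof. by []. Qed.

Lemma cabs_ge0 z : 0 <= cabs z.
Proof. by have := normr_ge0 (z : R[i]); rewrite normr_cabs lecE/= => /andP[]. Qed.

Lemma cabsM z w : cabs (z * w) = cabs z * cabs w.
Proof. exact: ComplexField.Normc.normcM. Qed.

Lemma cabs0 : cabs (0 : C) = 0. Proof. exact: ComplexField.Normc.normc0. Qed.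

Lemma cabs1 : cabs (1 : C) = 1. Proof. exact: ComplexField.Normc.normc1. Qed.

Lemma cabs_eq0 z : (cabs z == 0) = (z == 0).
Proof.
apply/eqP/eqP => [|->]; [exact: ComplexField.Normc.eq0_normc|exact: cabs0].
Qed.

Lemma cabs_gt0 z : (0 < cabs z) = (z != 0).
Proof. by rewrite lt_neqAle cabs_ge0 andbT eq_sym cabs_eq0. Qed.

Lemma cabsV z : cabs z^-1 = (cabs z)^-1.
Proof. exact: ComplexField.Normc.normcV. Qed.

Lemma cabsN z : cabs (- z) = cabs z.
Proof. exact: normcN. Qed.

Lemma cabsX z n : cabs (z ^+ n) = cabs z ^+ n.
Proof. by elim: n => [|n ih]; rewrite ?expr0 ?cabs1// !exprS cabsM ih. Qed.

Lemma cabs_prod (I : finType) (P : pred I) (F : I -> C) :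
  cabs (\prod_(i | P i) F i) = \prod_(i | P i) cabs (F i).
Proof.
by apply: (big_ind2 (fun z r => cabs z = r)) => [|z r w s <- <-|//];
  [exact: cabs1|exact: cabsM].
Qed.

Lemma le_cabsD z w : cabs (z + w) <= cabs z + cabs w.
Proof. exact: le_normcD. Qed.

Lemma cabs_distC z w : cabs (z - w) = cabs (w - z).
Proof. by rewrite -opprB cabsN. Qed.

Lemma le_cabsB z w : cabs z - cabs w <= cabs (z - w).
Proof. by rewrite lerBlDr -{1}(subrK w z) le_cabsD. Qed.

Lemma cabs_real x : cabs (x%:C%C : C) = `|x|.
Proof. by rewrite /cabs /= expr0n /= addr0 sqrtr_sqr. Qed.

Lemma sqr_cabs z : cabs z ^+ 2 = complex.Re z ^+ 2 + complex.Im z ^+ 2.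
Proof.
by case: z => a b; rewrite /cabs/= sqr_sqrtr// addr_ge0 ?sqr_ge0.
Qed.

Lemma Re_le_cabs z : `|complex.Re z| <= cabs z.
Proof.
by case: z => a b; rewrite /cabs/= -sqrtr_sqr ler_wsqrtr// lerDl sqr_ge0.
Qed.

Lemma Im_le_cabs z : `|complex.Im z| <= cabs z.
Proof.
by case: z => a b; rewrite /cabs/= -sqrtr_sqr ler_wsqrtr// lerDr sqr_ge0.
Qed.

Lemma cabs_le_ReIm z : cabs z <= `|complex.Re z| + `|complex.Im z|.
Proof.
rewrite -(@ler_pXn2r _ 2) ?nnegrE ?cabs_ge0 ?addr_ge0//.
rewrite sqr_cabs -[complex.Re z ^+ 2]real_normK ?num_real//.
rewrite -[complex.Im z ^+ 2]real_normK ?num_real//.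
have := normr_ge0 (complex.Re z); have := normr_ge0 (complex.Im z); nra.
Qed.

Lemma expiE (t : R) : cabs (expi t) = 1.
Proof. by rewrite /cabs /expi/= cos2Dsin2 sqrtr1. Qed.

(** The norm of [C] takes values in [C]; these two lemmas bring neighbourhoods
    and derivatives back to real estimates on the modulus. *)
Lemma nbhs_cabsP z (P : set C) :
  nbhs z P <-> exists2 d : R, 0 < d & forall w, cabs (w - z) < d -> P w.
Proof.
split.
  move=> /nbhs_ballP[d /= d0 dP].
  have dr : d = (complex.Re d)%:C%C :> C by move: d0; rewrite ltcE/= => /andP[/eqP]; case: d {dP} => a b /= ->.
  exists (complex.Re d); first by move: d0; rewrite ltcE/= => /andP[].
  by move=> w wz; apply: dP; rewrite -ball_normE/= distrC normr_cabs dr ltcR.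
move=> [d d0 dP]; apply/nbhs_ballP; exists (d%:C%C : C) => /=; first by rewrite ltcR.
by move=> w; rewrite -ball_normE/= distrC normr_cabs ltcR; apply: dP.
Qed.

Lemma differentiable_cabsP (f : C -> C) z :
  differentiable f z <-> exists L : C, forall e : R, 0 < e ->
    exists2 d : R, 0 < d & forall w, cabs (w - z) < d ->
      cabs (f w - f z - L * (w - z)) <= e * cabs (w - z).
Proof.
split.
  move=> df; exists ((f^`())%classic z) => e e0.
  have [_ /eqaddoP] := (diff_locallyP z f).1 df.
  move=> /(_ (e%:C%C : C)); rewrite ltcR => /(_ e0) /nbhs_cabsP[d d0 dP].
  exists d => // w wd; have := dP (w - z); rewrite subr0 => /(_ wd) /=.
  rewrite !fctE /= subrK diff1E//= !normr_cabs -(rmorphM _ e) lecR opprD addrA.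
  by rewrite /GRing.scale/= [X in _ - X]mulrC.
move=> [L HL]; apply/derivable1_diffP/cvg_ex; exists L => /=.
apply/cvgrPdist_le => /= e e0.
have er : e = (complex.Re e)%:C%C :> C.
  by move: e0; rewrite ltcE/= => /andP[/eqP]; case: e => a b /= ->.
have re0 : 0 < complex.Re e by move: e0; rewrite ltcE/= => /andP[].
have [d d0 dP] := HL _ re0.
apply/nbhs_cabsP; exists d => // h; rewrite subr0 => hd hn0.
have := dP (h + z); rewrite addrK => /(_ hd) H.
rewrite er normr_cabs lecR /GRing.scale/= mulr1.
have -> : L - h^-1 * (f (h + z) - f z) = - (h^-1 * (f (h + z) - f z - L * h)).
  by field.
by rewrite cabsN cabsM cabsV mulrC ler_pdivrMr ?cabs_gt0.
Qed.

End Modulus.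

(** * The complex exponential *)

Section ComplexExponential.
Variable R : realType.
Notation C := R[i]^o.
Implicit Types (z w : C) (x r t : R).

Lemma is_derive1_bound (f : R -> R) x l : is_derive x 1 f l ->
  forall e : R, 0 < e -> exists2 d : R, 0 < d &
    forall h, `|h| < d -> `|f (h + x) - f x - l * h| <= e * `|h|.
Proof.
move=> fl e e0.
have df : differentiable f x by apply/derivable1_diffP.
have [_ /eqaddoP] := (diff_locallyP x f).1 df.
move=> /(_ e e0)/nbhs_ballP[d /= d0 dP]; exists d => // h hd.
have := dP h; rewrite -ball_normE/= sub0r normrN => /(_ hd).
rewrite !fctE /= diff1E// derive1E derive_val opprD addrA.
by rewrite /GRing.scale/= [X in _ - X]mulrC.
Qed.

Definition cexp z : C := (expR (complex.Re z))%:C%C * expi (complex.Im z).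

Lemma expiD (s t : R) : expi (s + t) = expi s * expi t :> C.
Proof. by rewrite /expi cosD sinD; apply/eqP; rewrite eq_complex/= !eqxx/= addrC eqxx. Qed.

Lemma cexpD z w : cexp (z + w) = cexp z * cexp w.
Proof.
by case: z w => [a b] [c d]; rewrite /cexp/= expRD expiD rmorphM/= mulrACA.
Qed.

Lemma cabs_cexp z : cabs (cexp z) = expR (complex.Re z).
Proof. by rewrite cabsM expiE mulr1 cabs_real ger0_norm// expR_ge0. Qed.

Lemma cexp_real_imag (x y : R) :
  cexp (x +i* y)%C = ((expR x)%:C%C * expi y : C).
Proof. by []. Qed.

Lemma differentiable_cexp z : differentiable cexp z.
Proof.
apply/differentiable_cabsP; exists (cexp z) => e e0.
pose M := expR (complex.Re z).
have M0 : 0 < M by exact: expR_gt0.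
(* The factor 10 leaves room for the errors [4 e'] and [5 e'] of the real and
   the imaginary part. *)
have [e' [e'0 e'1 e'e]] : exists e' : R, [/\ 0 < e', e' <= 1 & e' * 10 <= e / M].
  exists (Num.min 1 (e / (M * 10))); split.
  - by rewrite lt_min ltr01 divr_gt0// mulr_gt0.
  - by rewrite ge_min lexx.
  - have -> : e / M = e / (M * 10) * 10 by field; rewrite gt_eqF.
    by rewrite ler_pM2r// ge_min lexx orbT.
have [d1 d10 H1] := is_derive1_bound (is_derive_expR 0) e'0.
have [d2 d20 H2] := is_derive1_bound (is_derive_cos 0) e'0.
have [d3 d30 H3] := is_derive1_bound (is_derive_sin 0) e'0.
exists (Num.min 1 (Num.min e' (Num.min d1 (Num.min d2 d3)))).
  by rewrite !lt_min ltr01 e'0 d10 d20 d30.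
move=> w; rewrite !lt_min => /and5P[h0 he h1 h2 h3].
set u := w - z in h0 he h1 h2 h3 *.
have -> : w = z + u by rewrite /u addrC subrK.
rewrite cexpD.
have -> : cexp z * cexp u - cexp z - cexp z * u = cexp z * (cexp u - 1 - u) by ring.
rewrite cabsM cabs_cexp -/M.
suff : cabs (cexp u - 1 - u) <= e / M * cabs u.
  move=> /(ler_wpM2l (ltW M0)) /le_trans; apply.
  by rewrite [X in X <= _](_ : _ = e * cabs u)//; field; rewrite gt_eqF.
have {}H1 := H1 (complex.Re u) (le_lt_trans (Re_le_cabs _) h1).
have {}H2 := H2 (complex.Im u) (le_lt_trans (Im_le_cabs _) h2).
have {}H3 := H3 (complex.Im u) (le_lt_trans (Im_le_cabs _) h3).
have Ru := Re_le_cabs u; have Iu := Im_le_cabs u.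
apply: (le_trans (cabs_le_ReIm _)).
have -> : complex.Re (cexp u - 1 - u) =
  expR (complex.Re u) * cos (complex.Im u) - 1 - complex.Re u.
  by case: (u) => a b /=; rewrite mul0r subr0.
have -> : complex.Im (cexp u - 1 - u) =
  expR (complex.Re u) * sin (complex.Im u) - complex.Im u.
  by case: (u) => a b /=; rewrite mul0r addr0 oppr0 addr0.
move: H1 H2 H3; rewrite !addr0 expR0 cos0 sin0 oppr0 mul0r !subr0 !addr0 !mul1r.
move: (complex.Re u) (complex.Im u) Ru Iu => a b Ru Iu H1 H2 H3.
have u1 : cabs u <= 1 by exact: ltW.
have ub1 : `|expR a - 1| <= 2 * cabs u.
  have -> : expR a - 1 = (expR a - 1 - a) + a by ring.
  apply: (le_trans (ler_normD _ _)).
  have : `|expR a - 1 - a| <= cabs u.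
    by apply: (le_trans H1); rewrite -[leRHS]mul1r ler_pM// ltW.
  lra.
have ub3 : expR a <= 3 by move: ub1; rewrite ler_norml => /andP[]; lra.
have c0 := cabs_ge0 u.
have B1 : `|expR a * cos b - 1 - a| <= 4 * e' * cabs u.
  have -> : expR a * cos b - 1 - a = expR a * (cos b - 1) + (expR a - 1 - a) by ring.
  apply: (le_trans (ler_normD _ _)); rewrite normrM ger0_norm ?expR_ge0//.
  have t1 : `|expR a - 1 - a| <= e' * cabs u by apply: (le_trans H1); rewrite ler_wpM2l// ltW.
  have t2 : `|cos b - 1| <= e' * cabs u by apply: (le_trans H2); rewrite ler_wpM2l// ltW.
  have := ler_pM (expR_ge0 a) (normr_ge0 (cos b - 1)) ub3 t2; lra.
have B2 : `|expR a * sin b - b| <= 5 * e' * cabs u.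
  have -> : expR a * sin b - b = expR a * (sin b - b) + (expR a - 1) * b by ring.
apply: (le_trans (ler_normD _ _)); rewrite !normrM [`|expR a|]ger0_norm ?expR_ge0//.
have t2 : `|sin b - b| <= e' * cabs u by apply: (le_trans H3); rewrite ler_wpM2l// ltW.
  have := ler_pM (expR_ge0 a) (normr_ge0 (sin b - b)) ub3 t2.
  have t3 : `|b| <= e' by rewrite (le_trans Iu)// ltW.
  have := ler_pM (normr_ge0 _) (normr_ge0 b) ub1 t3; lra.
apply: (@le_trans _ _ (e' * 10 * cabs u)); last exact: ler_wpM2r.
have : 0 <= e' * cabs u by rewrite mulr_ge0// ltW.
lra.
Qed.

End ComplexExponential.

(** * Integrals over segments *)

Section SegmentIntegral.
Variable R : realType.
Implicit Types (a b c : R) (f g F : R -> R).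

Definition sint a b f : R := \int[lebesgue_measure]_(t in `[a, b]) f t.

Lemma within_itv_continuous a b f :
  (forall x, a <= x <= b -> {for x, continuous f}) ->
  {within `[a, b], continuous f}.
Proof.
move=> cf; apply: continuous_in_subspaceT => x; rewrite inE/= in_itv/=.
exact: cf.
Qed.

Lemma integrable_itv a b f : (forall x, a <= x <= b -> {for x, continuous f}) ->
  lebesgue_measure.-integrable `[a, b] (EFin \o f).
Proof.
move=> cf; apply: continuous_compact_integrable.
  exact: segment_compact.
exact: within_itv_continuous.
Qed.

Lemma sint_ftc a b F f : a <= b -> (forall x : R, is_derive x 1 F (f x)) ->
  continuous f -> sint a b f = F b - F a.
Proof.
rewrite le_eqVlt => /predU1P[<-|ab] Ff cf.
  by rewrite /sint set_itv1 Rintegral_set1 subrr.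
rewrite /sint /Rintegral (@continuous_FTC2 _ f F)//.
- by apply: within_itv_continuous => x _; exact: cf.
- have cF : continuous F.
    move=> x; apply: (@differentiable_continuous _ _ _ x F).
    by apply/(derivable1_diffP F x); have := Ff x; case.
  split => //.
  + by apply: cvg_at_right_filter; exact: cF.
  + by apply: cvg_at_left_filter; exact: cF.
- by move=> x _; rewrite derive1E derive_val.
Qed.

Lemma sint_cat a b c f : a <= b -> b <= c ->
  (forall x, a <= x <= c -> {for x, continuous f}) ->
  sint a c f = sint a b f + sint b c f.
Proof.
move=> ab bc cf; rewrite /sint.
have If := integrable_itv cf.
have := @Rintegral_itvB _ f (BLeft a) (BRight c) b If.
rewrite !bnd_simp => /(_ ab bc).
rewrite Rintegral_itv_obnd_cbnd; first by move=> <-; rewrite addrC subrK.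
apply: integrableS If => //; exact: subset_itvr.
Qed.

Lemma le_sint a b f g :
  (forall x, a <= x <= b -> {for x, continuous f}) ->
  (forall x, a <= x <= b -> {for x, continuous g}) ->
  (forall x, a <= x <= b -> f x <= g x) -> sint a b f <= sint a b g.
Proof.
move=> cf cg fg; apply: le_Rintegral; [exact: measurable_itv|exact: (integrable_itv cf)|exact: (integrable_itv cg)|].
by move=> x /=; rewrite in_itv/=; exact: fg.
Qed.

Lemma eq_sint a b f g :
  (forall x, a <= x <= b -> f x = g x) -> sint a b f = sint a b g.
Proof. by move=> fg; apply: eq_Rintegral => x; rewrite inE/= in_itv/=; exact: fg. Qed.

Lemma sint_affine a b (p q : R) : a <= b ->
  sint a b (fun x => p + q * x) = (b - a) * (p + q * ((a + b) / 2)).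
Proof.
move=> ab.
have dF (x : R) : is_derive x 1 (fun x => p * x + q / 2 * x ^+ 2) (p + q * x).
  by apply: is_derive_eq; rewrite /GRing.scale/= !mulr1; field.
rewrite (sint_ftc ab dF); first by field.
move=> x; apply: cvgD; first exact: cvg_cst.
by apply: cvgM; [exact: cvg_cst|exact: cvg_id].
Qed.

(** The subtracted term is the exact integral of the affine function, its value
    at the midpoint times the length. *)
Lemma sint_near_affine a b f (p q M : R) : a <= b ->
  (forall x, a <= x <= b -> {for x, continuous f}) ->
  (forall x, a <= x <= b -> `|f x - (p + q * x)| <= M) ->
  `|sint a b f - (b - a) * (p + q * ((a + b) / 2))| <= (b - a) * M.
Proof.
move=> ab cf fM.
have ca (u v : R) : forall x, a <= x <= b -> {for x, continuous (fun x => u + v * x)}.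
  move=> x _; apply: cvgD; first exact: cvg_cst.
  by apply: cvgM; [exact: cvg_cst|exact: cvg_id].
have H1 : sint a b f <= sint a b (fun x => (p + M) + q * x).
  apply: le_sint => // [|x /fM]; first exact: ca.
  by rewrite ler_norml => /andP[_]; lra.
have H2 : sint a b (fun x => (p - M) + q * x) <= sint a b f.
  apply: le_sint => // [|x /fM]; first exact: ca.
  by rewrite ler_norml => /andP[+ _]; lra.
move: H1 H2; rewrite !sint_affine// ler_norml => H1 H2; apply/andP; split; lra.
Qed.

End SegmentIntegral.

(** * Goursat's theorem *)

Section Goursat.
Variable R : realType.
Notation C := R[i]^o.
Implicit Types (F : C -> C) (x y a b : R).

(** The imaginary part of the integral of [F dz] along the boundary of the
    rectangle, counterclockwise; on the vertical sides [dz = i dy] brings in the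
    real part of [F]. *)
Definition contour F x1 x2 y1 y2 : R :=
  sint x1 x2 (fun x => complex.Im (F (x +i* y1)%C)) -
  sint x1 x2 (fun x => complex.Im (F (x +i* y2)%C)) +
  (sint y1 y2 (fun y => complex.Re (F (x2 +i* y)%C)) -
   sint y1 y2 (fun y => complex.Re (F (x1 +i* y)%C))).

Lemma continuous_cabs_comp (g : R -> C) (f : C -> R) (t : R) :
  (forall s, cabs (g s - g t) <= `|s - t|) ->
  (exists2 K : R, 0 < K & exists2 d : R, 0 < d & forall w, cabs (w - g t) < d ->
     `|f w - f (g t)| <= K * cabs (w - g t)) ->
  {for t, continuous (fun s => f (g s))}.
Proof.
move=> gl [K K0 [d d0 fd]]; apply/cvgrPdist_le => e e0.
apply/nbhs_ballP; exists (Num.min d (e / K)) => /=.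
  by rewrite lt_min d0 divr_gt0.
move=> s; rewrite /ball/= distrC lt_min => /andP[sd se].
have gd : cabs (g s - g t) < d by exact: le_lt_trans sd.
rewrite distrC; apply: (le_trans (fd _ gd)).
rewrite -ler_pdivlMl// mulrC; apply: (le_trans (gl s)); exact: ltW.
Qed.

Lemma differentiable_local_lipschitz F z : differentiable F z ->
  exists2 K : R, 0 < K & exists2 d : R, 0 < d & forall w, cabs (w - z) < d ->
    cabs (F w - F z) <= K * cabs (w - z).
Proof.
move=> /differentiable_cabsP[L /(_ 1 ltr01)[d d0 H]].
exists (cabs L + 1); first by rewrite ltr_wpDl// cabs_ge0.
exists d => // w wd.
have -> : F w - F z = (F w - F z - L * (w - z)) + L * (w - z) by ring.
apply: (le_trans (le_cabsD _ _)).
by rewrite mulrDl addrC lerD// ?cabsM// H.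
Qed.

Section ContinuityAlongLines.
Variables (F : C -> C) (x y : R).
Hypothesis dF : differentiable F (x +i* y : C)%C.

Let lipx s : cabs ((s +i* y)%C - (x +i* y)%C : C) <= `|s - x|.
Proof.
rewrite (_ : _ - _ = (s - x)%:C%C :> C) ?cabs_real//.
by apply/eqP; rewrite eq_complex/= subrr !eqxx.
Qed.

Let lipy s : cabs ((x +i* s)%C - (x +i* y)%C : C) <= `|s - y|.
Proof.
apply: (le_trans (cabs_le_ReIm _)).
by rewrite /= subrr normr0 add0r.
Qed.

Lemma continuous_Im_hline :
  {for x, continuous (fun x => complex.Im (F (x +i* y)%C))}.
Proof.
have [K K0 [d d0 H]] := differentiable_local_lipschitz dF.
apply: (@continuous_cabs_comp (fun s => s +i* y)%C (fun w => complex.Im (F w))).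
  exact: lipx.
exists K => //; exists d => // w /H; apply: le_trans.
by rewrite -raddfB; exact: Im_le_cabs.
Qed.

Lemma continuous_Re_vline :
  {for y, continuous (fun y => complex.Re (F (x +i* y)%C))}.
Proof.
have [K K0 [d d0 H]] := differentiable_local_lipschitz dF.
apply: (@continuous_cabs_comp (fun s => x +i* s)%C (fun w => complex.Re (F w))).
  exact: lipy.
exists K => //; exists d => // w /H; apply: le_trans.
by rewrite -raddfB; exact: Re_le_cabs.
Qed.

End ContinuityAlongLines.

Definition holo_rect F x1 x2 y1 y2 :=
  forall x y, x1 <= x <= x2 -> y1 <= y <= y2 -> differentiable F (x +i* y : C)%C.

(** Affine functions have a primitive, so only the deviation [M] from an affine
    function contributes, over a path of length the perimeter. *)
Lemma contour_near_affine F x1 x2 y1 y2 (A L : C) (M : R) :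
  x1 <= x2 -> y1 <= y2 -> holo_rect F x1 x2 y1 y2 ->
  (forall x y, x1 <= x <= x2 -> y1 <= y <= y2 ->
     cabs (F (x +i* y)%C - (A + L * (x +i* y)%C)) <= M) ->
  `|contour F x1 x2 y1 y2| <= 2 * ((x2 - x1) + (y2 - y1)) * M.
Proof.
move=> x12 y12 dF FM.
have y1y : y1 <= y1 <= y2 by rewrite lexx.
have y2y : y1 <= y2 <= y2 by rewrite lexx andbT.
have x1x : x1 <= x1 <= x2 by rewrite lexx.
have x2x : x1 <= x2 <= x2 by rewrite lexx andbT.
pose a := complex.Re A; pose a' := complex.Im A.
pose l := complex.Re L; pose l' := complex.Im L.
have imH y : y1 <= y <= y2 -> `|sint x1 x2 (fun x => complex.Im (F (x +i* y)%C)) -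
    (x2 - x1) * ((a' + l * y) + l' * ((x1 + x2) / 2))| <= (x2 - x1) * M.
  move=> yy; apply: sint_near_affine => // x xx.
    by apply: continuous_Im_hline; exact: dF.
  apply: le_trans (FM x y xx yy); apply: le_trans (Im_le_cabs _).
  rewrite raddfB/= (_ : complex.Im (A + _) = a' + l * y + l' * x)//.
  by rewrite /a' /l /l'; case: (A) (L) => u v [u' v'] /=; ring.
have reV x : x1 <= x <= x2 -> `|sint y1 y2 (fun y => complex.Re (F (x +i* y)%C)) -
    (y2 - y1) * ((a + l * x) + - l' * ((y1 + y2) / 2))| <= (y2 - y1) * M.
  move=> xx; apply: sint_near_affine => // y yy.
    by apply: continuous_Re_vline; exact: dF.
  apply: le_trans (FM x y xx yy); apply: le_trans (Re_le_cabs _).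
  rewrite raddfB/= (_ : complex.Re (A + _) = a + l * x + - l' * y)//.
  by rewrite /a /l /l'; case: (A) (L) => u v [u' v'] /=; ring.
have := imH _ y1y; have := imH _ y2y; have := reV _ x1x; have := reV _ x2x.
rewrite /contour !ler_norml => /andP[? ?] /andP[? ?] /andP[? ?] /andP[? ?].
apply/andP; split; lra.
Qed.

Lemma contour_split F x1 x2 x3 y1 y2 y3 :
  x1 <= x2 -> x2 <= x3 -> y1 <= y2 -> y2 <= y3 -> holo_rect F x1 x3 y1 y3 ->
  contour F x1 x3 y1 y3 = contour F x1 x2 y1 y2 + contour F x2 x3 y1 y2 +
    (contour F x1 x2 y2 y3 + contour F x2 x3 y2 y3).
Proof.
move=> x12 x23 y12 y23 dF.
have x13 := le_trans x12 x23; have y13 := le_trans y12 y23.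
have H y : y1 <= y <= y3 -> sint x1 x3 (fun x => complex.Im (F (x +i* y)%C)) =
    sint x1 x2 (fun x => complex.Im (F (x +i* y)%C)) +
    sint x2 x3 (fun x => complex.Im (F (x +i* y)%C)).
  move=> yy; apply: sint_cat => // x xx.
  by apply: continuous_Im_hline; exact: dF.
have V x : x1 <= x <= x3 -> sint y1 y3 (fun y => complex.Re (F (x +i* y)%C)) =
    sint y1 y2 (fun y => complex.Re (F (x +i* y)%C)) +
    sint y2 y3 (fun y => complex.Re (F (x +i* y)%C)).
  move=> xx; apply: sint_cat => // y yy.
  by apply: continuous_Re_vline; exact: dF.
rewrite /contour !H ?V ?lexx ?x13 ?y13//.
ring.
Qed.

(** Repeated quartering keeps a quarter of a nonzero contour integral in one of
    the four parts. The nested rectangles shrink to a point, and there complex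
    differentiability bounds the integral by a small multiple of the area. *)
Lemma goursat F x1 x2 y1 y2 : x1 <= x2 -> y1 <= y2 ->
  holo_rect F x1 x2 y1 y2 -> contour F x1 x2 y1 y2 = 0.
Proof.
move=> x12 y12 dF; apply/eqP/negPn/negP => J0.
pose K := `|contour F x1 x2 y1 y2|.
have K0 : 0 < K by rewrite normr_gt0.
pose a n := (x2 - x1) / 2 ^+ n; pose b n := (y2 - y1) / 2 ^+ n.
have a0 n : 0 <= a n by rewrite divr_ge0 ?subr_ge0// exprn_ge0.
have b0 n : 0 <= b n by rewrite divr_ge0 ?subr_ge0// exprn_ge0.
have aS n : a n = a n.+1 *+ 2.
  by rewrite /a exprS mulr2n; field; rewrite expf_neq0.
have bS n : b n = b n.+1 *+ 2.
  by rewrite /b exprS mulr2n; field; rewrite expf_neq0.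
pose inR n (p : R * R) := [/\ x1 <= p.1, p.1 + a n <= x2, y1 <= p.2 & p.2 + b n <= y2].
pose Q n (p : R * R) := contour F p.1 (p.1 + a n) p.2 (p.2 + b n).
pose bad n p := inR n p /\ K / 4 ^+ n <= `|Q n p|.
have step n p : bad n p -> exists p', [/\ bad n.+1 p',
    p.1 <= p'.1, p.2 <= p'.2, p'.1 + a n.+1 <= p.1 + a n & p'.2 + b n.+1 <= p.2 + b n].
  move=> [[p1 p2 p3 p4] KQ].
  have Ha := aS n; have Hb := bS n; rewrite !mulr2n in Ha Hb.
  have a'0 := a0 n.+1; have b'0 := b0 n.+1.
  have sp : Q n p = Q n.+1 p + Q n.+1 (p.1 + a n.+1, p.2) +
     (Q n.+1 (p.1, p.2 + b n.+1) + Q n.+1 (p.1 + a n.+1, p.2 + b n.+1)).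
    rewrite /Q/= Ha Hb (addrA p.1) (addrA p.2); apply: contour_split; rewrite ?lerDl//.
    by move=> x y /andP[? ?] /andP[? ?]; apply: dF; apply/andP; split; lra.
  have sub p' : p.1 <= p'.1 -> p.2 <= p'.2 ->
      p'.1 + a n.+1 <= p.1 + a n -> p'.2 + b n.+1 <= p.2 + b n ->
      K / 4 ^+ n.+1 <= `|Q n.+1 p'| -> exists p', [/\ bad n.+1 p', p.1 <= p'.1,
        p.2 <= p'.2, p'.1 + a n.+1 <= p.1 + a n & p'.2 + b n.+1 <= p.2 + b n].
    move=> l1 l2 u1 u2 KQ'; exists p'; split => //; split => //; split.
    - exact: le_trans l1.
    - exact: le_trans u1 p2.
    - exact: le_trans l2.
    - exact: le_trans u2 p4.
  have A1 : p.1 + a n.+1 <= p.1 + a n by rewrite Ha lerD2l lerDl.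
  have A2 : p.1 + a n.+1 + a n.+1 <= p.1 + a n by rewrite Ha addrA.
  have A3 : p.2 + b n.+1 <= p.2 + b n by rewrite Hb lerD2l lerDl.
  have A4 : p.2 + b n.+1 + b n.+1 <= p.2 + b n by rewrite Hb addrA.
  have [|B1] := leP (K / 4 ^+ n.+1) `|Q n.+1 p|; first exact: sub.
  have [|B2] := leP (K / 4 ^+ n.+1) `|Q n.+1 (p.1 + a n.+1, p.2)|.
    by apply: sub => //=; rewrite lerDl.
  have [|B3] := leP (K / 4 ^+ n.+1) `|Q n.+1 (p.1, p.2 + b n.+1)|.
    by apply: sub => //=; rewrite lerDl.
  have [|B4] := leP (K / 4 ^+ n.+1) `|Q n.+1 (p.1 + a n.+1, p.2 + b n.+1)|.
    by apply: sub => //=; rewrite lerDl.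
  exfalso; move: KQ; apply/negP; rewrite -ltNge sp.
  have -> : K / 4 ^+ n = K / 4 ^+ n.+1 + K / 4 ^+ n.+1 + (K / 4 ^+ n.+1 + K / 4 ^+ n.+1).
    by rewrite exprS; field; rewrite expf_neq0.
  apply: (le_lt_trans (ler_normD _ _)); apply: ltrD;
    apply: (le_lt_trans (ler_normD _ _)); exact: ltrD.
pose next n p := if pselect (bad n p) is left h then projT1 (cid (step n p h)) else p.
pose s := fix s n := if n is m.+1 then next m (s m) else (x1, y1).
have bads n : bad n (s n).
  elim: n => [|n ih] /=.
    split; first by split => /=; rewrite /a /b ?expr0 ?divr1; lra.
    have -> : Q 0%N (x1, y1) = contour F x1 x2 y1 y2.
      by rewrite /Q /a /b/= !expr0 !divr1 (addrC x1) (addrC y1) !subrK.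
    by rewrite expr0 divr1.
  by rewrite /next; case: pselect => // h; case: cid => p' [].
have nest n : [/\ (s n).1 <= (s n.+1).1, (s n).2 <= (s n.+1).2,
    (s n.+1).1 + a n.+1 <= (s n).1 + a n & (s n.+1).2 + b n.+1 <= (s n).2 + b n].
  have := bads n; rewrite /= /next; case: pselect => // h _.
  by case: cid => p' [].
have nests n m : [/\ (s n).1 <= (s (m + n)%N).1, (s n).2 <= (s (m + n)%N).2,
    (s (m + n)%N).1 + a (m + n)%N <= (s n).1 + a n &
    (s (m + n)%N).2 + b (m + n)%N <= (s n).2 + b n].
  elim: m => [|m [i1 i2 i3 i4]] //; have [j1 j2 j3 j4] := nest (m + n)%N.
  rewrite addSn; split.
  - exact: le_trans j1.
  - exact: le_trans j2.
  - exact: le_trans i3.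
  - exact: le_trans i4.
have cross n m : (s m).1 <= (s n).1 + a n /\ (s m).2 <= (s n).2 + b n.
  have [i1 i2 _ _] := nests m n; have [_ _ i3 i4] := nests n m.
  rewrite (addnC m n) in i3 i4; have := a0 (n + m)%N; have := b0 (n + m)%N.
  by split; lra.
(* The common point of the nested rectangles. *)
pose X := sup (range (fun n => (s n).1)); pose Y := sup (range (fun n => (s n).2)).
have supX : has_sup (range (fun n => (s n).1)).
  split; first by exists (s 0%N).1; exists 0%N.
  by exists ((s 0%N).1 + a 0%N) => _ [m _ <-]; case: (cross 0%N m).
have supY : has_sup (range (fun n => (s n).2)).
  split; first by exists (s 0%N).2; exists 0%N.
  by exists ((s 0%N).2 + b 0%N) => _ [m _ <-]; case: (cross 0%N m).
have Xn n : (s n).1 <= X <= (s n).1 + a n.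
  apply/andP; split; first by apply: sup_upper_bound => //; exists n.
  apply: ge_sup; first by case: supX.
  by move=> _ [m _ <-]; case: (cross n m).
have Yn n : (s n).2 <= Y <= (s n).2 + b n.
  apply/andP; split; first by apply: sup_upper_bound => //; exists n.
  apply: ge_sup; first by case: supY.
  by move=> _ [m _ <-]; case: (cross n m).
have dXY : differentiable F (X +i* Y : C)%C.
  have [[p1 p2 p3 p4] _] := bads 0%N; have /andP[? ?] := Xn 0%N; have /andP[? ?] := Yn 0%N.
  by apply: dF; apply/andP; split; lra.
pose D := (x2 - x1) + (y2 - y1) + 1.
have D0 : 0 < D by rewrite /D; lra.
have [L HL] := (differentiable_cabsP F _).1 dXY.
have e0 : 0 < K / (4 * D ^+ 2) by rewrite divr_gt0// mulr_gt0// exprn_gt0.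
have [d d0 Hd] := HL _ e0.
have [n Dn] : exists n, D / 2 ^+ n < d.
  have [n Hn] : exists n : nat, D / d < n%:R.
    by exists (Num.bound (D / d)); rewrite archi_boundP// divr_ge0// ltW.
  exists n; rewrite ltr_pdivrMr ?exprn_gt0// mulrC -ltr_pdivrMr//.
  apply: (lt_le_trans Hn); rewrite -natrX ler_nat ltnW//; exact: ltn_expl.
have [[p1 p2 p3 p4] KQ] := bads n.
have Hcon : `|Q n (s n)| <= 2 * (a n + b n) * (K / (4 * D ^+ 2) * (a n + b n)).
  have -> : 2 * (a n + b n) = 2 * (((s n).1 + a n - (s n).1) + ((s n).2 + b n - (s n).2)).
    by ring.
  apply: (@contour_near_affine _ _ _ _ _ (F (X +i* Y)%C - L * (X +i* Y)%C) L).
  - by rewrite lerDl.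
  - by rewrite lerDl.
  - by move=> x y /andP[? ?] /andP[? ?]; apply: dF; apply/andP; split; lra.
  move=> x y /andP[? ?] /andP[? ?].
  have xyd : cabs ((x +i* y)%C - (X +i* Y)%C : C) <= a n + b n.
    apply: (le_trans (cabs_le_ReIm _)) => /=.
    have /andP[? ?] := Xn n; have /andP[? ?] := Yn n.
    by apply: lerD; rewrite ler_norml; apply/andP; split; lra.
  have -> : F (x +i* y)%C - (F (X +i* Y)%C - L * (X +i* Y)%C + L * (x +i* y)%C) =
    F (x +i* y)%C - F (X +i* Y)%C - L * ((x +i* y)%C - (X +i* Y)%C) by ring.
  apply: (le_trans (Hd _ _)); last by rewrite ler_wpM2l// ltW.
  apply: le_lt_trans xyd _; apply: le_lt_trans Dn.
  by rewrite -mulrDl ler_pM2r ?invr_gt0 ?exprn_gt0// /D lerDl.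
have := le_trans KQ Hcon.
have abD : a n + b n <= D / 2 ^+ n.
  by rewrite -mulrDl ler_pM2r ?invr_gt0 ?exprn_gt0// /D lerDl.
have ab0 : 0 <= a n + b n by rewrite addr_ge0.
have sq : (a n + b n) ^+ 2 <= D ^+ 2 / 4 ^+ n.
  have -> : D ^+ 2 / 4 ^+ n = (D / 2 ^+ n) ^+ 2.
    by rewrite expr_div_n -exprM mulnC exprM; congr (_ / _ ^+ _); ring.
  by rewrite ler_pXn2r// nnegrE (le_trans ab0).
have -> : 2 * (a n + b n) * (K / (4 * D ^+ 2) * (a n + b n)) =
  (K / (2 * D ^+ 2)) * (a n + b n) ^+ 2.
  by field; rewrite gt_eqF.
apply/negP; rewrite -ltNge.
apply: (@le_lt_trans _ _ (K / (2 * D ^+ 2) * (D ^+ 2 / 4 ^+ n))).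
  by rewrite ler_wpM2l// ltW// divr_gt0// mulr_gt0// exprn_gt0.
have -> : K / (2 * D ^+ 2) * (D ^+ 2 / 4 ^+ n) = K / 4 ^+ n / 2.
  by field; rewrite expf_neq0// gt_eqF.
by rewrite ltr_pdivrMr// ltr_pMr ?divr_gt0 ?exprn_gt0// ltr1n.
Qed.

End Goursat.

(** * Circle means of holomorphic functions *)

Section CircleMeans.
Variable R : realType.
Notation C := R[i]^o.
Implicit Types (h : C -> C) (x y a b r t : R) (c z : C).

Lemma sintD a b (f g : R -> R) :
  (forall x, a <= x <= b -> {for x, continuous f}) ->
  (forall x, a <= x <= b -> {for x, continuous g}) ->
  sint a b (fun x => f x + g x) = sint a b f + sint a b g.
Proof.
move=> cf cg; apply: RintegralD;
  [exact: measurable_itv|exact: (integrable_itv cf)|exact: (integrable_itv cg)].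
Qed.

Lemma sintZ a b (k : R) (f : R -> R) :
  (forall x, a <= x <= b -> {for x, continuous f}) ->
  sint a b (fun x => k * f x) = k * sint a b f.
Proof.
move=> cf; apply: RintegralZl; [exact: measurable_itv|exact: (integrable_itv cf)].
Qed.

Lemma sint_cst a b (k : R) : a <= b -> sint a b (cst k) = (b - a) * k.
Proof.
move=> ab; have := sint_affine k 0 ab; rewrite mul0r addr0 => <-.
by apply: eq_sint => x _; rewrite mul0r addr0.
Qed.

Lemma sint_affine_subst a b (u v : R) (g : R -> R) : a <= b -> 0 < u ->
  continuous g ->
  sint (u * a + v) (u * b + v) g = u * sint a b (fun t => g (u * t + v)).
Proof.
move=> ab u0 cg; pose F t : R := u * t + v.
have dF (x : R) : is_derive x 1 F u.
  by apply: is_derive_eq; rewrite addr0 /GRing.scale/= mulr1.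
have F' : (F^`())%classic = cst u by apply/funext => x; rewrite derive1E derive_val.
have cF : continuous F.
  move=> x; apply: cvgD; last exact: cvg_cst.
  by apply: cvgM; [exact: cvg_cst|exact: cvg_id].
have cgF : continuous (g \o F) by move=> x; apply: continuous_comp; [exact: cF|exact: cg].
rewrite -sintZ; last by move=> x _; exact: cgF.
rewrite /sint /Rintegral -/(F a) -/(F b).
rewrite (@integration_by_substitution_increasing _ F g a b)//.
- congr fine; apply: eq_integral => x _; rewrite F' /=; congr EFin.
  by rewrite /F /GRing.mul/= mulrC.
- by move=> x y _ _ xy; rewrite /F ltrD2r ltr_pM2l.
- by rewrite F' => x _; exact: cvg_cst.
- by rewrite F'; exact: is_cvg_cst.
- by rewrite F'; exact: is_cvg_cst.
- split.
  + by move=> x _; have := dF x; case.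
  + by apply: cvg_at_right_filter; exact: cF.
  + by apply: cvg_at_left_filter; exact: cF.
- by apply: continuous_subspaceT => x; exact: cg.
Qed.

Lemma expi_pi : expi (pi : R) = -1 :> C.
Proof. by rewrite /expi cospi sinpi; apply/eqP; rewrite eq_complex/= oppr0 !eqxx. Qed.

Lemma expi0 : expi (0 : R) = 1 :> C.
Proof. by rewrite /expi cos0 sin0. Qed.

Lemma expi2pi : expi (2 * pi : R) = 1 :> C.
Proof. by rewrite mulr_natl mulr2n expiD expi_pi mulrNN mulr1. Qed.

Lemma pi2_ge0 : 0 <= 2 * pi :> R.
Proof. by rewrite mulr_ge0// pi_ge0. Qed.

(** Continuity at a point in terms of the real modulus, the form in which
    estimates provide it. *)
Definition ccontinuous (f : C -> R) z := forall e : R, 0 < e ->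
  exists2 d : R, 0 < d & forall w, cabs (w - z) < d -> `|f w - f z| <= e.

Lemma cabs_expiB (s t : R) : cabs (expi s - expi t : C) <= `|s - t| * 2.
Proof.
have lip (f f' : R -> R) : (forall x : R, is_derive x 1 f (f' x)) ->
    (forall x, `|f' x| <= 1) -> forall x y, `|f x - f y| <= `|x - y|.
  move=> df f'1; have wl x y : x < y -> `|f y - f x| <= `|y - x|.
    move=> xy; have [|u _ ->] := @MVT _ f f' x y xy (fun u _ => df u).
      apply: continuous_subspaceT => u; apply: (@differentiable_continuous _ _ _ u f).
      by apply/(derivable1_diffP f u); have := df u; case.
    by rewrite normrM ler_piMl.
  move=> x y; case: (ltgtP x y) => [xy|yx|->]; last by rewrite !subrr.
    by rewrite distrC (distrC x); exact: wl.
  exact: wl.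
apply: (le_trans (cabs_le_ReIm _)); rewrite /= mulr_natr mulr2n lerD//.
- by apply: (lip cos (fun x => - sin x)) => x; rewrite normrN ler_norml sin_geN1 sin_le1.
- by apply: (lip sin cos) => x; rewrite ler_norml cos_geN1 cos_le1.
Qed.

Lemma continuous_circle (f : C -> R) c (r : R) t : 0 <= r ->
  ccontinuous f (c + r%:C%C * expi t) ->
  {for t, continuous (fun t => f (c + r%:C%C * expi t))}.
Proof.
move=> r0 cf; apply/cvgrPdist_le => e e0.
have [d d0 H] := cf _ e0.
have k0 : 0 < 2 * r + 1 by rewrite ltr_wpDl// mulr_ge0.
apply/nbhs_ballP; exists (d / (2 * r + 1)) => /=; first exact: divr_gt0.
move=> s; rewrite /ball/= ltr_pdivlMr// => sd.
rewrite distrC; apply: H.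
rewrite (_ : _ - _ = r%:C%C * (expi s - expi t)); last by ring.
rewrite cabsM cabs_real ger0_norm//.
apply: le_lt_trans sd; apply: (le_trans (ler_wpM2l r0 (cabs_expiB s t))).
by rewrite distrC; have := normr_ge0 (t - s); nra.
Qed.

Lemma differentiable_ccontinuous h z : differentiable h z ->
  ccontinuous (fun z => complex.Re (h z)) z.
Proof.
move=> /differentiable_local_lipschitz[K K0 [d d0 H]] e e0.
exists (Num.min d (e / K)); first by rewrite lt_min d0 divr_gt0.
move=> w; rewrite lt_min => /andP[wd we].
rewrite -raddfB/=; apply: (le_trans (Re_le_cabs _)); apply: (le_trans (H _ wd)).
by rewrite -ler_pdivlMl// mulrC ltW.
Qed.

(** The mean value property. Composing with [c + cexp] turns circles into
    vertical segments of length [2 * pi]: Goursat's theorem shows that the mean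
    over a circle does not depend on its radius, and the limit at radius 0 is
    the value at the centre. *)
Lemma holo_mean c r h : 0 < r ->
  (forall z, cabs (z - c) <= r -> differentiable h z) ->
  sint 0 (2 * pi) (fun t => complex.Re (h (c + r%:C%C * expi t))) =
    2 * pi * complex.Re (h c).
Proof.
move=> r0 dh; pose F := h \o (fun z => c + cexp z).
have dF (x y : R) : x <= ln r -> differentiable F (x +i* y : C)%C.
  move=> xr; apply: differentiable_comp.
    by apply: differentiableD; [exact: differentiable_cst|exact: differentiable_cexp].
  apply: dh; rewrite addrC addKr cabs_cexp/=.
  by rewrite -(lnK (_ : r \is Num.pos))// ler_expR.
have mean_indep x : x <= ln r -> sint 0 (2 * pi) (fun y => complex.Re (F (x +i* y)%C)) =
    sint 0 (2 * pi) (fun y => complex.Re (F (ln r +i* y)%C)).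
  move=> xr; have := @goursat _ F x (ln r) 0 (2 * pi) xr pi2_ge0.
  rewrite /contour; have FE t : F (t +i* 0)%C = F (t +i* (2 * pi))%C.
    by rewrite /F/= !cexp_real_imag expi0 expi2pi.
  rewrite (@eq_sint _ x (ln r) (fun t => complex.Im (F (t +i* 0)%C))
    (fun t => complex.Im (F (t +i* (2 * pi))%C))); last by move=> t _; rewrite FE.
  rewrite subrr add0r => H; apply/eqP; rewrite eq_sym -subr_eq0; apply/eqP; apply: H.
  by move=> t y /andP[_ tr] _; exact: dF.
have -> : sint 0 (2 * pi) (fun t => complex.Re (h (c + r%:C%C * expi t))) =
    sint 0 (2 * pi) (fun y => complex.Re (F (ln r +i* y)%C)).
  by apply: eq_sint => t _; rewrite /F/= cexp_real_imag lnK.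
apply/eqP; rewrite -subr_eq0 -normr_le0; apply/ler_addgt0Pl => e e0; rewrite addr0.
have dc : differentiable h c by apply: dh; rewrite subrr cabs0 ltW.
have e1 : 0 < e / (2 * pi) by rewrite divr_gt0// mulr_gt0// pi_gt0.
have [d d0 Hd] := differentiable_ccontinuous dc e1.
(* The circle of radius [exp x <= d / 2] is inside the disc of radius [d]. *)
pose x := Num.min (ln r) (ln (d / 2)).
have xr : x <= ln r by rewrite ge_min lexx.
rewrite -(mean_indep _ xr).
have H : forall y, 0 <= y <= 2 * pi -> `|complex.Re (F (x +i* y)%C) - (complex.Re (h c) + 0 * y)| <= e / (2 * pi).
  move=> y _; rewrite mul0r addr0; apply: Hd.
  rewrite addrC addKr cabs_cexp/=.
  apply: (@le_lt_trans _ _ (d / 2)); last by rewrite ltr_pdivrMr// ltr_pMr// ltr1n.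
  by rewrite -(lnK (_ : d / 2 \is Num.pos)) ?posrE ?divr_gt0// ler_expR ge_min lexx orbT.
have := sint_near_affine pi2_ge0 _ H; rewrite subr0 mul0r addr0.
have -> : 2 * pi * (e / (2 * pi)) = e.
  by rewrite mulrC divfK// gt_eqF// mulr_gt0// pi_gt0.
by apply => y _; apply: continuous_Re_vline; exact: dF.
Qed.

End CircleMeans.

(** * Circle means of logarithms *)

Section LogMeans.
Variable R : realType.
Notation C := R[i]^o.
Implicit Types (x y a b r t : R) (c z s : C).

Lemma continuous_cabs_circle c s t :
  {for t, continuous (fun t => cabs (c + s * expi t))}.
Proof.
apply/cvgrPdist_le => e e0.
have k0 : 0 < 2 * cabs s + 1 by rewrite ltr_wpDl// mulr_ge0// cabs_ge0.
apply/nbhs_ballP; exists (e / (2 * cabs s + 1)) => /=; first exact: divr_gt0.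
move=> u; rewrite /ball/= ltr_pdivlMr// => ue.
have lip : `|cabs (c + s * expi t) - cabs (c + s * expi u)| <=
    cabs (s * (expi t - expi u)).
  have E : s * (expi t - expi u) = (c + s * expi t) - (c + s * expi u) by ring.
  rewrite E ler_norml le_cabsB andbT lerNl opprB cabs_distC; exact: le_cabsB.
apply: (le_trans lip); rewrite cabsM; apply: le_trans (ltW ue).
apply: (le_trans (ler_wpM2l (cabs_ge0 s) (cabs_expiB t u))).
by have := normr_ge0 (t - u); have := cabs_ge0 s; nra.
Qed.

Lemma continuous_lncabs_circle c s t : 0 < cabs (c + s * expi t) ->
  {for t, continuous (fun t => ln (cabs (c + s * expi t)))}.
Proof.
move=> h; apply: (@continuous_comp _ _ _ (fun t => cabs (c + s * expi t)) (@ln R)).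
  exact: continuous_cabs_circle.
exact: continuous_ln.
Qed.

Section UnitDisc.
Variable rho : R.
Hypothesis rho1 : rho < 1.

Let psi s t := ln (cabs (1 + s * expi t)).

Let cabs_bounds s t : cabs s <= rho -> 1 - rho <= cabs (1 + s * expi t) <= 2.
Proof.
move=> sr; apply/andP; split.
  have := le_cabsB 1 (- (s * expi t)); rewrite opprK cabsN cabsM expiE mulr1 cabs1; lra.
have := rho1; have := le_cabsD 1 (s * expi t); rewrite cabsM expiE mulr1 cabs1; lra.
Qed.

Let cabs_pos s t : cabs s <= rho -> 0 < cabs (1 + s * expi t).
Proof. by move=> /(@cabs_bounds s t)/andP[+ _]; apply: lt_le_trans; rewrite subr_gt0. Qed.

Let psi_cont s t : cabs s <= rho -> {for t, continuous (psi s)}.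
Proof. by move=> sr; apply: continuous_lncabs_circle; exact: cabs_pos. Qed.

Let psi_bound s t : cabs s <= rho -> `|psi s t| <= ln 2 - ln (1 - rho).
Proof.
move=> sr; have /andP[l u] := @cabs_bounds s t sr.
have r0 : 0 < 1 - rho by rewrite subr_gt0.
have : ln (1 - rho) <= psi s t by rewrite ler_ln ?posrE// cabs_pos.
have : psi s t <= ln 2 by rewrite ler_ln ?posrE// cabs_pos.
have : ln (1 - rho) <= 0 by apply: ln_le0; have := cabs_ge0 s; lra.
have : 0 <= ln 2 :> R by apply: ln_ge0; rewrite ler1n.
by rewrite ler_norml => ? ? ? ?; apply/andP; split; lra.
Qed.

Let sqr_small s : cabs s <= rho -> cabs (- s ^+ 2) <= rho.
Proof.
move=> sr; rewrite cabsN cabsX expr2; have := rho1; have := cabs_ge0 s; nra.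
Qed.

(** The angle doubling identity behind the vanishing of the logarithmic mean:
    antipodal factors multiply to [1 - s^2 e^{2it}]. *)
Let double s : cabs s <= rho ->
  sint 0 (2 * pi) (psi s) = sint 0 (2 * pi) (psi (- s ^+ 2)) / 2.
Proof.
move=> sr; have s2r := sqr_small sr.
have p0 : 0 <= pi :> R by exact: pi_ge0.
have pp : pi <= 2 * pi :> R by lra.
have cp s' : cabs s' <= rho -> continuous (psi s') by move=> h t; exact: psi_cont.
rewrite (sint_cat p0 pp); last by move=> t _; exact: cp.
have := sint_affine_subst pi p0 ltr01 (cp _ sr).
have := sint_affine_subst 0 p0 (ltr0Sn R 1) (cp _ s2r).
rewrite !mul1r add0r mulr0 !addr0 -[2%:R]/(2 : R) => -> .
have -> : pi + pi = 2 * pi :> R by ring.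
move=> ->; rewrite mulrAC divff// mul1r -sintD.
- apply: eq_sint => t _; rewrite addr0 mul1r /psi -lnM ?posrE ?cabs_pos//.
  rewrite -cabsM expiD expi_pi mulr_natl mulr2n expiD; congr (ln (cabs _)).
  by ring.
- by move=> t _; exact: cp.
- move=> t _; apply: (@continuous_comp _ _ _ (fun t => 1 * t + pi) (psi s)); last exact: cp.
  apply: cvgD; last exact: cvg_cst.
  by apply: cvgM; [exact: cvg_cst|exact: cvg_id].
Qed.

Lemma log_mean_unit s : cabs s <= rho -> sint 0 (2 * pi) (psi s) = 0.
Proof.
move=> sr; pose B := 2 * pi * (ln 2 - ln (1 - rho)).
have bnd n : forall s, cabs s <= rho -> `|sint 0 (2 * pi) (psi s)| <= B / 2 ^+ n.
  elim: n => [|n ih] u ur.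
    rewrite expr0 divr1.
    have H t : 0 <= t <= 2 * pi -> `|psi u t - (0 + 0 * t)| <= ln 2 - ln (1 - rho).
      by move=> _; rewrite mul0r addr0 subr0; exact: psi_bound.
    have := sint_near_affine (pi2_ge0 R) _ H.
    rewrite mul0r addr0 mulr0 !subr0; apply.
    by move=> t _; exact: psi_cont.
  have -> : B / 2 ^+ n.+1 = B / 2 ^+ n / 2 by rewrite exprSr invfM mulrA.
  rewrite double// normrM [`|2^-1|]ger0_norm// ler_pM2r//.
  exact: ih (sqr_small ur).
apply/eqP; rewrite -normr_le0; apply/ler_addgt0Pl => e e0; rewrite addr0.
have B0 : 0 <= B by have := bnd 0%N s sr; rewrite expr0 divr1; apply: le_trans.
have [n Hn] : exists n : nat, B / e < n%:R.
  by exists (Num.bound (B / e)); rewrite archi_boundP// divr_ge0// ltW.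
apply: (le_trans (bnd n s sr)).
rewrite ler_pdivrMr ?exprn_gt0// mulrC -ler_pdivrMr//.
apply: (le_trans (ltW Hn)); rewrite -natrX ler_nat ltnW//; exact: ltn_expl.
Qed.

End UnitDisc.

Lemma log_mean_off c r : 0 <= r < cabs c ->
  sint 0 (2 * pi) (fun t => ln (cabs (c + r%:C%C * expi t))) = 2 * pi * ln (cabs c).
Proof.
move=> /andP[r0 rc]; have c0 : 0 < cabs c by exact: le_lt_trans rc.
have cn0 : c != 0 by rewrite -cabs_gt0.
pose s : C := r%:C%C / c.
have s1 : cabs s < 1 by rewrite cabsM cabs_real ger0_norm// cabsV ltr_pdivrMr// mul1r.
have E t : c + r%:C%C * expi t = c * (1 + s * expi t).
  by rewrite mulrDr mulr1 mulrA /s mulrCA divff// mulr1.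
have pos t : 0 < cabs (1 + s * expi t).
  have := le_cabsB 1 (- (s * expi t)); rewrite opprK cabsN cabsM expiE mulr1 cabs1; lra.
rewrite (@eq_sint _ _ _ _ (fun t => ln (cabs c) + ln (cabs (1 + s * expi t)))).
  rewrite sintD.
  - by rewrite (log_mean_unit s1)// addr0 (@sint_cst _ _ _ (ln (cabs c))) ?pi2_ge0// subr0.
  - by move=> t _; exact: cvg_cst.
  - by move=> t _; exact: continuous_lncabs_circle.
by move=> t _; rewrite E cabsM lnM ?posrE ?pos ?c0.
Qed.

Lemma sqr_cabsD c z : cabs (c + z) ^+ 2 =
  cabs c ^+ 2 + cabs z ^+ 2 + 2 * complex.Re (c^*%C * z).
Proof. by rewrite !sqr_cabs; case: c z => [a b] [u v] /=; ring. Qed.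

Lemma cabs_conj c : cabs (c^*%C : C) = cabs c.
Proof. by case: c => a b; rewrite /cabs/= sqrrN. Qed.

(** [|c + s e^{it}|^2 + eta] factors as [kappa |1 + sigma e^{it}|^2] with
    [|sigma| < 1], so that the mean of its logarithm is [ln kappa]; moreover
    [kappa >= |c|^2]. *)
Lemma log_mean_regularized c s (eta : R) : c != 0 -> 0 < eta ->
  2 * pi * (2 * ln (cabs c)) <=
  sint 0 (2 * pi) (fun t => ln (cabs (c + s * expi t) ^+ 2 + eta)).
Proof.
move=> c0 eta0; set m := cabs c; set n := cabs s.
have m0 : 0 < m by rewrite cabs_gt0.
have n0 : 0 <= n by exact: cabs_ge0.
pose A := m ^+ 2 + n ^+ 2 + eta.
pose D := Num.sqrt (A ^+ 2 - 4 * (m * n) ^+ 2).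
have DA0 : (m ^+ 2 - n ^+ 2) ^+ 2 <= A ^+ 2 - 4 * (m * n) ^+ 2.
  rewrite /A -subr_ge0.
  have -> : (m ^+ 2 + n ^+ 2 + eta) ^+ 2 - 4 * (m * n) ^+ 2 - (m ^+ 2 - n ^+ 2) ^+ 2
    = eta * (2 * (m ^+ 2 + n ^+ 2) + eta) by ring.
  by rewrite mulr_ge0 ?(ltW eta0)// addr_ge0 ?(ltW eta0)// mulr_ge0// addr_ge0// exprn_ge0// ltW.
have D0 : 0 <= D by exact: sqrtr_ge0.
have D2 : D ^+ 2 = A ^+ 2 - 4 * (m * n) ^+ 2.
  by rewrite sqr_sqrtr// (le_trans _ DA0)// sqr_ge0.
have Dmn : m ^+ 2 - n ^+ 2 <= D.
  by apply: le_trans (ler_norm _) _; rewrite -sqrtr_sqr ler_wsqrtr.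
pose k := (A + D) / 2.
have km : m ^+ 2 <= k.
  by rewrite /k ler_pdivlMr// /A; have := eta0; lra.
have k0 : 0 < k by apply: lt_le_trans km; exact: exprn_gt0.
have kA : k + (m * n) ^+ 2 / k = A.
  apply: (mulIf (lt0r_neq0 k0)); rewrite mulrDl divfK ?lt0r_neq0//.
  have : (2 * k - A) ^+ 2 = A ^+ 2 - 4 * (m * n) ^+ 2 by rewrite -D2 /k; congr (_ ^+ 2); field.
  by nra.
pose sg : C := (k^-1)%:C%C * (c^*%C * s).
have sg1 : cabs sg < 1.
  rewrite !cabsM cabs_real cabs_conj -/m -/n ger0_norm ?invr_ge0 ?ltW// mulrC ltr_pdivrMr// mul1r.
  rewrite /k ltr_pdivlMr// /A; have := sqr_ge0 (m - n); have := eta0; nra.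
have pos t : 0 < cabs (1 + sg * expi t).
  have := le_cabsB 1 (- (sg * expi t)); rewrite opprK cabsN cabsM expiE mulr1 cabs1; lra.
have E t : cabs (c + s * expi t) ^+ 2 + eta = k * cabs (1 + sg * expi t) ^+ 2.
  rewrite !sqr_cabsD cabs1 !cabsM expiE cabs_conj -/m -/n mulr1 conjc1 mul1r.
  rewrite cabs_real ger0_norm ?invr_ge0 ?ltW//.
  have -> : complex.Re (sg * expi t) = k^-1 * complex.Re (c^*%C * (s * expi t)).
    rewrite /sg -!mulrA; case: (c^*%C * (s * expi t)) => u v /=; ring.
  move: (complex.Re _) => X; rewrite -[eta](addKr (m ^+ 2 + n ^+ 2)) -/A -kA mulr1.
  by field; rewrite lt0r_neq0.
rewrite (@eq_sint _ _ _ _ (fun t => ln k + 2 * ln (cabs (1 + sg * expi t)))); last first.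
  by move=> t _; rewrite E lnM ?posrE ?exprn_gt0// lnXn// mulr_natl.
have cl t : {for t, continuous (fun t => ln (cabs (1 + sg * expi t)))}.
  exact: continuous_lncabs_circle.
rewrite sintD; last 2 first.
- by move=> t _; exact: cvg_cst.
- by move=> t _; apply: cvgM; [exact: cvg_cst|exact: cl].
rewrite sintZ; last by move=> t _; exact: cl.
rewrite (log_mean_unit sg1)// mulr0 addr0 (@sint_cst _ _ _ (ln k)) ?pi2_ge0// subr0.
rewrite ler_wpM2l ?pi2_ge0// mulr_natl -lnXn// ler_ln ?posrE// exprn_gt0//.
Qed.

End LogMeans.

(** * A maximum principle and two Schwarz lemmas *)

Section Schwarz.
Variable R : realType.
Notation C := R[i]^o.
Implicit Types (x r t : R) (c z s y : C).

(** The integral is a difference of two suprema over simple functions, hence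
    monotone for arbitrary integrands. It will be applied to subharmonic
    functions on circles, of which only the mean value inequality is used. *)
Lemma le_integral_pointwise (D : set R) (f g : R -> \bar R) :
  (forall x, D x -> (f x <= g x)%E) ->
  (\int[lebesgue_measure]_(x in D) f x <= \int[lebesgue_measure]_(x in D) g x)%E.
Proof.
move=> fg; have fgD x : ((f \_ D) x <= (g \_ D) x)%E.
  by rewrite /patch; case: ifPn => //; rewrite inE; exact: fg.
rewrite /integral; apply: leeB; apply: le_ereal_sup => _ [h hf <-];
  exists h => //= x; apply: le_trans (hf x) _.
- by rewrite !funeposE; apply: le_max2.
- by rewrite !funenegE; apply: le_max2 => //; rewrite leeN2.
Qed.

Lemma integral_sint (a b : R) (q : R -> R) :
  (forall x, a <= x <= b -> {for x, continuous q}) ->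
  (\int[lebesgue_measure]_(x in `[a, b]) (q x)%:E = (sint a b q)%:E)%E.
Proof.
move=> cq; rewrite /sint /Rintegral fineK//.
apply: integrable_fin_num; first exact: measurable_itv.
exact: (integrable_itv cq).
Qed.

Lemma mean_sqr_cabs c r : 0 < r ->
  sint 0 (2 * pi) (fun t => cabs (c + r%:C%C * expi t) ^+ 2) =
  2 * pi * (cabs c ^+ 2 + r ^+ 2).
Proof.
move=> r0; pose h z : C := c^*%C * z.
have dh z : differentiable h z.
  by apply: differentiableM; [exact: differentiable_cst|].
have := holo_mean r0 (fun z (_ : cabs (z - 0) <= r) => dh z).
rewrite /h mulr0 /= mulr0 => H.
rewrite (@eq_sint _ _ _ _ (fun t => (cabs c ^+ 2 + r ^+ 2) +
    2 * complex.Re (c^*%C * (0 + r%:C%C * expi t)))); last first.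
  by move=> t _; rewrite sqr_cabsD cabsM cabs_real expiE mulr1 ger0_norm ?ltW// add0r.
have ch t : {for t, continuous (fun t => complex.Re (c^*%C * (0 + r%:C%C * expi t)))}.
  apply: (@continuous_circle _ (fun z => complex.Re (h z))); first exact: ltW.
  exact: differentiable_ccontinuous.
rewrite sintD; last 2 first.
- by move=> t _; exact: cvg_cst.
- by move=> t _; apply: cvgM; [exact: cvg_cst|exact: ch].
rewrite sintZ; last by move=> t _; exact: ch.
by rewrite H mulr0 addr0 (@sint_cst _ _ _ (_ + _)) ?pi2_ge0// subr0.
Qed.

Lemma continuous_sqr_cabs c s t :
  {for t, continuous (fun t => cabs (c + s * expi t) ^+ 2)}.
Proof.
apply: (@continuous_comp _ _ _ (fun t => cabs (c + s * expi t)) (fun x => x ^+ 2)).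
  exact: continuous_cabs_circle.
exact: exprn_continuous.
Qed.

Lemma mean_majorant c r (mu delta : R) : 0 < r ->
  sint 0 (2 * pi) (fun t => mu - delta * cabs (c + r%:C%C * expi t) ^+ 2) =
  2 * pi * (mu - delta * (cabs c ^+ 2 + r ^+ 2)).
Proof.
move=> r0.
rewrite (@eq_sint _ _ _ _ (fun t => mu + (- delta) * cabs (c + r%:C%C * expi t) ^+ 2)); last first.
  by move=> t _; rewrite mulNr.
rewrite sintD; last 2 first.
- by move=> t _; exact: cvg_cst.
- by move=> t _; apply: cvgM; [exact: cvg_cst|exact: continuous_sqr_cabs].
rewrite sintZ; last by move=> t _; exact: continuous_sqr_cabs.
rewrite mean_sqr_cabs// (@sint_cst _ _ _ mu) ?pi2_ge0// subr0.
by rewrite mulNr mulrCA -mulrBr.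
Qed.

(** A maximum principle on a punctured disc for functions that satisfy a mean
    value inequality, tested only against majorants of the form
    [mu - delta |z|^2]. The gain [delta r^2] is the same for all centres with
    [eta <= |c| <= rho], so that a point where [w + delta |z|^2] is within this
    gain of its supremum already contradicts the mean value inequality. *)
Lemma annulus_max (w : C -> R) (eta rho a B K : R) :
  0 < eta -> eta <= rho -> rho < a ->
  (forall z, 0 < cabs z < eta -> w z <= B) ->
  (forall z, rho < cabs z < a -> w z <= B) ->
  (forall z, 0 < cabs z < a -> w z <= K) ->
  (forall c r mu delta, eta <= cabs c <= rho -> B < w c ->
     0 < r < cabs c -> cabs c + r < a -> 0 < delta ->
     (forall t, w (c + r%:C%C * expi t) <=
        mu - delta * cabs (c + r%:C%C * expi t) ^+ 2) ->
     w c <= mu - delta * (cabs c ^+ 2 + r ^+ 2)) ->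
  forall z, 0 < cabs z < a -> w z <= B.
Proof.
move=> eta0 er ra wB0 wBa wK wsub z za.
have a0 : 0 < a by lra.
apply/ler_addgt0Pl => e e0.
pose delta := e / a ^+ 2.
have delta0 : 0 < delta by rewrite divr_gt0// exprn_gt0.
have dE : delta * a ^+ 2 = e by rewrite /delta divfK// lt0r_neq0// exprn_gt0.
have dz s : 0 < cabs s < a -> delta * cabs s ^+ 2 <= e.
  move=> /andP[y0 ya]; rewrite -dE ler_wpM2l ?(ltW delta0)//.
  by rewrite ler_pXn2r ?nnegrE ?ltW.
have dz0 s : 0 <= delta * cabs s ^+ 2 by rewrite mulr_ge0 ?(ltW delta0)// exprn_ge0// cabs_ge0.
pose W s := w s + delta * cabs s ^+ 2.
pose S := [set W s | s in [set s | 0 < cabs s < a]].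
have supS : has_sup S.
  split; first by exists (W z); exists z.
  by exists (K + e) => _ [s ya <-]; rewrite lerD ?wK ?dz.
pose mu := sup S.
have Wmu s : 0 < cabs s < a -> W s <= mu.
  by move=> ya; apply: sup_upper_bound => //; exists s.
suff mule : mu <= e + B.
  by apply: le_trans mule; apply: le_trans (Wmu z za); rewrite /W lerDl.
rewrite leNgt; apply/negP => muge.
pose r := Num.min (eta / 2) ((a - rho) / 2).
have r0 : 0 < r by rewrite /r lt_min; apply/andP; split; lra.
have r1 : r <= eta / 2 by rewrite ge_min lexx.
have r2 : r <= (a - rho) / 2 by rewrite ge_min lexx orbT.
clearbody r.
(* A point [c] that is maximal up to [tau] lies in [eta <= |c| <= rho], and
   the mean value inequality there gains [delta * r ^+ 2 >= tau]. *)
pose tau := Num.min (delta * r ^+ 2) (mu - (e + B)).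
have tau0 : 0 < tau.
  by rewrite lt_min subr_gt0 muge andbT mulr_gt0// exprn_gt0.
have [_ [c ca <-] Wc] := sup_adherent tau0 supS.
rewrite -/mu in Wc.
have Wc1 : mu - delta * r ^+ 2 < W c.
  by apply: le_lt_trans Wc; rewrite lerD2l lerN2 ge_min lexx.
have Wc2 : e + B < W c.
  apply: le_lt_trans Wc; rewrite lerBrDr -lerBrDl; by rewrite ge_min lexx orbT.
have wc : B < w c.
  by move: Wc2; rewrite /W; have := dz _ ca; lra.
have ec : eta <= cabs c.
  rewrite leNgt; apply/negP => ce.
  by have : w c <= B; [apply: wB0; case/andP: ca => -> _|rewrite leNgt wc].
have cr : cabs c <= rho.
  rewrite leNgt; apply/negP => ce.
  by have : w c <= B; [apply: wBa; case/andP: ca => _ ->; rewrite andbT|rewrite leNgt wc].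
have rc : 0 < r < cabs c by rewrite r0/=; lra.
have cra : cabs c + r < a by lra.
have H t : w (c + r%:C%C * expi t) <= mu - delta * cabs (c + r%:C%C * expi t) ^+ 2.
  rewrite lerBrDr; apply: Wmu; apply/andP; split.
    have := le_cabsB c (- (r%:C%C * expi t)).
    by rewrite opprK cabsN cabsM expiE mulr1 cabs_real ger0_norm ?(ltW r0)//; lra.
  have := le_cabsD c (r%:C%C * expi t).
  by rewrite cabsM expiE mulr1 cabs_real ger0_norm ?(ltW r0)//; lra.
have := wsub c r mu delta _ wc rc cra delta0 H; rewrite ec cr => /(_ isT) wcle.
by move: Wc1; rewrite /W; lra.
Qed.

Lemma cabs_circle c r t : 0 <= r ->
  cabs c - r <= cabs (c + r%:C%C * expi t) <= cabs c + r.
Proof.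
move=> r0; have E : cabs (r%:C%C * expi t : C) = r.
  by rewrite cabsM expiE mulr1 cabs_real ger0_norm.
apply/andP; split.
  by have := le_cabsB c (- (r%:C%C * expi t)); rewrite opprK cabsN E.
by have := le_cabsD c (r%:C%C * expi t); rewrite E.
Qed.

Lemma expr_bounded_le1 (q K : R) : 0 <= q -> (forall n, q ^+ n <= K) -> q <= 1.
Proof.
move=> q0 qK; rewrite leNgt; apply/negP => q1.
have q0' : 0 < q by exact: lt_trans q1.
have K0 : 0 < K by apply: lt_le_trans (qK 0%N).
have lq : 0 < ln q by rewrite ln_gt0.
have lK : 0 <= ln K by rewrite ln_ge0// (le_trans _ (qK 0%N)).
have := archi_boundP (divr_ge0 lK (ltW lq)); rewrite ltr_pdivrMr//.
apply/negP; rewrite -leNgt.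
rewrite mulr_natl -lnXn// ler_ln ?posrE// exprn_gt0//.
Qed.

Lemma differentiable_exp (V : normedModType R[i]) (f : V -> C) (v : V) (n : nat) :
  differentiable f v -> differentiable (fun w => f w ^+ n) v.
Proof.
move=> df; elim: n => [|n ih].
  by under eq_fun do rewrite expr0; exact: differentiable_cst.
under eq_fun do rewrite exprS.
exact: differentiableM.
Qed.

(** Applied to [f^(m+1) / z^m], which tends to 0 at the origin, the maximum
    principle gives Schwarz's inequality up to an [m]-th root. *)
Lemma schwarz_holo (f : C -> C) (a M : R) : 0 < a ->
  (forall z, cabs z < a -> differentiable f z) -> f 0 = 0 ->
  (forall z, cabs z < a -> cabs (f z) <= M) ->
  forall z, cabs z < a -> cabs (f z) * a <= M * cabs z.
Proof.
move=> a0 df f0 fM z za.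
have [z0|z0] := eqVneq (cabs z) 0.
  by move/eqP: z0; rewrite cabs_eq0 => /eqP ->; rewrite f0 cabs0 mul0r mulr0.
have {z0}zp : 0 < cabs z by rewrite lt_neqAle eq_sym z0 cabs_ge0.
have [M0|M0] := leP M 0.
  have fz0 : cabs (f z) = 0.
    by apply/eqP; rewrite eq_le cabs_ge0 andbT (le_trans (fM _ za)).
  have ME : M = 0 by apply/eqP; rewrite eq_le M0 (le_trans _ (fM _ za))// cabs_ge0.
  by rewrite fz0 ME !mul0r.
have [fz0|fz0] := eqVneq (cabs (f z)) 0.
  by rewrite fz0 mul0r mulr_ge0// ltW.
have {fz0}fp : 0 < cabs (f z) by rewrite lt_neqAle eq_sym fz0 cabs_ge0.
suff key rho : cabs z < rho -> rho < a -> cabs (f z) * rho <= M * cabs z.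
  apply/ler_addgt0Pr => e e0.
  pose rho := Num.max ((cabs z + a) / 2) (a - e / cabs (f z)).
  have zr : cabs z < rho by rewrite lt_max; apply/orP; left; lra.
  have ra : rho < a.
    by rewrite gt_max; apply/andP; split; [lra|rewrite ltrBlDr ltrDl divr_gt0].
  have := key _ zr ra.
  have : (a - e / cabs (f z)) * cabs (f z) <= rho * cabs (f z).
    by rewrite ler_pM2r// le_max lexx orbT.
  by rewrite mulrBl divfK ?lt0r_neq0// => ? ?; lra.
move=> zr ra; have r0 : 0 < rho by exact: lt_trans zr.
have d0 : differentiable f 0 by apply: df; rewrite cabs0.
(* [|f| <= L |y|] near 0, so [f^(m+1) / y^m] is small there. *)
have [L L0 [d d0' lipf]] := differentiable_local_lipschitz d0.
have {}lipf y : cabs y < d -> cabs (f y) <= L * cabs y.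
  by move=> yd; have := lipf y; rewrite f0 !subr0; apply.
(* Taking [m]-th roots and letting [m] tend to infinity. *)
suff main m : cabs (f z) * (cabs (f z) / cabs z) ^+ m <= M * (M / rho) ^+ m.
  have q1 : cabs (f z) / cabs z / (M / rho) <= 1.
    apply: (@expr_bounded_le1 _ (M / cabs (f z))).
      by rewrite !divr_ge0// ?cabs_ge0// ltW.
    move=> m; rewrite (expr_div_n (cabs (f z) / cabs z)) ler_pdivrMr ?exprn_gt0 ?divr_gt0//.
    by rewrite mulrAC ler_pdivlMr// mulrC.
  have : cabs (f z) / cabs z <= M / rho.
    by rewrite -[leRHS]mul1r -ler_pdivrMr// divr_gt0.
  by rewrite ler_pdivrMr// mulrAC ler_pdivlMr.
pose B := M * (M / rho) ^+ m.
have B0 : 0 < B by rewrite mulr_gt0// exprn_gt0// divr_gt0.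
pose h y : C := f y * (f y * y^-1) ^+ m.
have hE y : cabs (h y) = cabs (f y) * (cabs (f y) / cabs y) ^+ m.
  by rewrite /h cabsM cabsX cabsM cabsV.
have dh y : 0 < cabs y < a -> differentiable h y.
  move=> /andP[y0 ya]; have yn0 : y != 0 by rewrite -cabs_gt0.
  apply: differentiableM; first exact: df.
  apply: (@differentiable_exp _ (fun y => f y * y^-1)).
  apply: differentiableM; first exact: df.
  exact: (@differentiable_Rinv R[i] y).
rewrite -hE -/B.
pose eta := Num.min rho (Num.min d (B / (L * L ^+ m))).
have eta0 : 0 < eta by rewrite !lt_min r0 d0' divr_gt0// mulr_gt0// exprn_gt0.
have er : eta <= rho by rewrite ge_min lexx.
have hle y b : 0 < b -> b <= cabs y -> cabs y < a -> cabs (h y) <= M * (M / b) ^+ m.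
  move=> b0 yb ya; have y0 : 0 < cabs y by exact: lt_le_trans yb.
  rewrite hE ler_pM ?cabs_ge0 ?exprn_ge0 ?divr_ge0 ?cabs_ge0 ?fM//.
  rewrite lerXn2r ?nnegrE ?divr_ge0 ?cabs_ge0 ?(ltW M0) ?(ltW b0)//.
  by rewrite ler_pM ?cabs_ge0 ?invr_ge0 ?cabs_ge0 ?fM// lef_pV2 ?posrE.
have hsm y : 0 < cabs y < eta -> cabs (h y) <= B.
  rewrite !lt_min => /andP[y0 /and3P[yr yd yB]].
  rewrite hE; apply: (@le_trans _ _ (L * cabs y * L ^+ m)).
    rewrite ler_pM ?cabs_ge0 ?exprn_ge0 ?divr_ge0 ?cabs_ge0 ?lipf//.
    rewrite lerXn2r ?nnegrE ?divr_ge0 ?cabs_ge0 ?(ltW L0)//.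
    by rewrite ler_pdivrMr// lipf.
  by rewrite mulrAC mulrC -ler_pdivlMr ?mulr_gt0 ?exprn_gt0// ltW.
apply: (@annulus_max (fun y => cabs (h y)) eta rho a B (M * (M / eta) ^+ m)) => //.
- by move=> y /andP[ry ya]; apply: hle => //; exact: ltW.
- move=> y /andP[y0 ya]; have [ye|ye] := ltP (cabs y) eta; last exact: hle.
  apply: (@le_trans _ _ B); first by apply: hsm; rewrite y0.
  rewrite /B ler_pM2l// lerXn2r ?nnegrE ?divr_ge0 ?(ltW M0) ?(ltW r0) ?(ltW eta0)//.
  by rewrite ler_pM2l// lef_pV2 ?posrE.
- move=> c r mu delta ec Bc /andP[r00 rc] cra delta0 H.
  have hc0 : cabs (h c) != 0 by rewrite gt_eqF// (lt_trans B0).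
  (* Rotated by [u], the value at [c] is its modulus, and real parts can be
     averaged. *)
  pose u : C := (cabs (h c))^-1%:C%C * (h c)^*%C.
  have uh : u * h c = (cabs (h c))%:C%C.
    rewrite /u -mulrA [_^*%C * _]mulrC -sqr_normc normr_cabs -rmorphXn -rmorphM/=.
    by rewrite expr2 mulKf.
  have u1 : cabs u = 1.
    by rewrite cabsM cabs_real cabs_conj ger0_norm ?invr_ge0 ?cabs_ge0// mulVf.
  have onc y : cabs (y - c) <= r -> 0 < cabs y < a.
    move=> yc; have := le_cabsB c (- (y - c)); have := le_cabsD c (y - c).
    rewrite opprK cabsN (addrC c) subrK; move=> ? ?; apply/andP; split; lra.
  have duh y : cabs (y - c) <= r -> differentiable (fun y => u * h y) y.
    move=> /onc yc; apply: differentiableM; first exact: differentiable_cst.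
    exact: dh.
  have := holo_mean r00 duh; rewrite uh /= => mean.
  have oncirc t : cabs (c + r%:C%C * expi t - c) <= r.
    by rewrite addrC addKr cabsM cabs_real expiE mulr1 ger0_norm// ltW.
  have cq t : {for t, continuous (fun t => delta * cabs (c + r%:C%C * expi t) ^+ 2)}.
    by apply: cvgM; [exact: cvg_cst|exact: continuous_sqr_cabs].
  rewrite -(ler_pM2l (_ : 0 < 2 * pi)) ?mulr_gt0 ?pi_gt0// -mean.
  apply: (@le_trans _ _ (sint 0 (2 * pi) (fun t => mu - delta * cabs (c + r%:C%C * expi t) ^+ 2))).
    apply: le_sint.
    + move=> t _; apply: (@continuous_circle _ (fun y => complex.Re (u * h y))); first exact: ltW.
      by apply: differentiable_ccontinuous; apply: duh.
    + by move=> t _; apply: cvgB; [exact: cvg_cst|exact: cq].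
    + move=> t _; apply: (le_trans _ (H t)).
      by apply: le_trans (ler_norm _) _; apply: le_trans (Re_le_cabs _) _; rewrite cabsM u1 mul1r.
  by rewrite mean_majorant.
- by rewrite zp.
Qed.

(** The same argument for [ln v - (1 - e) ln |z|], which tends to -oo at the
    origin; points where [v] vanishes are given the value [B], as the mean value
    inequality is only needed where [B] is exceeded. *)
Lemma schwarz_subharmonic (D : set C) (v : C -> R) (a M K : R) : 0 < a ->
  (forall z, cabs z < a -> D z) -> subharmonic D (fun z => lne (v z)%:E) ->
  (forall z, cabs z < a -> 0 <= v z <= M) ->
  (forall z, cabs z < a -> v z <= K * cabs z) ->
  forall z, cabs z < a -> v z * a <= M * cabs z.
Proof.
move=> a0 aD [_ subv] v0M vK z za.
have v0 y : cabs y < a -> 0 <= v y by move=> /v0M/andP[].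
have vM y : cabs y < a -> v y <= M by move=> /v0M/andP[].
have [vz0|vzn0] := eqVneq (v z) 0.
  by rewrite vz0 mul0r mulr_ge0 ?cabs_ge0// (le_trans (v0 _ za) (vM _ za)).
have vz : 0 < v z by rewrite lt_neqAle eq_sym vzn0 v0.
have M0 : 0 < M by exact: lt_le_trans (vM _ za).
have zp : 0 < cabs z.
  rewrite lt_neqAle cabs_ge0 andbT eq_sym; apply/eqP => z0.
  by have := vK _ za; rewrite z0 mulr0 leNgt vz.
have K0 : 0 < K by have := lt_le_trans vz (vK _ za); rewrite pmulr_lgt0.
suff key rho : cabs z < rho -> rho < a -> v z * rho <= M * cabs z.
  apply/ler_addgt0Pr => e e0.
  pose rho := Num.max ((cabs z + a) / 2) (a - e / v z).
  have zr : cabs z < rho by rewrite lt_max; apply/orP; left; lra.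
  have ra : rho < a.
    by rewrite gt_max; apply/andP; split; [lra|rewrite ltrBlDr ltrDl divr_gt0].
  have := key _ zr ra.
  have : (a - e / v z) * v z <= rho * v z.
    by rewrite ler_pM2r// le_max lexx orbT.
  by rewrite mulrBl divfK ?lt0r_neq0// => ? ?; lra.
move=> zr ra; have r0 : 0 < rho by exact: lt_trans zr.
have rz : ln (cabs z) <= ln rho by rewrite ler_ln ?posrE// ltW.
suff main e : 0 < e < 1 ->
    ln (v z) - (1 - e) * ln (cabs z) <= ln M - (1 - e) * ln rho.
  rewrite -ler_ln ?posrE ?mulr_gt0// !lnM ?posrE//.
  apply/ler_addgt0Pr => d d0.
  pose e := Num.min (1 / 2) (d / (ln rho - ln (cabs z) + 1)).
  have l0 : 0 < ln rho - ln (cabs z) + 1 by lra.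
  have e01 : 0 < e < 1.
    rewrite lt_min gt_min; apply/andP; split; last by apply/orP; left; lra.
    by apply/andP; split; [lra|exact: divr_gt0].
  have := main _ e01.
  have : e * (ln rho - ln (cabs z)) <= d.
    apply: (@le_trans _ _ (e * (ln rho - ln (cabs z) + 1))); first by case/andP: e01; nra.
    by rewrite -ler_pdivlMr// ge_min lexx orbT.
  by clearbody e; lra.
move=> /andP[e0 e1].
pose B := ln M - (1 - e) * ln rho.
pose w y := if v y == 0 then B else ln (v y) - (1 - e) * ln (cabs y).
have wz : w z = ln (v z) - (1 - e) * ln (cabs z) by rewrite /w (negbTE vzn0).
rewrite -wz -/B.
pose eta := Num.min rho (expR ((B - ln K) / e)).
have eta0 : 0 < eta by rewrite lt_min r0 expR_gt0.
have er : eta <= rho by rewrite ge_min lexx.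
have lnvM y : cabs y < a -> v y != 0 -> ln (v y) <= ln M.
  by move=> ya vy; rewrite ler_ln ?posrE ?vM// lt_neqAle eq_sym vy v0.
have wle y b : 0 < b -> b <= rho -> b <= cabs y -> cabs y < a ->
    w y <= ln M - (1 - e) * ln b.
  move=> b0 br yb ya; rewrite /w; case: ifPn => vy.
    have : ln b <= ln rho by rewrite ler_ln ?posrE.
    by rewrite /B; nra.
  have := lnvM _ ya vy; have : ln b <= ln (cabs y).
    by rewrite ler_ln ?posrE// (lt_le_trans b0).
  nra.
have wsm y : 0 < cabs y < eta -> w y <= B.
  rewrite lt_min => /andP[y0 /andP[yr ye]]; rewrite /w; case: ifPn => // vy.
  have ya : cabs y < a by exact: lt_trans ra.
  have vy0 : 0 < v y by rewrite lt_neqAle eq_sym vy v0.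
  have : ln (v y) <= ln K + ln (cabs y).
    by rewrite -lnM ?posrE// ler_ln ?posrE ?mulr_gt0 ?vK.
  have : ln (cabs y) <= (B - ln K) / e.
    by rewrite -(expRK ((B - ln K) / e)) ler_ln ?posrE ?expR_gt0// ltW.
  by rewrite ler_pdivlMr//; lra.
apply: (@annulus_max w eta rho a B (ln M - (1 - e) * ln eta)) => //.
- move=> y /andP[ry ya]; apply: wle => //; exact: ltW.
- move=> y /andP[y0 ya]; have [ye|ye] := ltP (cabs y) eta; last exact: wle.
  apply: (@le_trans _ _ B); first by apply: wsm; rewrite y0.
  have : ln eta <= ln rho by rewrite ler_ln ?posrE.
  by rewrite /B; nra.
- move=> c r mu delta ec Bc /andP[r00 rc] cra delta0 H.
  have vc : v c != 0 by apply/eqP => vc; move: Bc; rewrite /w vc eqxx ltxx.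
  have ca : cabs c < a by lra.
  have vc0 : 0 < v c by rewrite lt_neqAle eq_sym vc v0.
  have c0 : 0 < cabs c by exact: lt_trans rc.
  have circ t : 0 < cabs (c + r%:C%C * expi t) < a.
    by have /andP[? ?] := cabs_circle c t (ltW r00); apply/andP; split; lra.
  pose q t := (1 - e) * ln (cabs (c + r%:C%C * expi t)) +
    (mu - delta * cabs (c + r%:C%C * expi t) ^+ 2).
  have cl t : {for t, continuous (fun t => ln (cabs (c + r%:C%C * expi t)))}.
    by apply: continuous_lncabs_circle; case/andP: (circ t).
  have cm t : {for t, continuous (fun t => mu - delta * cabs (c + r%:C%C * expi t) ^+ 2)}.
    apply: cvgB; first exact: cvg_cst.
    by apply: cvgM; [exact: cvg_cst|exact: continuous_sqr_cabs].
  have cl' t : {for t, continuous (fun t => (1 - e) * ln (cabs (c + r%:C%C * expi t)))}.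
    by apply: cvgM; [exact: cvg_cst|exact: cl].
  have disc : [set x | cabs (x - c) <= r] `<=` D.
    move=> y /= yc; apply: aD; have := le_cabsD (y - c) c; rewrite subrK; lra.
  have := subv c r r00 disc; rewrite lne_EFin//.
  have mle : (\int[lebesgue_measure]_(t in `[0%R, (2 * pi)%R]) lne (v (c + r%:C%C * expi t))%:E <=
      (sint 0 (2 * pi) q)%:E)%E.
    rewrite -integral_sint; last first.
      by move=> t _; apply: cvgD; [exact: cl'|exact: cm].
    apply: le_integral_pointwise => t _; have /andP[t0 ta] := circ t.
    have := H t; rewrite {1}/w; case: ifPn => vt.
      by rewrite (eqP vt) le0_lneNy// leNye.
    by rewrite lne_EFin ?lee_fin ?lt_neqAle 1?eq_sym ?vt ?v0// /q; lra.
  move=> /le_trans/(_ (lee_wpmul2l _ mle)).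
  have p0 : 0 < 2 * pi :> R by rewrite mulr_gt0// pi_gt0.
  rewrite lee_fin invr_ge0 (ltW p0) => /(_ isT).
  rewrite -EFinM lee_fin ler_pdivlMl//.
  rewrite sintD; last 2 first.
  + by move=> t _; exact: cl'.
  + by move=> t _; exact: cm.
  rewrite sintZ; last by move=> t _; exact: cl.
  rewrite mean_majorant// log_mean_off ?(ltW r00)// mulrCA -mulrDr ler_pM2l//.
  by rewrite /w (negbTE vc); lra.
- by rewrite zp.
Qed.

End Schwarz.

(** * Upper bounds by polydiscs *)

Section UpperBound.
Variables (R : realType) (n : nat) (p : 'I_n -> R).
Hypothesis p0 : forall j, 0 < p j.
Notation C := R[i]^o.
Notation E := (ellipsoid p).
Implicit Types (z w : 'rV[C]_n) (x : C) (j i : 'I_n) (a : 'I_n -> R).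

Definition set_coord z j x : 'rV[C]_n := \row_i (if i == j then x else z 0 i).

Lemma set_coord_line z j x :
  set_coord z j x = set_coord z j 0 + x *: delta_mx 0 j.
Proof.
apply/rowP => i; rewrite !mxE /=.
by case: eqVneq => _; rewrite ?add0r ?mulr1// mulr0 addr0.
Qed.

Lemma set_coord_id z j : set_coord z j (z 0 j) = z.
Proof. by apply/rowP => i; rewrite mxE; have [->|_] := eqVneq i j. Qed.

Lemma enorm_line j x : enorm (x *: delta_mx 0 j : 'rV[C]_n) = cabs x.
Proof.
rewrite /enorm (bigD1 j)//= !mxE !eqxx /= [X in _ + X]big1 => [|i ij].
  by rewrite addr0 /GRing.scale/= mulr1 sqrtr_sqr ger0_norm// cabs_ge0.
by rewrite !mxE (negbTE ij) andbF /GRing.scale/= mulr0 cabs0 expr0n.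
Qed.

Lemma differentiable_line z j x : differentiable (fun x : C => set_coord z j x) x.
Proof.
under eq_fun do rewrite set_coord_line.
apply: differentiableD; first exact: differentiable_cst.
exact: differentiableZl.
Qed.

Lemma ellA_set_coord0 z j (k : nat) : (j < k)%N ->
  E (set_coord z j 0) -> ellA p k (set_coord z j 0).
Proof. by move=> jk Ez; split=> //; rewrite (bigD1 j)//= mxE eqxx mul0r. Qed.

(** The centre of a coordinate disc with [j < k] lies in [A], where [u] vanishes
    to first order. *)
Lemma green_slice (k : nat) u z j (r M : R) :
  green_family E (ellA p k) u -> (j < k)%N -> 0 < r ->
  (forall x, cabs x < r -> E (set_coord z j x)) ->
  (forall x, cabs x < r -> u (set_coord z j x) <= M) ->
  cabs (z 0 j) < r -> u z * r <= M * cabs (z 0 j).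
Proof.
move=> [u01 [_ ush] uA] jk r0 Er uM zr.
have E0 : E (set_coord z j 0) by apply: Er; rewrite cabs0.
have [K K0 HK] := uA _ (ellA_set_coord0 jk E0).
rewrite -{1}(set_coord_id z j).
apply: (@schwarz_subharmonic _ [set x | E (set_coord z j x)]
  (fun x => u (set_coord z j x)) r M K) => //.
- have := ush (set_coord z j 0) (delta_mx 0 j).
  have lE x : set_coord z j 0 + x *: delta_mx 0 j = set_coord z j x.
    by rewrite -set_coord_line.
  congr subharmonic; first by apply/funext => x /=; rewrite lE.
  by apply/funext => x; rewrite lE.
- by move=> x xr; rewrite uM// andbT; case/andP: (u01 _ (Er _ xr)).
- move=> x xr; apply: (le_trans (HK _ (Er _ xr))).
  by rewrite (set_coord_line z j x) addrC addKr enorm_line.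
Qed.

Lemma mobius_slice (k : nat) f z j (r M : R) :
  mobius_family E (ellA p k) f -> (j < k)%N -> 0 < r ->
  (forall x, cabs x < r -> E (set_coord z j x)) ->
  (forall x, cabs x < r -> cabs (f (set_coord z j x)) <= M) ->
  cabs (z 0 j) < r -> cabs (f z) * r <= M * cabs (z 0 j).
Proof.
move=> [fh _ fA] jk r0 Er fM zr.
rewrite -{1}(set_coord_id z j).
apply: (@schwarz_holo _ (fun x => f (set_coord z j x)) r M) => //.
- move=> x xr; apply: (@differentiable_comp _ _ _ _ (set_coord z j) f).
    exact: differentiable_line.
  by apply: fh; exact: Er.
- by apply: fA; apply: ellA_set_coord0 => //; apply: Er; rewrite cabs0.
Qed.

(** Schwarz's lemma for the increment of [f] from the centre, which is bounded
    by 2. *)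
Lemma holo_slice_lipschitz (f : 'rV[C]_n -> C) z j (r : R) :
  holomorphic E f -> (forall w, E w -> cabs (f w) < 1) -> 0 < r ->
  (forall x, cabs x < r -> E (set_coord z j x)) ->
  forall x, cabs x < r ->
    cabs (f (set_coord z j x) - f (set_coord z j 0)) * r <= 2 * cabs x.
Proof.
move=> fh f1 r0 Er.
pose g x := f (set_coord z j x) - f (set_coord z j 0).
apply: (@schwarz_holo _ g r 2 r0); rewrite /g.
- move=> x xr; apply: differentiableB; last exact: differentiable_cst.
  apply: (@differentiable_comp _ _ _ _ (set_coord z j) f).
    exact: differentiable_line.
  by apply: fh; exact: Er.
- by rewrite subrr.
- move=> x xr; have := le_cabsD (f (set_coord z j x)) (- f (set_coord z j 0)).
  rewrite cabsN; have := f1 _ (Er _ xr); have := f1 _ (Er 0 _); rewrite cabs0 => /(_ r0); lra.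
Qed.

Lemma powR_lt_2p j (x y : R) : 0 <= x -> x < y -> x `^ (2 * p j) < y `^ (2 * p j).
Proof.
move=> x0 xy; rewrite gt0_ltr_powR ?nnegrE// ?mulr_gt0//.
by rewrite ltW// (le_lt_trans x0).
Qed.

Lemma powR_le_2p j (x y : R) : 0 <= x -> x <= y -> x `^ (2 * p j) <= y `^ (2 * p j).
Proof.
move=> x0 xy; apply: ge0_ler_powR => //; rewrite ?nnegrE//.
  by rewrite mulr_ge0// ltW.
exact: le_trans xy.
Qed.

(** Schwarz's lemma, applied to one coordinate at a time in a polydisc
    [|w_j| < a j, j in T] that lies in the ellipsoid: the bound by the product
    over the coordinates treated so far is constant along a disc in the next
    coordinate, so that it can serve as the bound [M] there. *)
Lemma polydisc_bound (k : nat) (u : 'rV[C]_n -> R) (T : {set 'I_n}) a :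
  (forall w, E w -> u w <= 1) ->
  (forall w j (r M : R), (j < k)%N -> 0 < r ->
    (forall x, cabs x < r -> E (set_coord w j x)) ->
    (forall x, cabs x < r -> u (set_coord w j x) <= M) ->
    cabs (w 0 j) < r -> u w * r <= M * cabs (w 0 j)) ->
  (forall j, j \in T -> (j < k)%N /\ 0 < a j) ->
  forall z, E z -> (forall j, j \in T -> cabs (z 0 j) <= a j) ->
  \sum_j (if j \in T then a j else cabs (z 0 j)) `^ (2 * p j) <= 1 ->
  u z <= \prod_(j in T) (cabs (z 0 j) / a j).
Proof.
move=> u1 uslice aT z Ez za sa.
suff H (s : seq 'I_n) : uniq s -> {subset s <= T} -> forall z, E z ->
    (forall j, j \in T -> cabs (z 0 j) <= a j) ->
    \sum_j (if j \in T then a j else cabs (z 0 j)) `^ (2 * p j) <= 1 ->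
    u z <= \prod_(j <- s) (cabs (z 0 j) / a j).
  rewrite -big_enum; apply: H => //; first exact: enum_uniq.
  by move=> j; rewrite mem_enum.
elim: s => [|j s ih] /= {z Ez za sa}.
  by move=> _ _ z Ez _ _; rewrite big_nil u1.
move=> /andP[js us] sT z Ez za sa.
have jT : j \in T by apply: sT; rewrite mem_head.
have {}ih := ih us (fun i hi => sT i (@mem_behead _ (j :: s) i hi)).
have [jk aj0] := aT _ jT.
rewrite big_cons.
(* On the boundary of the disc the factor is 1. *)
have [zja|zja] := leP (a j) (cabs (z 0 j)).
  have -> : cabs (z 0 j) / a j = 1.
    by have -> : cabs (z 0 j) = a j; [apply/eqP; rewrite eq_le zja za|rewrite divff// gt_eqF].
  by rewrite mul1r ih.
rewrite mulrAC ler_pdivlMr// [cabs _ * _]mulrC.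
have Ex x : cabs x < a j -> E (set_coord z j x).
  move=> xa; apply: lt_le_trans sa; rewrite (bigD1 j)//= [ltRHS](bigD1 j)//=.
  rewrite mxE eqxx jT ltr_leD// ?powR_lt_2p ?cabs_ge0//.
  apply: ler_sum => i ij; rewrite mxE (negbTE ij); case: ifPn => // iT.
  by rewrite powR_le_2p ?cabs_ge0// za.
apply: uslice => // x xa.
have -> : \prod_(i <- s) (cabs (z 0 i) / a i) =
    \prod_(i <- s) (cabs (set_coord z j x 0 i) / a i).
  rewrite [LHS]big_seq [RHS]big_seq; apply: eq_bigr => i si; rewrite mxE.
  by case: eqP => // ij; move: js; rewrite -ij si.
apply: ih; first exact: Ex.
- move=> i iT; rewrite mxE; case: eqP => [->|_]; [exact: ltW|exact: za].
- apply: le_trans sa; apply: ler_sum => i _; rewrite mxE.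
  by case: ifPn => // iT; case: eqP => // ij; move: iT; rewrite ij jT.
Qed.

Lemma green_le_polydisc (k : nat) u (T : {set 'I_n}) a :
  green_family E (ellA p k) u ->
  (forall j, j \in T -> (j < k)%N /\ 0 < a j) ->
  forall z, E z -> (forall j, j \in T -> cabs (z 0 j) <= a j) ->
  \sum_j (if j \in T then a j else cabs (z 0 j)) `^ (2 * p j) <= 1 ->
  u z <= \prod_(j in T) (cabs (z 0 j) / a j).
Proof.
move=> gu; apply: (@polydisc_bound k).
  by case: gu => u01 _ _ w /u01/andP[_ /ltW].
by move=> w j r M; exact: green_slice.
Qed.

Lemma mobius_le_polydisc (k : nat) f (T : {set 'I_n}) a :
  mobius_family E (ellA p k) f ->
  (forall j, j \in T -> (j < k)%N /\ 0 < a j) ->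
  forall z, E z -> (forall j, j \in T -> cabs (z 0 j) <= a j) ->
  \sum_j (if j \in T then a j else cabs (z 0 j)) `^ (2 * p j) <= 1 ->
  cabs (f z) <= \prod_(j in T) (cabs (z 0 j) / a j).
Proof.
move=> mf; apply: (@polydisc_bound k (fun w => cabs (f w))).
  by case: mf => _ f1 _ w /f1/ltW.
by move=> w j r M; exact: mobius_slice.
Qed.

End UpperBound.

(** * Logarithmically plurisubharmonic monomials *)

Section LogMonomial.
Variables (R : realType) (n : nat) (b al : 'I_n -> R).
Hypotheses (b0 : forall j, 0 < b j) (al0 : forall j, 0 <= al j).
Notation C := R[i]^o.
Implicit Types (X : 'I_n -> R) (x t eta : R) (j : 'I_n).

Definition monomial X : R := \prod_j (X j / b j) `^ al j.

Lemma monomial_ge0 X : 0 <= monomial X.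
Proof. by apply: prodr_ge0 => j _; exact: powR_ge0. Qed.

Lemma monomial_gt0 X : (forall j, al j != 0 -> 0 < X j) -> 0 < monomial X.
Proof.
move=> X0; apply: prodr_gt0 => j _; have [->|aj] := eqVneq (al j) 0.
  by rewrite powRr0.
by rewrite powR_gt0// divr_gt0// X0.
Qed.

Lemma ln_monomial X : (forall j, al j != 0 -> 0 < X j) ->
  ln (monomial X) = \sum_j al j * (ln (X j) - ln (b j)).
Proof.
move=> X0; rewrite /monomial.
have H (s : seq 'I_n) : 0 < \prod_(j <- s) (X j / b j) `^ al j /\
    ln (\prod_(j <- s) (X j / b j) `^ al j) = \sum_(j <- s) al j * (ln (X j) - ln (b j)).
  elim: s => [|j s [p0 ih]]; first by rewrite !big_nil ln1.
  have pj : 0 < (X j / b j) `^ al j.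
    have [->|aj] := eqVneq (al j) 0; first by rewrite powRr0.
    by rewrite powR_gt0// divr_gt0// X0.
  rewrite !big_cons mulr_gt0//; split => //.
  rewrite lnM ?posrE// ih ln_powR; congr (_ + _).
  have [->|aj] := eqVneq (al j) 0; first by rewrite !mul0r.
  by rewrite ln_div ?posrE// X0.
by case: (H (index_enum 'I_n)).
Qed.

Lemma eq_continuous_at (T : topologicalType) (f g : T -> R) (v : T) :
  f =1 g -> {for v, continuous f} -> {for v, continuous g}.
Proof. by move=> /funext ->. Qed.

Lemma powR_continuous_nneg (T : topologicalType) (g : T -> R) (v : T) (r : R) :
  0 <= r -> (forall v, 0 <= g v) -> {for v, continuous g} ->
  {for v, continuous (fun v => g v `^ r)}.
Proof.
rewrite le_eqVlt => /predU1P[<-|r0] g0 cg.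
  apply: (@eq_continuous_at _ (cst 1)); last exact: cvg_cst.
  by move=> w; rewrite powRr0.
have [gv|gv] := eqVneq (g v) 0.
  apply/cvgrPdist_lt => e e0; rewrite gv powR0 ?gt_eqF//.
  have : \forall w \near v, g w < e `^ r^-1.
    move/cvgrPdist_lt : cg => /(_ (e `^ r^-1)); rewrite powR_gt0// => /(_ isT).
    by apply: filterS => w; rewrite gv sub0r normrN ger0_norm.
  apply: filterS => w gw; rewrite sub0r normrN ger0_norm ?powR_ge0//.
  have -> : e = (e `^ r^-1) `^ r by rewrite -powRrM mulVf ?gt_eqF// powRr1// ltW.
  by rewrite gt0_ltr_powR ?nnegrE ?powR_ge0.
apply: (@continuous_comp _ _ _ g (fun x => x `^ r)); first exact: cg.
apply: (@differentiable_continuous _ _ _ (g v) (fun x => x `^ r)).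
apply/(derivable1_diffP (fun x => x `^ r) (g v)); apply: derivable_powR.
by rewrite in_itv/= andbT lt_neqAle eq_sym gv g0.
Qed.

Lemma monomial_continuous (T : topologicalType) (X : T -> 'I_n -> R) (v : T) :
  (forall v j, 0 <= X v j) -> (forall j, {for v, continuous (fun v => X v j)}) ->
  {for v, continuous (fun v => monomial (X v))}.
Proof.
move=> X0 cX; rewrite /monomial; elim: (index_enum 'I_n) => [|j s ih].
  apply: (@eq_continuous_at _ (cst 1)); last exact: cvg_cst.
  by move=> w; rewrite big_nil.
apply: (@eq_continuous_at _ (fun v => (X v j / b j) `^ al j *
    \prod_(i <- s) (X v i / b i) `^ al i)); first by move=> w; rewrite big_cons.
apply: cvgM; last exact: ih.
apply: (@powR_continuous_nneg T (fun v => X v j / b j)) => // [w|].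
  by rewrite divr_ge0// ltW.
by apply: cvgM; [exact: cX|exact: cvg_cst].
Qed.

Lemma usc_on_lne (T : topologicalType) (D : set T) (u : T -> R) :
  (forall v, D v -> {for v, continuous u}) -> usc_on D (fun v => lne (u v)%:E).
Proof.
move=> cu v Dv; split.
  by have [uv|uv] := leP (u v) 0; [rewrite le0_lneNy// ltNyr|rewrite lne_EFin// ltry].
move=> a la.
have ua : u v < expR a.
  have [uv|uv] := leP (u v) 0; first exact: le_lt_trans (expR_gt0 a).
  by rewrite -[u v]lnK ?posrE// ltr_expR -lte_fin -lne_EFin.
have : \forall w \near v, u w < expR a.
  move/cvgrPdist_lt : (cu v Dv) => /(_ (expR a - u v)); rewrite subr_gt0 => /(_ ua).
  by apply: filterS => w; rewrite distrC => /(le_lt_trans (ler_norm _)); lra.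
move=> H; rewrite near_withinE; apply: filterS H => w uw _.
have [w0|w0] := leP (u w) 0; first by rewrite le0_lneNy// ltNyr.
by rewrite lne_EFin// lte_fin -ltr_expR lnK ?posrE.
Qed.

Lemma continuous_sumR (F : 'I_n -> R -> R) t :
  (forall j, {for t, continuous (F j)}) ->
  {for t, continuous (fun t => \sum_j F j t)}.
Proof.
move=> cF; elim: (index_enum 'I_n) => [|j s ih].
  apply: (@eq_continuous_at _ (cst 0)); last exact: cvg_cst.
  by move=> w; rewrite big_nil.
apply: (@eq_continuous_at _ (fun t => F j t + \sum_(i <- s) F i t)).
  by move=> w; rewrite big_cons.
by apply: cvgD; [exact: cF|exact: ih].
Qed.

Lemma sint_sum (x1 x2 : R) (F : 'I_n -> R -> R) :
  (forall j t, {for t, continuous (F j)}) -> x1 <= x2 ->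
  sint x1 x2 (fun t => \sum_j F j t) = \sum_j sint x1 x2 (F j).
Proof.
move=> cF x12.
apply: EFin_inj; rewrite -sumEFin -integral_sint; last first.
  by move=> t _; apply: continuous_sumR => j; exact: cF.
under eq_integral do rewrite -sumEFin.
have iF j : lebesgue_measure.-integrable `[x1, x2] (EFin \o F j).
  by apply: integrable_itv => t _; exact: cF.
rewrite (@integral_sum _ _ _ lebesgue_measure _ (measurable_itv _) _
  (fun j => EFin \o F j) iF).
by apply: eq_bigr => j _; rewrite integral_sint.
Qed.

(** Monotone convergence, applied to [B - f m], whose limit dominates
    [B - v]. *)
Lemma integral_ge_decreasing_limit (x1 x2 L B : R) (f : nat -> R -> R)
    (v : R -> \bar R) : x1 <= x2 ->
  (forall m t, {for t, continuous (f m)}) ->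
  (forall m t, f m t <= B) ->
  (forall t, nonincreasing_seq (f^~ t)) ->
  (forall t y, (v t < y%:E)%E -> exists m, f m t < y) ->
  (forall m, L <= sint x1 x2 (f m)) ->
  (L%:E <= \int[lebesgue_measure]_(t in `[x1, x2]) v t)%E.
Proof.
move=> x12 cf fB fdec fv fL.
pose I : set (measurableTypeR R) := `[x1, x2]%classic.
have mI : measurable I by exact: measurable_itv.
pose g m (t : measurableTypeR R) := (B - f m t)%:E.
have cg m t : {for t, continuous (fun t => B - f m t)}.
  by apply: cvgB; [exact: cvg_cst|exact: cf].
have mg m : measurable_fun I (g m).
  by apply: (measurable_int lebesgue_measure); apply: integrable_itv => t _; exact: cg.
have g0 m t : I t -> (0 <= g m t)%E by move=> _; rewrite lee_fin subr_ge0.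
have ndg t : I t -> nondecreasing_seq (g^~ t).
  by move=> _ i j ij; rewrite lee_fin lerD2l lerN2; exact: fdec.
pose G (t : measurableTypeR R) := limn (g^~ t).
have cG t : I t -> g^~ t @ \oo --> G t.
  by move=> It; apply: ereal_nondecreasing_is_cvgn; exact: ndg.
have gG m t : I t -> (g m t <= G t)%E.
  move=> It; rewrite /G (cvg_lim _ (ereal_nondecreasing_cvgn (ndg _ It)))//.
  by apply: ereal_sup_ubound; exists m.
have G0 t : I t -> (0 <= G t)%E by move=> It; apply: le_trans (gG 0%N t It); exact: g0.
have mG : measurable_fun I G by exact: (emeasurable_fun_cvg g).
have intg m : (\int[lebesgue_measure]_(t in I) g m t <= ((x2 - x1) * B - L)%:E)%E.
  rewrite /g integral_sint; last by move=> t _; exact: cg.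
  rewrite lee_fin (@eq_sint _ _ _ _ (fun t => B + (-1) * f m t)); last first.
    by move=> t _; rewrite mulN1r.
  rewrite sintD; last 2 first.
  - by move=> t _; exact: cvg_cst.
  - by move=> t _; apply: cvgM; [exact: cvg_cst|exact: cf].
  rewrite sintZ; last by move=> t _; exact: cf.
  by rewrite (@sint_cst _ _ _ B)// mulN1r lerD2l lerN2.
have intG : (\int[lebesgue_measure]_(t in I) G t <= ((x2 - x1) * B - L)%:E)%E.
  rewrite (@monotone_convergence _ _ _ lebesgue_measure I mI g mg g0 ndg).
  apply: lime_le; last by apply: nearW => m; exact: intg.
  apply: ereal_nondecreasing_is_cvgn => i j ij.
  by apply: le_integral_pointwise => t It; exact: ndg.
have iG : lebesgue_measure.-integrable I G.
  apply/integrableP; split => //.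
  rewrite (eq_integral G); last first.
    by move=> t; rewrite inE => It; rewrite gee0_abs// G0.
  exact: le_lt_trans intG (ltry _).
have iB : lebesgue_measure.-integrable I (EFin \o cst B).
  by apply: integrable_itv => t _; exact: cvg_cst.
apply: (@le_trans _ _ (\int[lebesgue_measure]_(t in I) (B%:E - G t))%E).
  rewrite (integralB mI iB iG).
  rewrite (_ : \int[lebesgue_measure]_(t in I) _ = ((x2 - x1) * B)%:E)%E; last first.
    rewrite -(sint_cst B x12) -integral_sint//.
    by move=> t _; exact: cvg_cst.
  rewrite leeBrDr; last first.
    by rewrite ge0_fin_numE ?integral_ge0// (le_lt_trans intG)// ltry.
  by apply: (le_trans (leeD2l _ intG)); rewrite -EFinD lee_fin addrC subrK.
apply: le_integral_pointwise => t It; rewrite leNgt; apply/negP.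
move: (fun m => gG m t It) (G0 t It) (fv t) => {}gG; case: (G t) gG => [r gG _ fvt|_ _ _|_ /=].
- by rewrite -EFinB => /fvt[m]; have := gG m; rewrite lee_fin; lra.
- by rewrite /= ltNge leNye.
- by rewrite leNgt ltNy0.
Qed.

Lemma cabs_continuous : continuous (@cabs R : C -> R).
Proof.
move=> z; rewrite /continuous_at; apply/(@cvgrPdist_le _ _ _ (nbhs z)) => e e0.
apply/nbhs_cabsP; exists e => // w /ltW wz.
rewrite ler_norml; apply/andP; split.
  by rewrite lerNl opprB; apply: le_trans wz; exact: le_cabsB.
by apply: le_trans wz; rewrite cabs_distC; exact: le_cabsB.
Qed.

(** Jensen's inequality for the logarithm of a product. Zeros on the circle are
    avoided by replacing each modulus [x] by the square root of [x^2 + 1/m],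
    which decreases to [x]. *)
Lemma submean_monomial (c s : 'I_n -> C) :
  (lne (monomial (fun j => cabs (c j)))%:E <= ((2 * pi)^-1)%:E *
    \int[lebesgue_measure]_(t in `[0%R, (2 * pi)%R])
      lne (monomial (fun j => cabs (c j + s j * expi t)))%:E)%E.
Proof.
have [u0|uc] := eqVneq (monomial (fun j => cabs (c j))) 0.
  by rewrite u0 le0_lneNy// leNye.
have cj0 j : al j != 0 -> 0 < cabs (c j).
  move=> aj; rewrite cabs_gt0; apply/eqP => cj; move/eqP: uc; apply.
  by rewrite /monomial (bigD1 j)//= cj cabs0 mul0r powR0// mul0r.
have u0 : 0 < monomial (fun j => cabs (c j)) by rewrite monomial_gt0.
have pi0 : 0 < 2 * pi :> R by rewrite mulr_gt0// pi_gt0.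
rewrite lne_EFin// -lee_pdivrMl//; last by rewrite invr_gt0.
rewrite invrK -EFinM ln_monomial//.
pose F m j t := al j * (ln (cabs (c j + s j * expi t) ^+ 2 + m.+1%:R^-1) / 2 - ln (b j)).
have arg0 m j t : 0 < cabs (c j + s j * expi t) ^+ 2 + m.+1%:R^-1 :> R.
  by rewrite ltr_wpDl ?exprn_ge0 ?cabs_ge0// invr_gt0.
have clog m j t : {for t, continuous (fun t => ln (cabs (c j + s j * expi t) ^+ 2 + m.+1%:R^-1))}.
  apply: (@continuous_comp _ _ _ (fun t => cabs (c j + s j * expi t) ^+ 2 + m.+1%:R^-1) (@ln R)).
    by apply: cvgD; [exact: continuous_sqr_cabs|exact: cvg_cst].
  exact: continuous_ln.
have cF m j t : {for t, continuous (F m j)}.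
  apply: cvgM; first exact: cvg_cst.
  apply: cvgB; last exact: cvg_cst.
  by apply: cvgM; [exact: clog|exact: cvg_cst].
apply: (@integral_ge_decreasing_limit 0 (2 * pi) _
  (\sum_j al j * (ln ((cabs (c j) + cabs (s j)) ^+ 2 + 1) / 2 - ln (b j)))
  (fun m t => \sum_j F m j t)).
- exact: ltW.
- by move=> m t; apply: continuous_sumR => j; exact: cF.
- move=> m t; apply: ler_sum => j _; rewrite ler_wpM2l// lerD2r ler_pM2r//.
  rewrite ler_ln ?posrE//; last by rewrite ltr_wpDl ?exprn_ge0 ?addr_ge0 ?cabs_ge0.
  rewrite lerD//; last by rewrite invf_le1// ler1n.
  rewrite ler_pXn2r ?nnegrE ?addr_ge0 ?cabs_ge0//.
  by apply: (le_trans (le_cabsD _ _)); rewrite cabsM expiE mulr1.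
- move=> t m m' mm'; apply: ler_sum => j _; rewrite ler_wpM2l// lerD2r ler_pM2r//.
  by rewrite ler_ln ?posrE// lerD2l lef_pV2 ?posrE// ler_nat.
- move=> t y uy.
  pose X j : R := cabs (c j + s j * expi t).
  pose U (eta : R) := monomial (fun j => Num.sqrt (X j ^+ 2 + `|eta|)).
  have U0 : U 0 = monomial X.
    by congr monomial; apply/funext => j; rewrite normr0 addr0 sqrtr_sqr ger0_norm// cabs_ge0.
  have U0y : U 0 < expR y.
    rewrite U0; have [uv|uv] := leP (monomial X) 0; first exact: le_lt_trans (expR_gt0 y).
    by rewrite -[monomial X]lnK ?posrE// ltr_expR -lte_fin -lne_EFin.
  have cU : {for 0, continuous U}.
    apply: (@monomial_continuous _ (fun eta j => Num.sqrt (X j ^+ 2 + `|eta|))).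
      by move=> *; exact: sqrtr_ge0.
    move=> j; apply: (@continuous_comp _ _ _ (fun eta : R => X j ^+ 2 + `|eta|) (@Num.sqrt R)).
      by apply: cvgD; [exact: cvg_cst|exact: norm_continuous].
    exact: sqrt_continuous.
  move/cvgrPdist_lt : cU => /(_ (expR y - U 0)); rewrite subr_gt0 => /(_ U0y).
  move=> /nbhs_ballP[d /= d0 dU].
  exists (Num.bound d^-1).
  have md : (Num.bound d^-1).+1%:R^-1 < d.
    rewrite -[ltRHS]invrK ltf_pV2 ?posrE ?invr_gt0//.
    apply: (@lt_trans _ _ (Num.bound d^-1)%:R); last by rewrite ltr_nat.
    by rewrite archi_boundP// invr_ge0 ltW.
  have := dU (Num.bound d^-1).+1%:R^-1; rewrite /ball/= sub0r normrN ger0_norm ?invr_ge0// => /(_ md).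
  rewrite distrC => /(le_lt_trans (ler_norm _)); rewrite ltrD2r.
  move: (Num.bound d^-1) => m Uy.
  have sq0 j : 0 < Num.sqrt (X j ^+ 2 + `|m.+1%:R^-1|).
    by rewrite sqrtr_gt0 ger0_norm ?invr_ge0// arg0.
  rewrite -ltr_expR; apply: le_lt_trans Uy.
  rewrite -[leRHS]lnK ?posrE ?monomial_gt0// ler_expR ln_monomial//.
  apply: ler_sum => j _; rewrite /F -powR12_sqrt ?ln_powR; last first.
    by rewrite addr_ge0 ?exprn_ge0 ?cabs_ge0.
  by rewrite ger0_norm ?invr_ge0// [2^-1 * _]mulrC.
- move=> m; rewrite sint_sum; [|by move=> j t; exact: cF|exact: ltW].
  rewrite mulr_sumr; apply: ler_sum => j _.
  have cl2 t : {for t, continuous (fun t => ln (cabs (c j + s j * expi t) ^+ 2 + m.+1%:R^-1) * 2^-1)}.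
    by apply: cvgM; [exact: clog|exact: cvg_cst].
  rewrite sintZ; last by move=> t _; apply: cvgB; [exact: cl2|exact: cvg_cst].
  have [->|aj] := eqVneq (al j) 0; first by rewrite !mul0r mulr0.
  rewrite mulrCA ler_wpM2l//.
  rewrite (@eq_sint _ _ _ _ (fun t => - ln (b j) + 2^-1 * ln (cabs (c j + s j * expi t) ^+ 2 + m.+1%:R^-1))); last first.
    by move=> t _; rewrite addrC mulrC.
  rewrite sintD; last 2 first.
  + by move=> t _; exact: cvg_cst.
  + by move=> t _; apply: cvgM; [exact: cvg_cst|exact: clog].
  rewrite (@sint_cst _ _ _ (- ln (b j))) ?(ltW pi0)// subr0 sintZ; last by move=> t _; exact: clog.
  rewrite mulrBr mulrN addrC lerD2l.
  have eta0 : 0 < m.+1%:R^-1 :> R by rewrite invr_gt0.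
  have cn0 : c j != 0 by rewrite -cabs_gt0 cj0.
  by have := log_mean_regularized (s j) cn0 eta0; lra.
Qed.

Lemma monomial_psh (G : set 'rV[C]_n) :
  plurisubharmonic G (fun w => lne (monomial (fun j => cabs (w 0 j)))%:E).
Proof.
split=> [|a d].
  apply: usc_on_lne => w _.
  apply: (@monomial_continuous ('rV[C]_n : topologicalType) (fun (w : 'rV[C]_n) j => cabs (w 0 j : C))).
    by move=> *; exact: cabs_ge0.
  move=> j; apply: (@continuous_comp _ _ _ (fun w : 'rV[C]_n => w 0 j : C) (@cabs R)).
    exact: coord_continuous.
  exact: cabs_continuous.
split.
  apply: usc_on_lne => x _.
  apply: (@monomial_continuous _ (fun (x : C) j => cabs ((a + x *: d) 0 j))).
    by move=> *; exact: cabs_ge0.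
  move=> j; apply: (@continuous_comp _ _ _ (fun x : C => (a + x *: d) 0 j : C) (@cabs R)).
    have -> : (fun x : C => (a + x *: d) 0 j : C) = (fun x : C => a 0 j + x * d 0 j).
      by apply/funext => y; rewrite !mxE.
    apply: (@differentiable_continuous R[i] C C x (fun x : C => a 0 j + x * d 0 j)).
    apply: differentiableD; first exact: differentiable_cst.
    by apply: differentiableM => //; exact: differentiable_cst.
  exact: cabs_continuous.
move=> c r r0 _.
have := submean_monomial (fun j => (a + c *: d) 0 j) (fun j => r%:C%C * d 0 j).
move=> H; apply: (le_trans H); apply: lee_wpmul2l.
  by rewrite lee_fin invr_ge0 mulr_ge0// pi_ge0.
apply: le_integral_pointwise => t _; rewrite le_eqVlt; apply/orP; left; apply/eqP.
congr (lne (monomial _)%:E); apply/funext => j; congr cabs.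
by rewrite !mxE; ring.
Qed.

End LogMonomial.

(** * The critical point *)

Section CriticalSet.
Variable R : realType.
Notation C := R[i]^o.

(** The coordinates in [T] are the ones that are pushed to the boundary.
    Conditions [critical_in] and [critical_sum] say that the point with
    coordinates [(c / 2 p_j)^(1 / 2 p_j)] on [T] and [|z_j|] elsewhere dominates
    [z] and lies on the boundary of the ellipsoid; by [critical_out] the
    monomial that is maximal there has exponents at least 1 at all [j < k]. *)
Record critical n (p : 'I_n -> R) (k : nat) (z : 'rV[C]_n) (T : {set 'I_n}) (c : R) := Critical {
  critical_gt0 : 0 < c ;
  critical_lt : forall j, j \in T -> (j < k)%N ;
  critical_in : forall j, j \in T -> 2 * p j * cabs (z 0 j) `^ (2 * p j) <= c ;
  critical_out : forall j, j \notin T -> (j < k)%N ->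
    c <= 2 * p j * cabs (z 0 j) `^ (2 * p j) ;
  critical_sum : c * \sum_(j in T) (2 * p j)^-1 =
    1 - \sum_(j | j \notin T) cabs (z 0 j) `^ (2 * p j) }.

Definition critical_value n (p : 'I_n -> R) (z : 'rV[C]_n) (T : {set 'I_n}) (c : R) : R :=
  \prod_(j in T) (cabs (z 0 j) * (2 * p j / c) `^ (2 * p j)^-1).

Section Sorted.
Variables (n k : nat) (p : 'I_n -> R) (z : 'rV[C]_n).
Hypotheses (p0 : forall j, 0 < p j) (hk : (1 <= k <= n)%N).
Hypothesis Ez : ellipsoid p z.
Hypothesis sorted_z : forall i j : 'I_n, (i <= j < k)%N ->
  p i * cabs (z 0 i) `^ (2 * p i) <= p j * cabs (z 0 j) `^ (2 * p j).

Let y (j : 'I_n) := cabs (z 0 j) `^ (2 * p j).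

Lemma ellq_gt0 s : (0 < s)%N -> 0 < ellq p s.
Proof.
move=> s0; case/andP: hk => k1 kn; have n0 : (0 < n)%N by exact: leq_trans kn.
rewrite /ellq (bigD1 (Ordinal n0))//= ltr_wpDr ?invr_gt0 ?mulr_gt0//.
by apply: sumr_ge0 => j _; rewrite invr_ge0 mulr_ge0// ltW.
Qed.

Lemma ellr_gt0 s : 0 < ellr p z s.
Proof.
rewrite /ellr subr_gt0; apply: le_lt_trans Ez.
rewrite [leRHS](bigID (fun j : 'I_n => (s <= j)%N))/= lerDl.
by apply: sumr_ge0 => j _; exact: powR_ge0.
Qed.

Lemma ellc_gt0 s : (0 < s)%N -> 0 < ellc p z s.
Proof. by move=> s0; rewrite divr_gt0 ?ellr_gt0 ?ellq_gt0. Qed.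

Lemma ellqS (j : 'I_n) : ellq p j.+1 = ellq p j + (2 * p j)^-1.
Proof.
rewrite /ellq (bigD1 j)//= addrC; congr (_ + _); apply: eq_bigl => i.
by rewrite ltnS [RHS]ltn_neqAle andbC.
Qed.

Lemma ellrS (j : 'I_n) : ellr p z j.+1 = ellr p z j + y j.
Proof.
have H : \sum_(i < n | (j <= i)%N) cabs (z 0 i) `^ (2 * p i) =
    y j + \sum_(i < n | (j < i)%N) cabs (z 0 i) `^ (2 * p i).
  rewrite (bigD1 j)//=; congr (_ + _); apply: eq_bigl => i.
  by rewrite ltn_neqAle eq_sym andbC.
by rewrite /ellr H; ring.
Qed.

Let cond (j : 'I_n) := (j < k)%N && (2 * p j * y j <= ellc p z j.+1).

(** The constant for [d + 1] coordinates is a mediant of the constant for [d]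
    coordinates and the term of index [d], so that the failure of the defining
    inequality at [d + 1], by maximality of [d], compares that term with the
    constant for [d] as well. *)
Lemma sorted_critical :
  critical p k z [set j : 'I_n | (j < elld p k z)%N]%SET (ellc p z (elld p k z)).
Proof.
case/andP: hk => k1 kn; have n0 : (0 < n)%N by exact: leq_trans kn.
have condmax j : cond j -> (j.+1 <= elld p k z)%N.
  by move=> cj; rewrite /elld; apply: (@leq_bigmax_cond _ _ (fun j : 'I_n => j.+1)).
have cond0 : cond (Ordinal n0).
  rewrite /cond /ellc ellqS ellrS; apply/andP; split => //.
  have -> : ellq p (Ordinal n0) = 0 by rewrite /ellq big_pred0.
  have pp := p0 (Ordinal n0).
  rewrite add0r invrK mulrC ler_pM2r ?mulr_gt0// lerDr.
  by apply: ltW; exact: ellr_gt0.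
have d0 : (0 < elld p k z)%N by exact: leq_trans (condmax _ cond0).
have [jd cjd dE] : exists2 j, cond j & elld p k z = j.+1.
  have c1 : (0 < #|[pred j | cond j]|)%N by apply/card_gt0P; exists (Ordinal n0).
  have [j cj dj] := eq_bigmax_cond (fun j : 'I_n => j.+1) c1.
  by exists j => //; rewrite /elld -dj.
have [jk jc] := andP cjd.
have cpos := ellc_gt0 d0.
split=> //.
- by move=> j; rewrite inE dE ltnS => /leq_ltn_trans; apply.
- move=> j; rewrite inE dE ltnS => jj.
  rewrite -mulrA (le_trans _ jc)// -mulrA ler_pM2l//.
  by apply: sorted_z; rewrite jj.
- move=> j; rewrite inE -leqNgt => dj jk'.
  have dn : (elld p k z < n)%N by exact: leq_ltn_trans dj (ltn_ord j).
  pose D := Ordinal dn; have Dk : (D < k)%N by exact: leq_ltn_trans jk'.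
  apply: (@le_trans _ _ (2 * p D * y D)); last first.
    by rewrite -!mulrA ler_pM2l//; apply: sorted_z; rewrite dj.
  have : ~~ cond D by apply/negP => /condmax; rewrite ltnn.
  rewrite /cond Dk andTb -ltNge /ellc (ellqS D) (ellrS D) => H.
  have q0 := ellq_gt0 d0; have pD := p0 D.
  have ip : 0 < (2 * p D)^-1 by rewrite invr_gt0 mulr_gt0.
  rewrite ler_pdivrMr//; move: H; rewrite ltr_pdivrMr ?addr_gt0//.
  have -> : 2 * p D * y D * (ellq p D + (2 * p D)^-1) = 2 * p D * y D * ellq p D + y D.
    by field; rewrite gt_eqF.
  by rewrite ltrD2r => /ltW.
- have q0 := ellq_gt0 d0.
  have -> : \sum_(j in [set j : 'I_n | (j < elld p k z)%N]%SET) (2 * p j)^-1 =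
     ellq p (elld p k z).
    by rewrite /ellq; apply: eq_bigl => j; rewrite inE.
  rewrite /ellc.
  rewrite divfK ?gt_eqF// /ellr; congr (_ - _); apply: eq_bigl => j.
  by rewrite inE -leqNgt.
Qed.

End Sorted.

Lemma critical_perm n k (p : 'I_n -> R) (z : 'rV[C]_n) (s : 'S_n) T c :
  (forall j : 'I_n, (s j < k)%N = (j < k)%N) ->
  critical (fun j => p (s j)) k (\row_j z 0 (s j)) T c ->
  critical p k z (s @: T) c.
Proof.
move=> sk [c0 Tk Tin Tout Tsum].
have memT j : (s j \in s @: T) = (j \in T) by rewrite mem_imset//; exact: perm_inj.
split=> //.
- by move=> _ /imsetP[j jT ->]; rewrite sk; exact: Tk.
- by move=> _ /imsetP[j jT ->]; have := Tin j jT; rewrite mxE.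
- move=> i; rewrite -(permKV s i) memT sk => jT jk.
  by have := Tout _ jT jk; rewrite mxE.
- rewrite (reindex_inj (@perm_inj _ s))/=.
  rewrite [in RHS](reindex_inj (@perm_inj _ s))/=.
  rewrite (eq_bigl (fun j => j \in T)) => [|j]; last by rewrite memT.
  rewrite [in RHS](eq_bigl (fun j => j \notin T)) => [|j]; last by rewrite memT.
  by rewrite Tsum; congr (_ - _); apply: eq_bigr => j _; rewrite mxE.
Qed.

Lemma exists_critical n k (p : 'I_n -> R) (z : 'rV[C]_n) :
  (forall j, 0 < p j) -> (1 <= k <= n)%N -> ellipsoid p z ->
  exists T c, critical p k z T c /\ ellR p k z = critical_value p z T c.
Proof.
move=> p0 hk Ez; rewrite /ellR; case: pickP => [s ss|nos]; last first.
  by have [s ss] := ell_sorting_ex p k z; have := nos s; rewrite ss.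
case/andP: ss => /forallP sfix /forallP ssort.
have fixk (j : 'I_n) : (k <= j)%N -> s j = j by move=> kj; have /implyP/(_ kj)/eqP := sfix j.
have sk (j : 'I_n) : (s j < k)%N = (j < k)%N.
  have [kj|jk] := leqP k j; first by rewrite fixk// ltnNge kj.
  rewrite ltnNge; apply/negP => ksj.
  by have /perm_inj sj := fixk _ ksj; move: ksj; rewrite sj leqNgt jk.
pose p' (j : 'I_n) := p (s j); pose z' : 'rV[C]_n := \row_j z 0 (s j).
have p'0 j : 0 < p' j by exact: p0.
have Ez' : ellipsoid p' z'.
  move: Ez; rewrite /ellipsoid/= (reindex_inj (@perm_inj _ s))/=.
  by congr (_ < _); apply: eq_bigr => j _; rewrite mxE.
have sorted_z (i j : 'I_n) : (i <= j < k)%N ->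
    p' i * cabs (z' 0 i) `^ (2 * p' i) <= p' j * cabs (z' 0 j) `^ (2 * p' j).
  by move=> ijk; rewrite !mxE; have /forallP/(_ j)/implyP/(_ ijk) := ssort i.
have crit := sorted_critical p'0 hk Ez' sorted_z.
exists (s @: [set j : 'I_n | (j < elld p' k z')%N]%SET), (ellc p' z' (elld p' k z')).
split; first exact: critical_perm.
rewrite /ellR_sorted /critical_value [RHS](reindex_inj (@perm_inj _ s))/=.
apply: eq_big => [j|j _]; last by rewrite mxE.
by rewrite mem_imset ?inE//; exact: perm_inj.
Qed.

End CriticalSet.

(** * The Green function *)

Section GreenValue.
Variables (R : realType) (n k : nat) (p : 'I_n -> R) (z : 'rV[R[i]^o]_n).
Variables (T : {set 'I_n}) (c : R).
Hypotheses (p0 : forall j, 0 < p j) (Ez : ellipsoid p z).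
Hypothesis crit : critical p k z T c.
Notation C := R[i]^o.
Notation E := (ellipsoid p).
Implicit Types (w : 'rV[C]_n) (j i : 'I_n).

Let c0 : 0 < c. Proof. by case: crit. Qed.
Let p20 j : 0 < 2 * p j. Proof. by rewrite mulr_gt0. Qed.

Definition crit_radius j : R := (c / (2 * p j)) `^ (2 * p j)^-1.

Let a_gt0 j : 0 < crit_radius j.
Proof. by rewrite powR_gt0// divr_gt0. Qed.

Lemma crit_radiusE j : crit_radius j `^ (2 * p j) = c / (2 * p j).
Proof. by rewrite -powRrM mulVf ?gt_eqF// powRr1// ltW// divr_gt0. Qed.

Lemma critical_valueE :
  critical_value p z T c = \prod_(j in T) (cabs (z 0 j) / crit_radius j).
Proof.
apply: eq_bigr => j _; congr (_ * _); apply: (mulIf (lt0r_neq0 (a_gt0 j))).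
rewrite mulVf ?gt_eqF// /crit_radius -powRM ?divr_ge0 ?(ltW c0) ?(ltW (p20 j))//.
by rewrite mulrA divfK ?gt_eqF// divff ?gt_eqF// powR1.
Qed.

Lemma cabs_le_crit_radius j : j \in T -> cabs (z 0 j) <= crit_radius j.
Proof.
move=> jT; have := critical_in crit jT; rewrite mulrC -ler_pdivlMr// -crit_radiusE.
rewrite leNgt => H; rewrite leNgt; apply: contra H; apply: powR_lt_2p => //.
exact: powR_ge0.
Qed.

Lemma sum_crit_radius :
  \sum_j (if j \in T then crit_radius j else cabs (z 0 j)) `^ (2 * p j) = 1.
Proof.
rewrite (bigID (fun j => j \in T))/=.
rewrite (eq_bigr (fun j => c * (2 * p j)^-1)) => [|j ->]; last first.
  by rewrite crit_radiusE.
rewrite -mulr_sumr (critical_sum crit).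
rewrite [X in _ + X](eq_bigr (fun j => cabs (z 0 j) `^ (2 * p j))) ?subrK// => j.
by move=> /negbTE ->.
Qed.

(** Schwarz in the polydisc whose distinguished boundary passes through the
    critical point. *)
Lemma green_le_critical u : green_family E (ellA p k) u ->
  u z <= critical_value p z T c.
Proof.
move=> gu; rewrite critical_valueE; apply: (green_le_polydisc p0 gu) => //.
- by move=> j jT; split; [exact: critical_lt crit _ jT|exact: a_gt0].
- exact: cabs_le_crit_radius.
- by rewrite sum_crit_radius.
Qed.

Lemma mobius_le_critical f : mobius_family E (ellA p k) f ->
  cabs (f z) <= critical_value p z T c.
Proof.
move=> gf; rewrite critical_valueE; apply: (mobius_le_polydisc p0 gf) => //.
- by move=> j jT; split; [exact: critical_lt crit _ jT|exact: a_gt0].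
- exact: cabs_le_crit_radius.
- by rewrite sum_crit_radius.
Qed.

(** The critical point, with a dummy value where its coordinate vanishes (the
    exponent [crit_exp] is then 0). *)
Definition crit_point j : R :=
  if j \in T then crit_radius j
  else if z 0 j == 0 then 1 else cabs (z 0 j).

Definition crit_weight j : R :=
  if j \in T then c / (2 * p j) else cabs (z 0 j) `^ (2 * p j).

(** The exponents for which the monomial is stationary at the critical point
    on the boundary of the ellipsoid; the Lagrange multiplier is [1 / c]. *)
Definition crit_exp j : R := 2 * p j * crit_weight j / c.

Lemma crit_point_gt0 j : 0 < crit_point j.
Proof.
rewrite /crit_point; case: ifPn => // _; case: ifPn => // zj.
by rewrite cabs_gt0.
Qed.

Lemma crit_exp_in j : j \in T -> crit_exp j = 1.
Proof.
move=> jT; rewrite /crit_exp /crit_weight jT.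
by field; rewrite !gt_eqF.
Qed.

Lemma crit_exp_ge1 j : (j < k)%N -> 1 <= crit_exp j.
Proof.
move=> jk; have [jT|jT] := boolP (j \in T); first by rewrite crit_exp_in.
rewrite /crit_exp ler_pdivlMr// mul1r /crit_weight (negbTE jT).
exact: (critical_out crit).
Qed.

Lemma crit_weight_ge0 j : 0 <= crit_weight j.
Proof.
rewrite /crit_weight; case: ifP => _; last exact: powR_ge0.
by rewrite divr_ge0// ltW.
Qed.

Lemma crit_exp_ge0 j : 0 <= crit_exp j.
Proof. by rewrite /crit_exp divr_ge0 ?(ltW c0)// mulr_ge0 ?crit_weight_ge0// ltW. Qed.

Lemma sum_crit_weight : \sum_j crit_weight j = 1.
Proof.
rewrite -sum_crit_radius; apply: eq_bigr => j _; rewrite /crit_weight.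
by case: ifP => // _; rewrite crit_radiusE.
Qed.

Lemma crit_exp_neq0 j : crit_exp j != 0 -> crit_point j `^ (2 * p j) = crit_weight j.
Proof.
rewrite /crit_exp /crit_point /crit_weight; case: ifPn => [_ _|jT].
  by rewrite crit_radiusE.
have [->|//] := eqVneq (z 0 j) 0.
by rewrite cabs0 powR0 ?(gt_eqF (p20 j))// mulr0 mul0r eqxx.
Qed.

Lemma crit_exp_z0 j : z 0 j = 0 -> j \notin T -> crit_exp j = 0.
Proof.
move=> zj jT; rewrite /crit_exp /crit_weight (negbTE jT) zj cabs0 powR0 ?gt_eqF//.
by rewrite mulr0 mul0r.
Qed.

(** The weights add up to 1, and they are the powers [(crit_point j)^(2 p_j)]
    wherever the exponent is nonzero. So the sum of the terms
    [crit_weight j * ((X_j / crit_point j)^(2 p_j) - 1)] is negative inside the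
    ellipsoid, and [phi j] is at most [1 / c] times such a term. The [phi j]
    will be logarithms of the factors of a competitor. *)
Lemma critical_lt0 (X phi : 'I_n -> R) :
  \sum_j X j `^ (2 * p j) < 1 ->
  (forall j, crit_exp j = 0 -> phi j = 0) ->
  (forall j, crit_exp j != 0 -> 0 <= X j /\
     2 * p j * phi j <= crit_exp j * ((X j / crit_point j) `^ (2 * p j) - 1)) ->
  (forall j, 0 <= X j) ->
  \sum_j phi j < 0.
Proof.
move=> X1 phi0 phile X0.
rewrite -(pmulr_rlt0 _ c0) mulr_sumr.
apply: (@le_lt_trans _ _ (\sum_j (X j `^ (2 * p j) - crit_weight j))); last first.
  by rewrite sumrB sum_crit_weight subr_lt0.
apply: ler_sum => j _.
have [e0|e0] := eqVneq (crit_exp j) 0.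
  rewrite phi0// mulr0 subr_ge0.
  have : crit_weight j = 0.
    have -> : crit_weight j = crit_exp j * c / (2 * p j).
      by rewrite /crit_exp; field; rewrite !gt_eqF.
    by rewrite e0 !mul0r.
  by move=> ->; exact: powR_ge0.
have [_ H] := phile j e0.
have bE := crit_exp_neq0 e0; have b0 := crit_point_gt0 j.
have w0 : 0 < crit_weight j.
  by rewrite -bE powR_gt0.
move: H; rewrite powRM ?invr_ge0 ?(ltW b0)//.
have -> : (crit_point j)^-1 `^ (2 * p j) = (crit_weight j)^-1.
  apply: (mulIf (lt0r_neq0 w0)); rewrite mulVf ?gt_eqF// -bE -powRM ?invr_ge0 ?(ltW b0)//.
  by rewrite mulVf ?gt_eqF// powR1.
move=> H; rewrite -(ler_pM2l (p20 j)) mulrCA.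
apply: (le_trans (ler_wpM2l (ltW c0) H)).
rewrite /crit_exp le_eqVlt; apply/orP; left; apply/eqP; field.
by rewrite !gt_eqF.
Qed.

Definition green_extremal w : R :=
  monomial crit_point crit_exp (fun j => cabs (w 0 j)).

Lemma ellipsoid_coord_lt1 w j : E w -> cabs (w 0 j) < 1.
Proof.
move=> Ew; rewrite ltNge; apply/negP => w1.
suff : 1 <= \sum_j cabs (w 0 j) `^ (2 * p j) by rewrite leNgt Ew.
rewrite (bigD1 j)//=; apply: (@le_trans _ _ (cabs (w 0 j) `^ (2 * p j))).
  by have := @powR_le_2p R n p p0 j 1 _ ler01 w1; rewrite powR1.
by rewrite lerDl sumr_ge0// => i _; exact: powR_ge0.
Qed.

Lemma ln_le_sub1 (x : R) : 0 < x -> ln x <= x - 1.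
Proof.
move=> x0; have := @le_ln1Dx R (x - 1); have -> : 1 + (x - 1) = x by ring.
by apply; rewrite ltrBrDr addNr.
Qed.

(** This is the weighted inequality of arithmetic and geometric means, in the
    form [ln x <= x - 1]. *)
Lemma green_extremal_lt1 w : E w -> green_extremal w < 1.
Proof.
move=> Ew; have [u0|u0] := leP (green_extremal w) 0; first exact: le_lt_trans ltr01.
have X0 j : crit_exp j != 0 -> 0 < cabs (w 0 j).
  move=> ej; rewrite lt_neqAle cabs_ge0 andbT eq_sym; apply/eqP => wj.
  move: u0; rewrite /green_extremal /monomial (bigD1 j)//= wj mul0r powR0// mul0r.
  by rewrite ltxx.
rewrite -[ltRHS]expR0 -[green_extremal w]lnK ?posrE// ltr_expR.
rewrite /green_extremal ln_monomial ?crit_point_gt0//; last exact: crit_point_gt0.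
apply: (@critical_lt0 (fun j => cabs (w 0 j))) => //.
- by move=> j ->; rewrite mul0r.
- move=> j ej; split; first exact: cabs_ge0.
  have b0 := crit_point_gt0 j.
  rewrite -ln_div ?posrE ?X0// mulrCA ler_wpM2l ?crit_exp_ge0// -ln_powR.
  by apply: ln_le_sub1; rewrite powR_gt0// divr_gt0// X0.
- by move=> j; exact: cabs_ge0.
Qed.

Lemma le_coord_enorm w j : cabs (w 0 j) <= enorm w.
Proof.
rewrite -(ger0_norm (cabs_ge0 (w 0 j))) -sqrtr_sqr; apply: ler_wsqrtr.
by rewrite (bigD1 j)//= lerDl sumr_ge0// => i _; rewrite exprn_ge0// cabs_ge0.
Qed.

Lemma green_extremal_family : green_family E (ellA p k) green_extremal.
Proof.
split.
- by move=> w Ew; rewrite green_extremal_lt1// monomial_ge0.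
- exact: monomial_psh crit_point_gt0 crit_exp_ge0 E.
move=> a [Ea /eqP/prodf_eq0[j jk /eqP aj]].
exists (\prod_i (crit_point i)^-1 `^ crit_exp i).
  by apply: prodr_gt0 => i _; rewrite powR_gt0// invr_gt0 crit_point_gt0.
move=> w Ew; rewrite /green_extremal /monomial.
under eq_bigr => i _ do rewrite powRM ?cabs_ge0 ?invr_ge0 ?(ltW (crit_point_gt0 _))// mulrC.
rewrite big_split/= ler_wpM2l//.
  by apply: prodr_ge0 => i _; exact: powR_ge0.
have e1 := crit_exp_ge1 jk.
rewrite (bigD1 j)//=; apply: (@le_trans _ _ (cabs (w 0 j) `^ crit_exp j)).
  rewrite ler_piMr ?powR_ge0// prodr_ile1// => i _; rewrite powR_ge0/=.
  have := @ge0_ler_powR R _ (crit_exp_ge0 i) (cabs (w 0 i)) 1; rewrite powR1.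
  by apply; rewrite ?nnegrE ?cabs_ge0// ltW// ellipsoid_coord_lt1.
apply: (@le_trans _ _ (cabs (w 0 j))).
  have [->|wj] := eqVneq (cabs (w 0 j)) 0.
    by rewrite powR0// gt_eqF// (lt_le_trans ltr01).
  apply: ge1r_powR => //; rewrite lt_neqAle eq_sym wj cabs_ge0/= ltW//.
  exact: ellipsoid_coord_lt1.
apply: le_trans (le_coord_enorm _ j).
by rewrite !mxE aj subr0.
Qed.

Lemma green_extremal_z : green_extremal z = critical_value p z T c.
Proof.
rewrite critical_valueE [RHS]big_mkcond; apply: eq_bigr => j _.
rewrite /crit_point; case: ifPn => jT.
  by rewrite crit_exp_in// powRr1// divr_ge0 ?cabs_ge0// ltW.
have [zj|zj] := eqVneq (z 0 j) 0; first by rewrite crit_exp_z0// powRr0.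
by rewrite divff ?cabs_eq0// powR1.
Qed.

Lemma green_critical : green E (ellA p k) z = critical_value p z T c.
Proof.
apply/eqP; rewrite eq_le; apply/andP; split.
  apply: ge_sup; first by exists (green_extremal z), green_extremal => //; exact: green_extremal_family.
  by move=> _ [u gu <-]; exact: green_le_critical.
rewrite -green_extremal_z; apply: sup_upper_bound; last first.
  by exists green_extremal => //; exact: green_extremal_family.
split; first by exists (green_extremal z), green_extremal => //; exact: green_extremal_family.
by exists (critical_value p z T c) => _ [u gu <-]; exact: green_le_critical.
Qed.

End GreenValue.

(** * The Moebius function *)

(** Young's inequality for the product of [x] and 1. *)
Lemma bernoulli_powR (R : realType) (r x : R) : 1 <= r -> 0 <= x ->
  r * (x - 1) <= x `^ r - 1.
Proof.
rewrite le_eqVlt => /predU1P[<- x0|r1 x0]; first by rewrite powRr1// mul1r.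
have r0 : 0 < r by exact: lt_trans r1.
have q0 : 0 < r / (r - 1) by rewrite divr_gt0// subr_gt0.
have := @conjugate_powR R x 1 r (r / (r - 1)) x0 ler01 r0 q0.
rewrite powR1 mulr1 => H.
have {}H : x <= x `^ r / r + 1 / (r / (r - 1)).
  by apply: H; field; rewrite subr_eq0 !gt_eqF.
have := ler_wpM2l (ltW r0) H.
have -> : r * (x `^ r / r + 1 / (r / (r - 1))) = x `^ r + (r - 1).
  by field; rewrite subr_eq0 !gt_eqF.
lra.
Qed.

Section MobiusValue.
Variables (R : realType) (n k : nat) (p : 'I_n -> R) (z : 'rV[R[i]^o]_n).
Variables (T : {set 'I_n}) (c : R).
Hypotheses (p0 : forall j, 0 < p j) (Ez : ellipsoid p z).
Hypothesis crit : critical p k z T c.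
Notation C := R[i]^o.
Notation E := (ellipsoid p).
Implicit Types (w : 'rV[C]_n) (j i : 'I_n) (x : C).
Notation b := (crit_point p z T c).
Notation al := (crit_exp p z T c).

Let b0 j : 0 < b j. Proof. exact: (crit_point_gt0 p0 crit). Qed.

Definition slope j : R := al j - (j < k)%N%:R.

Definition phase j : C := ((cabs (z 0 j))^-1)%:C%C * (z 0 j)^*%C.

Definition mobius_factor j x : C :=
  (((b j)^-1)%:C%C * x) ^+ (j < k)%N *
  cexp ((slope j)%:C%C * (((b j)^-1)%:C%C * phase j * x - 1)).

(** The monomial [|w_j|^(al_j)] is replaced by [w_j] (for the coordinates on
    which [f] has to vanish) times an exponential of a linear function that has
    the same modulus and the same logarithmic derivative at [z]. *)
Definition mobius_extremal w : C := \prod_j mobius_factor j (w 0 j).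

(** An upper bound for the logarithm of the modulus of the [j]-th factor at
    points with moduli [X]. *)
Definition log_bound (X : 'I_n -> R) j : R :=
  (j < k)%N%:R * (ln (X j) - ln (b j)) + slope j * (X j / b j - 1).

Lemma slope_ge0 j : 0 <= slope j.
Proof.
rewrite /slope; case: (ltnP j k) => jk.
  by rewrite subr_ge0; exact: (crit_exp_ge1 p0 crit).
by rewrite subr0; exact: (crit_exp_ge0 p0 crit).
Qed.

Lemma cabs_phase_le1 j : cabs (phase j) <= 1.
Proof.
rewrite /phase cabsM cabs_real cabs_conj ger0_norm ?invr_ge0 ?cabs_ge0//.
have [->|zj] := eqVneq (cabs (z 0 j)) 0; first by rewrite mulr0.
by rewrite mulVf.
Qed.

Lemma phase_z j : phase j * z 0 j = (cabs (z 0 j))%:C%C.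
Proof.
rewrite /phase -mulrA [_^*%C * _]mulrC -sqr_normc normr_cabs -rmorphXn -rmorphM/=.
have [->|zj] := eqVneq (cabs (z 0 j)) 0; first by rewrite expr0n/= mulr0.
by rewrite expr2 mulKf.
Qed.

Lemma cabs_mobius_factor_le j x :
  cabs (mobius_factor j x) <=
    (cabs x / b j) ^+ (j < k)%N * expR (slope j * (cabs x / b j - 1)).
Proof.
rewrite /mobius_factor cabsM cabsX cabsM cabs_real ger0_norm ?invr_ge0 ?(ltW (b0 j))//.
rewrite [_^-1 * cabs x]mulrC ler_wpM2l ?exprn_ge0 ?divr_ge0 ?cabs_ge0 ?(ltW (b0 j))//.
have reE : complex.Re ((slope j)%:C%C * (((b j)^-1)%:C%C * phase j * x - 1)) =
    slope j * ((b j)^-1 * complex.Re (phase j * x) - 1).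
  by rewrite -[_ * phase j * x]mulrA; case: (phase j * x) => u v /=; ring.
rewrite cabs_cexp ler_expR reE.
rewrite ler_wpM2l ?slope_ge0// lerD2r mulrC ler_wpM2r ?invr_ge0 ?(ltW (b0 j))//.
apply: (le_trans (ler_norm _)); apply: (le_trans (Re_le_cabs _)).
by rewrite cabsM ler_piMl ?cabs_ge0// cabs_phase_le1.
Qed.

Lemma differentiable_mobius_factor j x : differentiable (mobius_factor j) x.
Proof.
pose h (y : C) : C := (slope j)%:C%C * (((b j)^-1)%:C%C * phase j * y - 1).
have dmul (u y : C) : differentiable (fun y : C => u * y : C) y.
  by apply: differentiableM; first exact: differentiable_cst.
have dh : differentiable h x.
  apply: differentiableM; first exact: differentiable_cst.
  by apply: differentiableB; [exact: dmul|exact: differentiable_cst].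
have dc : differentiable (@cexp R \o h) x.
  exact: (differentiable_comp dh (differentiable_cexp (h x))).
exact: (differentiableM (differentiable_exp (j < k)%N (dmul ((b j)^-1)%:C%C x)) dc).
Qed.

Lemma mobius_extremal_holo : holomorphic E mobius_extremal.
Proof.
move=> w _; rewrite /mobius_extremal.
elim: (index_enum 'I_n) => [|j s ih].
  by under eq_fun do rewrite big_nil; exact: differentiable_cst.
under eq_fun do rewrite big_cons.
apply: differentiableM ih.
apply: (@differentiable_comp _ _ _ _ (fun w : 'rV[C]_n => w 0 j : C) (mobius_factor j)).
  exact: differentiable_coord.
exact: differentiable_mobius_factor.
Qed.

Lemma mobius_extremal_z : cabs (mobius_extremal z) = critical_value p z T c.
Proof.
rewrite (critical_valueE p0 crit) /mobius_extremal cabs_prod [RHS]big_mkcond.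
apply: eq_bigr => j _; rewrite /mobius_factor.
rewrite -[_ * phase j * _]mulrA phase_z cabsM cabsX cabsM cabs_real ger0_norm ?invr_ge0 ?(ltW (b0 j))//.
rewrite cabs_cexp.
have -> : complex.Re ((slope j)%:C%C * (((b j)^-1)%:C%C * (cabs (z 0 j))%:C%C - 1)) =
    slope j * (cabs (z 0 j) / b j - 1) by rewrite /=; ring.
case: ifPn => jT.
  have jk := critical_lt crit jT.
  rewrite /slope (crit_exp_in p0 crit)// jk subrr mul0r expR0 mulr1 expr1 mulrC.
  by rewrite /crit_point jT.
have [zj|zj] := eqVneq (z 0 j) 0.
  have al0 := crit_exp_z0 c p0 zj jT.
  have kj : (k <= j)%N.
    rewrite leqNgt; apply/negP => jk.
    by have := crit_exp_ge1 p0 crit jk; rewrite al0 ler10.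
  by rewrite /slope al0 ltnNge kj subrr mul0r expR0 expr0 mulr1.
have bz : b j = cabs (z 0 j) by rewrite /crit_point (negbTE jT) (negbTE zj).
by rewrite bz mulVf ?divff ?cabs_eq0// subrr mulr0 expR0 expr1n mulr1.
Qed.

Section Candidate.
Hypothesis log_bound_lt0 : forall X : 'I_n -> R, (forall j, 0 <= X j) ->
  \sum_j X j `^ (2 * p j) < 1 -> (forall j, (j < k)%N -> 0 < X j) ->
  \sum_j log_bound X j < 0.

Lemma mobius_extremal_lt1 w : E w -> cabs (mobius_extremal w) < 1.
Proof.
move=> Ew; pose X j := cabs (w 0 j).
have [/existsP[j /andP[jk /eqP wj]]|/existsPn nz] :=
    boolP [exists j : 'I_n, (j < k)%N && (w 0 j == 0)].
  rewrite /mobius_extremal cabs_prod (bigD1 j)//= /mobius_factor jk wj.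
  by rewrite mulr0 expr1 mul0r cabs0 mul0r ltr01.
have Xk j : (j < k)%N -> 0 < X j.
  by move=> jk; rewrite cabs_gt0; have := nz j; rewrite jk.
rewrite /mobius_extremal cabs_prod.
apply: (@le_lt_trans _ _ (\prod_j expR (log_bound X j))).
  apply: ler_prod => j _; rewrite cabs_ge0/=.
  apply: (le_trans (cabs_mobius_factor_le j (w 0 j))).
  rewrite /log_bound expRD ler_pM2r ?expR_gt0// -/(X j).
  case: (ltnP j k) => jk; last by rewrite mul0r expR0.
  rewrite mul1r -ln_div ?posrE ?Xk// lnK ?posrE ?divr_gt0 ?Xk//.
rewrite -expR_sum -expR0 ltr_expR.
by apply: log_bound_lt0 => // j; exact: cabs_ge0.
Qed.

Lemma mobius_extremal_family : mobius_family E (ellA p k) mobius_extremal.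
Proof.
split; [exact: mobius_extremal_holo|exact: mobius_extremal_lt1|].
move=> a [_ /eqP/prodf_eq0[j jk /eqP aj]].
by rewrite /mobius_extremal (bigD1 j)//= /mobius_factor jk aj mulr0 expr1 !mul0r.
Qed.

Lemma mobius_critical : mobius E (ellA p k) z = critical_value p z T c.
Proof.
have inS : [set cabs (f z) | f in mobius_family E (ellA p k)] (critical_value p z T c).
  by exists mobius_extremal; [exact: mobius_extremal_family|exact: mobius_extremal_z].
apply/eqP; rewrite eq_le; apply/andP; split.
  apply: ge_sup; first by exists (critical_value p z T c).
  by move=> _ [u gu <-]; exact: (mobius_le_critical p0 Ez crit).
apply: sup_upper_bound => //.
split; first by exists (critical_value p z T c).
by exists (critical_value p z T c) => _ [u gu <-]; exact: (mobius_le_critical p0 Ez crit).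
Qed.

End Candidate.

(** The logarithm and the linear function in [log_bound] have the same tangent
    at the critical point, and both lie below [x^(2 p_j) - 1] up to the factor
    [2 p_j]. They enter with weights that add up to [crit_exp j], as
    [critical_lt0] asks for. *)
Lemma mobius_critical_convex : (forall j, j \notin T -> 2^-1 <= p j) ->
  mobius E (ellA p k) z = critical_value p z T c.
Proof.
move=> ph; apply: mobius_critical => X X0 X1 Xk.
apply: (critical_lt0 p0 crit X1) => //.
- move=> j al0; rewrite /log_bound /slope al0.
  case: (ltnP j k) => jk; last by rewrite subrr !mul0r addr0.
  by have := crit_exp_ge1 p0 crit jk; rewrite al0 ler10.
- move=> j alj; split => //; rewrite /log_bound /slope.
  have xp : 0 <= X j / b j by rewrite divr_ge0// ltW.
  have lnb : (j < k)%N -> 2 * p j * (ln (X j) - ln (b j)) <= (X j / b j) `^ (2 * p j) - 1.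
    move=> jk; rewrite -ln_div ?posrE ?Xk// -ln_powR.
    by apply: ln_le_sub1; rewrite powR_gt0// divr_gt0// Xk.
  have [jT|jT] := boolP (j \in T).
    have jk := critical_lt crit jT.
    by rewrite (crit_exp_in p0 crit)// jk subrr mul0r addr0 !mul1r lnb.
  have p1 : 1 <= 2 * p j by have := ph j jT; lra.
  have ber := bernoulli_powR p1 xp.
  case: (ltnP j k) => jk.
    have al1 := crit_exp_ge1 p0 crit jk.
    have := lnb jk.
    have : (al j - 1) * (2 * p j * (X j / b j - 1)) <= (al j - 1) * ((X j / b j) `^ (2 * p j) - 1).
      by rewrite ler_wpM2l// subr_ge0.
    rewrite mul1r /=; lra.
  rewrite mul0r add0r subr0 mulrCA ler_wpM2l//.
  exact: (crit_exp_ge0 p0 crit).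
Qed.

End MobiusValue.

(** * A tangent inequality *)

Section TangentInequality.
Variables (R : realType) (P Q : R).
Hypotheses (P0 : 0 < P) (Q0 : 0 < Q) (discr : (1 - 2 * P) ^+ 2 < 8 * Q).
Implicit Types (s t x al : R).

Let kap : R := P / Q.
Let th : R := (2 * P)^-1.

Let th0 : 0 < th. Proof. by rewrite invr_gt0 mulr_gt0. Qed.

(* In the parameter [s = x^(2 P) / (1 - x^(2 P))], the variable [x] is [X s]
   and the derivative of [- (1 / 2 Q) ln (1 - x^(2 P)) - ln x] with respect to
   [x] is [D s]. *)
Let L s : R := ln s - ln (1 + s).
Let X s : R := expR (th * L s).
Let D s : R := (kap * s - 1) * expR (- th * L s).

(** Up to the factor [2 P Q], a quadratic polynomial in [P s] with discriminant
    [(1 - 2 P)^2 - 8 Q]. *)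
Lemma quadratic_gt0 s : 0 < kap * (s * (1 + s)) - th * (kap * s - 1).
Proof.
have -> : kap * (s * (1 + s)) - th * (kap * s - 1) =
    (2 * (P * s) ^+ 2 - (1 - 2 * P) * (P * s) + Q) / (2 * P * Q).
  by rewrite /kap /th; field; rewrite !gt_eqF.
rewrite divr_gt0//; last by rewrite !mulr_gt0.
move: (P * s) => w; have := sqr_ge0 (4 * w - (1 - 2 * P)); have := discr; nra.
Qed.

Let is_derive_add1 s : is_derive s 1 (fun s : R => 1 + s) 1.
Proof.
have d : is_derive s (1 : R) ((cst (1 : R) : R -> R) + id) (0 + 1) by apply: is_deriveD.
by apply: (is_derive_eq d); rewrite add0r.
Qed.

Let is_derive_scale (r : R) (f : R -> R) s f' : is_derive s (1 : R) f f' ->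
  is_derive s 1 (fun s => r * f s) (r * f').
Proof.
move=> df; have d : is_derive s (1 : R) ((cst r : R -> R) * f) (r *: f' + f s *: (0 : R)).
  by apply: is_deriveM.
by apply: (is_derive_eq d); rewrite /GRing.scale/= mulr0 addr0.
Qed.

Let is_derive_L s : 0 < s -> is_derive s 1 L (s * (1 + s))^-1.
Proof.
move=> s0; have s1 : 0 < 1 + s by lra.
have d1 := is_derive1_ln s0.
have d2 := is_derive_add1 s.
have d3 := @is_derive1_comp R (@ln R) (fun s => 1 + s) s _ _ (is_derive1_ln s1) d2.
have d4 := is_deriveB d1 d3.
apply: (is_derive_eq d4); rewrite mulr1.
by field; rewrite !gt_eqF.
Qed.

Let is_derive_expL (r : R) s : 0 < s ->
  is_derive s 1 (fun s => expR (r * L s)) (expR (r * L s) * (r / (s * (1 + s)))).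
Proof.
move=> s0; have dL := is_derive_L s0.
have dr : is_derive s 1 (fun s => r * L s) (r / (s * (1 + s))).
  exact: is_derive_scale.
exact: (@is_derive1_comp R (@expR R) (fun s => r * L s) s _ _ (is_derive_expR _) dr).
Qed.

Let is_derive_num s : is_derive s 1 (fun s => kap * s - 1) kap.
Proof. by apply: is_derive_eq; rewrite /GRing.scale/= subr0 mulr1. Qed.

Let mvt (f f' : R -> R) s1 s2 : 0 < s1 -> s1 < s2 ->
  (forall s, 0 < s -> is_derive s 1 f (f' s)) ->
  exists2 s, s1 < s < s2 & f s2 - f s1 = f' s * (s2 - s1).
Proof.
move=> s10 s12 df.
have [||s] := @MVT R f f' s1 s2 s12.
- by move=> s; rewrite in_itv/= => /andP[s1s _]; apply: df; exact: lt_trans s1s.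
- apply: within_itv_continuous => s /andP[s1s _].
  apply: (@differentiable_continuous _ _ _ s f).
  by apply/(derivable1_diffP f s); have := df s (lt_le_trans s10 s1s); case.
by rewrite in_itv/= => ?; exists s.
Qed.

Let D_le s1 s2 : 0 < s1 -> s1 <= s2 -> D s1 <= D s2.
Proof.
move=> s10; rewrite le_eqVlt => /predU1P[->//|s12].
pose D' s := kap * expR (- th * L s) +
  (kap * s - 1) * (expR (- th * L s) * (- th / (s * (1 + s)))).
have dD s : 0 < s -> is_derive s 1 D (D' s).
  move=> s0; have d := is_deriveM (is_derive_num s) (is_derive_expL (- th) s0).
  by apply: (is_derive_eq d); rewrite /D' /GRing.scale/=; ring.
have [s /andP[s1s _] E] := mvt s10 s12 dD.
rewrite -subr_ge0 E mulr_ge0 ?subr_ge0 ?(ltW s12)//.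
have s0 : 0 < s by exact: lt_trans s1s.
have s1' : 0 < 1 + s by lra.
have -> : D' s = expR (- th * L s) / (s * (1 + s)) *
    (kap * (s * (1 + s)) - th * (kap * s - 1)).
  by rewrite /D'; field; rewrite !gt_eqF.
by rewrite mulr_ge0 ?divr_ge0 ?expR_ge0 ?mulr_ge0 ?(ltW s0) ?(ltW s1')// ltW// quadratic_gt0.
Qed.

(* The difference between the function and a linear function of slope [d]. *)
Let H (d : R) s : R := th * kap * ln (1 + s) - th * L s - d * X s.

Let H_min s0 s : 0 < s0 -> 0 < s -> H (D s0) s0 <= H (D s0) s.
Proof.
move=> s00 sp.
pose H' u := th * X u / (u * (1 + u)) * (D u - D s0).
have dH (v : R) : 0 < v -> is_derive v 1 (H (D s0)) (H' v).
  move=> s1; have s2 : 0 < 1 + v by lra.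
  have d2 := is_derive_add1 v.
  have d3 := @is_derive1_comp R (@ln R) (fun s => 1 + s) v _ _ (is_derive1_ln s2) d2.
  have d := is_deriveB (is_deriveB (is_derive_scale (th * kap) d3)
    (is_derive_scale th (is_derive_L s1))) (is_derive_scale (D s0) (is_derive_expL th s1)).
  apply: (is_derive_eq d).
  have DE : D v = (kap * v - 1) / X v by rewrite /D mulNr expRN.
  have X0 : 0 < X v by exact: expR_gt0.
  rewrite /H' DE -/(X v); move: (X v) X0 (D s0) => Xv X0 d0.
  by field; rewrite !gt_eqF.
have nn (v : R) : 0 < v -> 0 <= th * X v / (v * (1 + v)).
  move=> s1; rewrite divr_ge0 ?mulr_ge0 ?expR_ge0 ?(ltW s1) ?(ltW th0)//; lra.
case: (ltgtP s0 s) => [s0s|ss0|->//].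
  have [u /andP[s0u us] E] := mvt s00 s0s dH.
  rewrite -subr_ge0 E mulr_ge0 ?subr_ge0 ?(ltW s0s)//.
  have u0 := lt_trans s00 s0u.
  by rewrite mulr_ge0 ?nn// subr_ge0 D_le// ltW.
have [u /andP[su us0] E] := mvt sp ss0 dH.
rewrite -subr_le0 E mulr_le0_ge0 ?subr_ge0 ?(ltW ss0)//.
have u0 := lt_trans sp su.
by rewrite mulr_ge0_le0 ?nn// subr_le0 D_le// ltW.
Qed.

(** The function [- (1 / 2 Q) ln (1 - x^(2 P)) - ln x] is convex, since its
    derivative [D s] is increasing, and therefore lies above its tangent at
    [t]. *)
Lemma tangent_inequality al t x : 0 < t < 1 -> 0 < x < 1 ->
  al = 2 * P * t `^ (2 * P) / (2 * Q * (1 - t `^ (2 * P))) ->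
  ln x - ln t + (al - 1) * (x / t - 1) <=
  (2 * Q)^-1 * (ln (1 - t `^ (2 * P)) - ln (1 - x `^ (2 * P))).
Proof.
move=> t01 x01 alE.
pose s x : R := x `^ (2 * P) / (1 - x `^ (2 * P)).
have P20 : 0 < 2 * P by rewrite mulr_gt0.
have y01 u : 0 < u < 1 -> 0 < u `^ (2 * P) < 1.
  move=> /andP[u0 u1]; rewrite powR_gt0//=.
  by have := @gt0_ltr_powR R _ P20 u 1; rewrite powR1; apply; rewrite ?nnegrE// ltW.
have s0 u : 0 < u < 1 -> 0 < s u.
  by move=> /y01/andP[y0 y1]; rewrite divr_gt0// subr_gt0.
have s1 u : 0 < u < 1 -> 1 + s u = (1 - u `^ (2 * P))^-1.
  by move=> /y01/andP[y0 y1]; rewrite /s; field; rewrite subr_eq0 gt_eqF.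
have Ls u : 0 < u < 1 -> th * L (s u) = ln u.
  move=> u01; have /andP[y0 y1] := y01 u u01; have /andP[u0 _] := u01.
  have y1' : 0 < 1 - u `^ (2 * P) by rewrite subr_gt0.
  rewrite /L s1// /s lnM ?posrE ?invr_gt0// addrK ln_powR /th.
  by field; rewrite gt_eqF.
have Xs u : 0 < u < 1 -> X (s u) = u.
  by move=> u01; rewrite /X Ls// lnK// posrE; case/andP: u01.
have := H_min (s0 t t01) (s0 x x01); rewrite /H !Ls// !Xs// !s1//.
have /andP[t0 t1] := t01; have /andP[yt0 yt1] := y01 t t01.
have /andP[x0 x1] := x01; have /andP[yx0 yx1] := y01 x x01.
rewrite !lnV ?posrE ?subr_gt0//.
have -> : D (s t) = (al - 1) / t.
  rewrite /D mulNr Ls// expRN lnK ?posrE//; congr (_ / _).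
  by rewrite alE /s /kap; field; rewrite !gt_eqF// subr_gt0.
have -> : th * kap = (2 * Q)^-1 by rewrite /th /kap; field; rewrite !gt_eqF.
have -> : (al - 1) / t * t = al - 1 by rewrite divfK// gt_eqF.
have -> : (al - 1) * (x / t - 1) = (al - 1) / t * x - (al - 1) by ring.
move: ((al - 1) / t * x) => u; lra.
Qed.

End TangentInequality.

(** * Two coordinates, and the cusp of the Green function *)

Section PairCase.
Variables (R : realType) (n k : nat) (p : 'I_n -> R) (z : 'rV[R[i]^o]_n).
Variables (i j : 'I_n) (c : R).
Hypotheses (p0 : forall j, 0 < p j) (Ez : ellipsoid p z).
Hypothesis crit : critical p k z [set i]%SET c.
Hypotheses (ij : i != j) (jk : (j < k)%N).
Hypothesis only_ij : forall l, l != i -> l != j -> false.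
Hypothesis discr : (1 - 2 * p j) ^+ 2 < 8 * p i.

Let sum_pair (F : 'I_n -> R) : \sum_l F l = F i + F j.
Proof.
rewrite (bigD1 i)//= (bigD1 j) 1?eq_sym//= [X in _ + (_ + X)]big1 ?addr0// => l /andP[li lj].
by have := only_ij li lj.
Qed.

(** With two coordinates the exact bound [X_i^(2 p_i) < 1 - X_j^(2 p_j)] can be
    used for the coordinate in [T], instead of its linearization; this admits
    exponents [p_j] below [1 / 2]. *)
Lemma mobius_critical_pair :
  mobius (ellipsoid p) (ellA p k) z = critical_value p z [set i]%SET c.
Proof.
have c0 : 0 < c by case: crit.
have jT : j \notin [set i]%SET by rewrite inE eq_sym.
have iT : i \in [set i]%SET by rewrite inE.
have al1 := crit_exp_ge1 p0 crit jk.
have zj : z 0 j != 0.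
  apply/eqP => zj; have := crit_exp_z0 c p0 zj jT; move: al1 => /[swap] ->.
  by rewrite ler10.
pose t := cabs (z 0 j).
have t01 : 0 < t < 1 by rewrite cabs_gt0 zj /=; exact: ellipsoid_coord_lt1.
have Pj0 := p0 j; have Qi0 := p0 i.
have cE : c = 2 * p i * (1 - t `^ (2 * p j)).
  have so : \sum_(l | l \notin [set i]%SET) cabs (z 0 l) `^ (2 * p l) = t `^ (2 * p j).
    rewrite (bigD1 j)//= big1 ?addr0// => l /andP[]; rewrite inE => li lj.
    by have := only_ij li lj.
  have := critical_sum crit; rewrite big_set1 so.
  by move=> <-; field; rewrite gt_eqF.
have y1 : 0 < 1 - t `^ (2 * p j) by move: c0; rewrite cE pmulr_rgt0// mulr_gt0.
have bj : crit_point p z [set i]%SET c j = t by rewrite /crit_point (negbTE jT) (negbTE zj).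
have alE : crit_exp p z [set i]%SET c j =
    2 * p j * t `^ (2 * p j) / (2 * p i * (1 - t `^ (2 * p j))).
  by rewrite /crit_exp /crit_weight (negbTE jT) -cE.
have lnbi : ln (crit_point p z [set i]%SET c i) = (2 * p i)^-1 * ln (1 - t `^ (2 * p j)).
  rewrite /crit_point iT /crit_radius ln_powR; congr (_ * ln _).
  by rewrite cE mulrC mulKf// gt_eqF// mulr_gt0.
apply: (mobius_critical p0 Ez crit) => X X0 X1 Xk.
have ik := critical_lt crit iT.
have Xi := Xk i ik; have Xj := Xk j jk.
rewrite sum_pair in X1.
have Xj1 : X j < 1.
  rewrite ltNge; apply/negP => h.
  have := @powR_le_2p R n p p0 j 1 _ ler01 h; rewrite powR1.
  by have := powR_ge0 (X i) (2 * p i); move: X1; lra.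
have Xj01 : 0 < X j < 1 by rewrite Xj.
have tan := tangent_inequality Pj0 Qi0 discr t01 Xj01 alE.
have lnXi : 2 * p i * ln (X i) < ln (1 - X j `^ (2 * p j)).
  rewrite -ln_powR ltr_ln ?posrE ?powR_gt0//; last by have := powR_gt0 (2 * p i) Xi; lra.
  lra.
rewrite sum_pair /log_bound /slope ik jk (crit_exp_in p0 crit iT) subrr mul0r addr0 !mul1r.
rewrite bj lnbi.
have {}lnXi : ln (X i) < (2 * p i)^-1 * ln (1 - X j `^ (2 * p j)).
  by rewrite mulrC ltr_pdivlMr ?mulr_gt0// mulrC.
move: tan lnXi; rewrite [leRHS]mulrBr.
move: (_ * ln (1 - t `^ _)) (_ * ln (1 - X j `^ _)) => A B; rewrite -[true%:R]/(1 : R); lra.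
Qed.

End PairCase.

Lemma critical_neq0 (R : realType) n k (p : 'I_n -> R) (z : 'rV[R[i]^o]_n) T c :
  ellipsoid p z -> critical p k z T c -> exists i, i \in T.
Proof.
move=> Ez crit; have [T0|[i iT]] := set_0Vmem T; last by exists i.
have := critical_sum crit; rewrite T0 big_set0 mulr0 => H.
have E1 : \sum_j cabs (z 0 j) `^ (2 * p j) =
    \sum_(j | j \notin (finset.set0 : {set 'I_n})) cabs (z 0 j) `^ (2 * p j).
  by apply: eq_bigl => j; rewrite inE.
move/eqP: H; rewrite eq_sym subr_eq0 => /eqP H.
by move: Ez; rewrite /ellipsoid/= E1 -H ltxx.
Qed.

Section NonEqual.
Variables (R : realType) (n k : nat) (p : 'I_n -> R) (j0 : 'I_n).
Hypotheses (p0 : forall j, 0 < p j) (hk : (1 <= k <= n)%N).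
Hypotheses (kj0 : (k <= j0)%N) (pj0 : p j0 < 2^-1).
Notation C := R[i]^o.
Notation E := (ellipsoid p).

(* The points [zt t] have the first [k] coordinates on the boundary of a
   polydisc for the constant [cst0], half of the constant [1 / q] at [t = 0].
   This leaves room for small [t] in the coordinate [j0], and the critical set
   consists of the first [k] coordinates for all these [t]. *)
Let q := ellq p k.
Let q0 : 0 < q. Proof. by apply: (ellq_gt0 p0 hk); case/andP: hk. Qed.
Let cst0 := (2 * q)^-1.
Let cst0_gt0 : 0 < cst0. Proof. by rewrite invr_gt0 mulr_gt0. Qed.
Let p20 j : 0 < 2 * p j. Proof. by rewrite mulr_gt0. Qed.
Let r : R := 2^-1 `^ (2 * p j0)^-1.
Let r0 : 0 < r. Proof. by rewrite powR_gt0. Qed.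

Let base : 'rV[C]_n :=
  \row_j (if (j < k)%N then (crit_radius p cst0 j)%:C%C else 0).
Let zt (x : C) := set_coord base j0 x.
Let T : {set 'I_n} := [set j : 'I_n | (j < k)%N]%SET.

Let rad_gt0 j : 0 < crit_radius p cst0 j.
Proof. by rewrite powR_gt0// divr_gt0. Qed.

Let sumT : \sum_(j in T) (2 * p j)^-1 = q.
Proof. by rewrite /q /ellq; apply: eq_bigl => j; rewrite inE. Qed.

Let cabs_zt x j : cabs (zt x 0 j) =
  if (j < k)%N then crit_radius p cst0 j else if j == j0 then cabs x else 0.
Proof.
rewrite !mxE; have [->|jj] := eqVneq j j0; first by rewrite ltnNge kj0.
by case: ifP => _; rewrite ?cabs0// cabs_real ger0_norm// ltW.
Qed.

Let pow_in x (j : 'I_n) : (j < k)%N -> cabs (zt x 0 j) `^ (2 * p j) = cst0 / (2 * p j).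
Proof. by move=> jk; rewrite cabs_zt jk -powRrM mulVf ?gt_eqF// powRr1// ltW// divr_gt0. Qed.

Let sum_out x : \sum_(j | j \notin T) cabs (zt x 0 j) `^ (2 * p j) = cabs x `^ (2 * p j0).
Proof.
rewrite (bigD1 j0)/=; last by rewrite inE -leqNgt.
rewrite cabs_zt ltnNge kj0 eqxx/= big1 ?addr0// => j /andP[].
rewrite inE => /negbTE jk /negbTE jj.
by rewrite cabs_zt jk jj powR0// gt_eqF.
Qed.

Let Ezt x : cabs x < r -> E (zt x).
Proof.
move=> xr; rewrite /ellipsoid/= (bigID (fun j => j \in T))/= sum_out.
rewrite (eq_bigr (fun j => cst0 * (2 * p j)^-1)) => [|j]; last first.
  by rewrite inE => jk; rewrite pow_in.
rewrite -mulr_sumr sumT.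
have -> : cst0 * q = 2^-1 by rewrite /cst0; field; rewrite gt_eqF.
have : cabs x `^ (2 * p j0) < 2^-1.
  have := powR_lt_2p p0 j0 (cabs_ge0 x) xr.
  by rewrite /r -powRrM mulVf ?gt_eqF// powRr1.
by lra.
Qed.

Let ct (t : R) := (1 - t `^ (2 * p j0)) / q.

Let pow_small (t : R) : 0 <= t < r -> 0 <= t `^ (2 * p j0) < 2^-1.
Proof.
move=> /andP[t0 tr]; rewrite powR_ge0/=.
have := powR_lt_2p p0 j0 t0 tr.
by rewrite /r -powRrM mulVf ?gt_eqF// powRr1.
Qed.

Let cabs_r (t : R) : 0 <= t -> cabs (t%:C%C : C) = t.
Proof. by move=> t0; rewrite cabs_real ger0_norm. Qed.

Let crit_zt (t : R) : 0 <= t < r -> critical p k (zt t%:C%C) T (ct t).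
Proof.
move=> tr; have /andP[y0 y1] := pow_small tr; have /andP[t0 _] := tr.
split.
- by rewrite divr_gt0//; lra.
- by move=> j; rewrite inE.
- move=> j; rewrite inE => jk; rewrite pow_in// mulrC divfK ?gt_eqF//.
  rewrite /cst0 /ct invfM ler_pM2r ?invr_gt0//; lra.
- by move=> j; rewrite inE => /negbTE ->.
- by rewrite sum_out cabs_r// sumT divfK// gt_eqF.
Qed.

Let value (t : R) := expR (q * (ln 2^-1 - ln (1 - t `^ (2 * p j0)))).

Let value_crit (t : R) : 0 <= t < r ->
  critical_value p (zt t%:C%C) T (ct t) = value t.
Proof.
move=> tr; have /andP[y0 y1] := pow_small tr.
have y1' : 0 < 1 - t `^ (2 * p j0) by lra.
have c0 := critical_gt0 (crit_zt tr).
rewrite /value /critical_value -sumT mulr_suml expR_sum.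
apply: eq_bigr => j; rewrite inE => jk; rewrite cabs_zt jk /crit_radius.
have d1 : 0 < cst0 / (2 * p j) by exact: divr_gt0.
have d2 : 0 < 2 * p j / ct t by exact: divr_gt0.
rewrite -powRM ?(ltW d1) ?(ltW d2)//.
have -> : cst0 / (2 * p j) * (2 * p j / ct t) = 2^-1 / (1 - t `^ (2 * p j0)).
  by rewrite /cst0 /ct; field; rewrite !gt_eqF.
rewrite -ln_div ?posrE// -ln_powR lnK// posrE powR_gt0// divr_gt0//.
Qed.

Let mobius_zt_le (t : R) : 0 <= t < r ->
  mobius E (ellA p k) (zt t%:C%C) <= value 0 + 2 * t / r.
Proof.
move=> tr; have /andP[t0 tr'] := tr.
apply: ge_sup.
  exists (cabs (0 : C)), (fun=> 0 : C) => //; split => //.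
  by move=> w _; rewrite cabs0 ltr01.
move=> _ [f mf <-]; have [fh f1 _] := mf.
have r00 : 0 <= (0 : R) < r by rewrite lexx r0.
have f0 : cabs (f (zt 0)) <= value 0.
  rewrite -value_crit//; apply: mobius_le_critical mf => //; last exact: (crit_zt r00).
  by apply: Ezt; rewrite cabs0.
have := @holo_slice_lipschitz R n p f base j0 r fh f1 r0 Ezt t%:C%C.
rewrite cabs_r// => /(_ tr'); rewrite -ler_pdivlMr// => lip.
rewrite -/(zt _) -/(zt _) in lip.
have -> : f (zt t%:C%C) = f (zt 0) + (f (zt t%:C%C) - f (zt 0)) by ring.
by apply: (le_trans (le_cabsD _ _)); exact: lerD.
Qed.

(** Where [p_j0 < 1/2] the Green function has a cusp [t^(2 p_j0)] along the
    coordinate [j0], whereas bounded holomorphic functions are uniformly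
    Lipschitz there. *)
Lemma mobius_neq_green :
  ~ (forall z, E z -> mobius E (ellA p k) z = green E (ellA p k) z).
Proof.
move=> mg; have P0 := p0 j0.
have main (t : R) : 0 < t < r -> value 0 * (q * t `^ (2 * p j0)) <= 2 * t / r.
  move=> /andP[t0 tr]; have t0r : 0 <= t < r by rewrite ltW.
  have Et : E (zt t%:C%C) by apply: Ezt; rewrite cabs_r// ltW.
  have := mobius_zt_le t0r; rewrite mg// (green_critical p0 Et (crit_zt t0r)) value_crit//.
  have /andP[y0 y1] := pow_small t0r.
  have vE : value t = value 0 * expR (q * (- ln (1 - t `^ (2 * p j0)))).
    rewrite /value powR0 ?gt_eqF// subr0 ln1 subr0 -expRD; congr expR; ring.
  rewrite vE => H.
  have y1' : 0 < 1 - t `^ (2 * p j0) by rewrite subr_gt0 (lt_trans y1)// invf_lt1// ltr1n.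
  have l1 : t `^ (2 * p j0) <= - ln (1 - t `^ (2 * p j0)).
    rewrite lerNr; apply: le_trans (ln_le_sub1 y1') _.
    by rewrite addrAC subrr add0r.
  have v0 : 0 <= value 0 by exact: expR_ge0.
  rewrite -(lerD2l (value 0)); apply: le_trans H.
  rewrite -[X in X + _]mulr1 -mulrDr ler_wpM2l//.
  apply: le_trans (expR_ge1Dx _); rewrite lerD2l ler_wpM2l//.
  exact: ltW q0.
have v0 : 0 < value 0 by exact: expR_gt0.
pose K := value 0 * q * r / 2.
have K0 : 0 < K by rewrite divr_gt0// !mulr_gt0.
have e0 : 0 < 1 - 2 * p j0 by have := pj0; lra.
(* [t] is so small that [t^(1 - 2 p_j0) <= K / 2]. *)
pose t := Num.min (r / 2) ((K / 2) `^ (1 - 2 * p j0)^-1).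
have t0 : 0 < t by rewrite lt_min divr_gt0//= powR_gt0// divr_gt0.
have tr : t < r.
  apply: (@le_lt_trans _ _ (r / 2)); first by rewrite ge_min lexx.
  by rewrite ltr_pdivrMr// ltr_pMr// ltr1n.
have tK : t `^ (1 - 2 * p j0) <= K / 2.
  have -> : K / 2 = ((K / 2) `^ (1 - 2 * p j0)^-1) `^ (1 - 2 * p j0).
    by rewrite -powRrM mulVf ?gt_eqF// powRr1// ltW// divr_gt0.
  apply: ge0_ler_powR; rewrite ?nnegrE ?powR_ge0 ?(ltW t0) ?(ltW e0)//.
  by rewrite ge_min lexx orbT.
have := main t; rewrite t0 tr => /(_ isT).
have y0 : 0 < t `^ (2 * p j0) by exact: powR_gt0.
have tE : t = t `^ (2 * p j0) * t `^ (1 - 2 * p j0).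
  rewrite -powRD; last by rewrite (gt_eqF t0) implybT.
  by rewrite addrC subrK powRr1// ltW.
rewrite {2}tE ler_pdivlMr// => H.
have V0 : 0 < value 0 * q * r by rewrite !mulr_gt0.
have : t `^ (2 * p j0) * (value 0 * q * r) <= t `^ (2 * p j0) * K.
  apply: (@le_trans _ _ (2 * (t `^ (2 * p j0) * t `^ (1 - 2 * p j0)))).
    by apply: le_trans H; rewrite le_eqVlt; apply/orP; left; apply/eqP; ring.
  have -> : t `^ (2 * p j0) * K = 2 * (t `^ (2 * p j0) * (K / 2)) by field.
  by rewrite ler_pM2l// ler_pM2l.
rewrite ler_pM2l// /K ler_pdivlMr// mulr_natr mulr2n -subr_ge0 opprD addrA subrr sub0r.
by rewrite oppr_ge0 leNgt V0.
Qed.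

End NonEqual.

(** * The theorem *)

Theorem theorem1p2 (R : realType) (n k : nat) (p : 'I_n -> R)
    (hn : (2 <= n)%N) (hk : (1 <= k <= n)%N) (hp : forall j, 0 < p j) :
  let E := ellipsoid p in
  let A := ellA p k in
  let m := mobius E A in
  let g := green E A in
  let RE := ellR p k in
  [/\ (* (a) *)
      forall z, E z -> g z = RE z,
      (* (b) *)
      (forall j, 2^-1 <= p j) ->
        forall z, E z -> m z = g z /\ g z = RE z,
      (* (c) *)
      k = 1%N -> n = 2%N ->
        (forall j2 : 'I_n, j2 = 1%N :> nat -> 2^-1 <= p j2) ->
        forall z, E z -> m z = g z /\ g z = RE z,
      (* (d) *)
      (exists j : 'I_n, (k <= j)%N /\ p j < 2^-1) ->
        ~ (forall z, E z -> m z = g z)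
    & (* (e) *)
      k = 2%N -> n = 2%N ->
        forall j1 j2 : 'I_n, j1 = 0%N :> nat -> j2 = 1%N :> nat ->
        p j1 <= p j2 ->
        2^-1 <= p j2 \/ 8 * p j1 + 4 * p j2 * (1 - p j2) > 1 ->
        forall z, E z -> m z = g z /\ g z = RE z].
Proof.
move=> E A m g RE.
have partA z : E z -> g z = RE z.
  move=> Ez; have [T [c [crit RT]]] := exists_critical hp hk Ez; rewrite /RE RT.
  exact: (green_critical hp Ez crit).
have convex z : E z ->
    (forall T c, critical p k z T c -> m z = critical_value p z T c) ->
    m z = g z /\ g z = RE z.
  move=> Ez H; split; last exact: partA.
  have [T [c [crit RT]]] := exists_critical hp hk Ez.
  by rewrite partA// /RE RT; exact: H.
split=> //.
- move=> ph z Ez; apply: convex => // T c crit.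
  by apply: (mobius_critical_convex hp Ez crit) => j _; exact: ph.
- move=> k1 n2 ph z Ez; apply: convex => // T c crit.
  apply: (mobius_critical_convex hp Ez crit) => j jT; apply: ph.
  have [i iT] := critical_neq0 Ez crit.
  have i0 : i = 0%N :> nat by have := critical_lt crit iT; rewrite k1; case: (nat_of_ord i).
  have : (j < 2)%N by rewrite -n2.
  case jE : (nat_of_ord j) => [|[|//]] // _.
  by move: jT; rewrite (_ : j = i) ?iT//; apply: val_inj; rewrite /= jE i0.
- by move=> [j [kj pj]]; exact: (mobius_neq_green hp hk kj pj).
move=> k2 n2 j1 j2 j10 j21 p12 h z Ez; apply: convex => // T c crit.
have ord2 (l : 'I_n) : l = j1 \/ l = j2.
  have : (l < 2)%N by rewrite -n2.
  by case lE : (nat_of_ord l) => [|[|//]] // _; [left|right]; apply: val_inj; rewrite /= lE.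
have p1 := hp j1; have p2 := hp j2.
have [/existsP[j jT]|/existsPn allT] := boolP [exists j, j \notin T]; last first.
  by apply: (mobius_critical_convex hp Ez crit) => j jT; have := allT j; rewrite jT.
have [i iT] := critical_neq0 Ez crit.
have ij : i != j by apply: contraNneq jT => <-.
have only_ij l : l != i -> l != j -> false.
  by move: ij; case: (ord2 l) => ->; case: (ord2 i) => ->; case: (ord2 j) => ->; rewrite ?eqxx.
have TE : T = [set i]%SET.
  apply/setP => l; rewrite inE; apply/idP/eqP => [lT|->//].
  apply/eqP/negPn/negP => li; suff: false by [].
  by apply: (only_ij l) => //; apply: contraNneq jT => <-.
have [pj|pj] := leP 2^-1 (p j).
  apply: (mobius_critical_convex hp Ez crit) => l.
  rewrite TE inE => li; suff -> : l = j by [].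
  by apply/eqP/negPn/negP => lj; have := only_ij l li lj.
rewrite TE in crit *.
apply: (mobius_critical_pair hp Ez crit ij _ only_ij); first by rewrite k2 -n2.
(* For [j = j2] the discriminant condition is the hypothesis; for [j = j1] it is
   weaker, as [p j1 <= p j2]. *)
case: (ord2 j) => jE; case: (ord2 i) => iE; move: ij pj; rewrite iE jE ?eqxx// => _ pj.
- case: h => h; nra.
- case: h => h; nra.
Qed.
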